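(* Let $(T,P)$ be an irreducible, transient, nearest neighbour random walk on a tree $T$ and let $o\in T$. Let $\partial T$ be the Martin boundary of $(T,P)$ and $\nu_x$, $x\in T$, the harmonic measures. The following are equivalent: (i) every infinite branching subtree of $T$ is transient; (ii) for any $x,y\in T$ such that $x\sim y$ and $T_{x,y}$ is infinite, we have $F(y,x)<1$; (iii) there exists $x\in T$ (equivalently, for every $x\in T$) such that $\operatorname{supp}(\nu_x)=\partial T$; (iv) there exists $x\in T$ (equivalently, for every $x\in T$) such that there exists a flux from $x$ to infinity, supported on each edge $(z,y)$ such that $T_{z,y}$ is infinite. If the Martin boundary of $T$ contains at least two elements, then any of the previous conditions is equivalent to the following one: (v) given any signed measure $\mu$ on $T$ with finite support, $\mu$ has the weak mean value property with respect to $o$ if and only if it has the strong mean value property with respect to $o$.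
   Context: $T$ is a (non-oriented) tree with at most countable vertex set, also denoted $T$. $P=(p(x,y))_{x,y\in T}$ is a Markov operator: $p(x,y)\ge0$, $\sum_y p(x,y)=1$, $(Pf)(x)=\sum_y p(x,y)f(y)$ whenever $\sum_y p(x,y)|f(y)|<\infty$ for all $x$. Nearest neighbour (adapted to the tree) means that $p(x,y)>0$ if and only if $x$ and $y$ are neighbours in $T$ (written $x\sim y$). An edge $(z,y)$ is an ordered pair of neighbours, i.e. a pair with $p(z,y)>0$. A function $f:T\to\mathbb R$ is harmonic if $Pf=f$; $\mathcal H(T,P)$ is the set of harmonic functions and $\mathcal H^\infty(T,P)$ the set of bounded ones. $Z_n$ denotes the associated Markov chain, $\Pr_x$ its law started from $x$, and $F(x,y)=\Pr_x(\exists n\ge0: Z_n=y)$ (so $F(x,x)=1$). For $x,y\in T$, $\Pi[x,y]$ is the unique geodesic from $x$ to $y$, and $T_{x,y}=\{w\in T: y\in\Pi[x,w]\}$ is the branching subtree of $y$ with respect to $x$. The walk is reversible, as is any nearest neighbour random walk on a tree: there is $m:T\to(0,\infty)$ with $a(x,y):=m(x)p(x,y)=m(y)p(y,x)$. Transience of a branching subtree and fluxes are understood in the usual sense of network theory. An infinite branching subtree is transient if the nearest neighbour random walk on it determined by the conductances $a(\cdot,\cdot)$ restricted to its edges is transient. A flux from $x$ to infinity is a function $\varphi$ on edges with $\varphi(z,y)=-\varphi(y,z)$, $\sum_{y\sim z}\varphi(z,y)=\delta_x(z)$ for all $z\in T$ (where $\delta_x(z)$ is $1$ if $z=x$ and $0$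 otherwise), and finite energy $\sum\varphi(z,y)^2/a(z,y)<\infty$. It is supported on an edge $(z,y)$ if $\varphi(z,y)\neq0$. A compactification of the discrete set $T$ is a compact Hausdorff space $\widehat T$ containing $T$ as an open, discrete, dense subset. The Martin kernel is $k_o(x,y)=F(x,y)/F(o,y)$. The Martin compactification $\widehat T$ is the unique (up to homeomorphism) smallest compactification of the discrete set $T$ to which all functions $k_o(x,\cdot)$, $x\in T$, extend continuously (it does not depend on $o$, up to homeomorphism); $\partial T=\widehat T\setminus T$ is the Martin boundary. For every starting point $x$ the chain converges $\Pr_x$-almost surely to a $\partial T$-valued random variable $Z_\infty$, and the harmonic measures are $\nu_x(A)=\Pr_x(Z_\infty\in A)$ for Borel $A\subseteq\partial T$ (they are mutually absolutely continuous). For a signed measure $\mu$ of finite variation on the power set of $T$ and $h\in L^1(|\mu|)$, put $L(h,\mu)(x)=\int_T h\,d\mu-\mu(T)h(x)$. The measure $\mu$ has the strong (resp. weak) mean value property with respect to $o$ if $L(h,\mu)(o)=0$ for all $h\in\mathcal H(T,P)\cap L^1(|\mu|)$ (resp. for all $h\in\mathcal H^\infty(T,P)$).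
   Formalization: Assumed in addition: each vertex of infinite degree has infinitely many neighbours whose branching subtrees (seen from it) are infinite; otherwise (iii) always fails though (i) may hold. In (iv) the flux must be nonzero only on edges (z,y) directed away from x (x not in T_{z,y}). *)

(* Defs.v *)
From HB Require Import structures.
From mathcomp Require Import all_boot all_order all_algebra.
From mathcomp Require Import all_classical all_reals all_analysis.

Set Implicit Arguments.
Unset Strict Implicit.
Unset Printing Implicit Defensive.

Import Order.TTheory GRing.Theory Num.Theory.
Import numFieldNormedType.Exports.

Local Open Scope classical_set_scope.
Local Open Scope ring_scope.

Section AbsoluteSums.
Variables (R : realType) (I : choiceType).

(* \esum is only a sum for nonnegative families; signed families are summed as
   the difference of the sums of their positive and negative parts. *)
Definition has_sum (A : set I) (f : I -> R) (s : R) : Prop :=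
  summable A (EFin \o f) /\
  (\esum_(i in A) (EFin \o f)^\+ i - \esum_(i in A) (EFin \o f)^\- i)%E = s%:E.

End AbsoluteSums.

Section Trees.
Variable T : countType.
Implicit Types (e : rel T) (x y z w : T) (s : seq T).

(* x :: s lists the vertices of a self-avoiding path from x to y. *)
Definition simple_path e x y s : bool :=
  [&& path e x s, last x s == y & uniq (x :: s)].

Definition is_tree e : Prop :=
  [/\ irreflexive e, symmetric e & forall x y, exists! s, simple_path e x y s].

(* y lies on the geodesic from x to w. *)
Definition on_geodesic e x w y : Prop :=
  exists2 s, simple_path e x w s & y \in x :: s.

Definition branch e x y : set T := [set w | on_geodesic e x w y].

(* Every vertex of infinite degree has infinitely many infinite branches; this
   is vacuous when the tree is locally finite.  A vertex y which violates it
   carries infinitely many finite branches, and these accumulate at an isolated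
   boundary point that no harmonic measure charges. *)
Definition ramified_at_infinite_degree e : Prop :=
  forall y, infinite_set [set z | e y z] ->
    infinite_set [set z | e y z /\ infinite_set (branch e y z)].

End Trees.

Section RandomWalks.
Variables (R : realType) (T : countType).
Implicit Types (S : set T) (q p : T -> T -> R) (e : rel T) (m : T -> R).

Fixpoint nstep S q (n : nat) (x y : T) : \bar R :=
  if n is k.+1 then (\esum_(z in S) ((q x z)%:E * nstep S q k z y))%E
  else ((x == y)%:R)%:E.

Definition green S q (x y : T) : \bar R :=
  (\sum_(0 <= n <oo) nstep S q n x y)%E.

Definition transient_on S q : Prop :=
  forall x y, S x -> S y -> (green S q x y < +oo)%E.

Definition markov_operator p : Prop :=
  (forall x y, 0 <= p x y) /\
  (forall x, (\esum_(y in [set: T]) (p x y)%:E)%E = 1%E).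

Definition nearest_neighbour e p : Prop := forall x y, 0 < p x y <-> e x y.

Definition irreducible p : Prop :=
  forall x y, exists n, (0 < nstep [set: T] p n x y)%E.

Definition transient p : Prop := transient_on [set: T] p.

Definition reversing p m : Prop :=
  (forall x, 0 < m x) /\ (forall x y, m x * p x y = m y * p y x).

Definition conductance p m (x y : T) : R := m x * p x y.

(* The walk on S whose conductances are those of a between vertices of S. *)
Definition restricted_walk (a : T -> T -> R) S (x y : T) : R :=
  a x y / fine (\esum_(z in S) (a x z)%:E)%E.

Definition harmonic_function p (h : T -> R) : Prop :=
  forall x, has_sum [set: T] (fun y => p x y * h y) (h x).

Definition bounded_on_tree (h : T -> R) : Prop := exists M, forall x, `|h x| <= M.

Definition flux_to_infinity e (a : T -> T -> R) (x : T) (phi : T -> T -> R) :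
    Prop :=
  [/\ forall z y, e z y -> phi z y = - phi y z,
      forall z, has_sum [set y | e z y] (phi z) (z == x)%:R
    & (\esum_(zy in [set zy : T * T | e zy.1 zy.2])
         (phi zy.1 zy.2 ^+ 2 / a zy.1 zy.2)%:E < +oo)%E].

(* Edges are oriented away from x: x does not belong to branch e z y.  Towards x
   the branch may be infinite while every flux from x vanishes on the edge, for
   instance when z is a leaf other than x. *)
Definition supported_on_infinite_branches e (x : T) (phi : T -> T -> R) : Prop :=
  forall z y, e z y -> ~ branch e z y x -> infinite_set (branch e z y) ->
    phi z y != 0.

End RandomWalks.

Section MarkovChain.
Variables (R : realType) (T : countType).
Variables (d : measure_display) (Omega : measurableType d).
Variables (Pr : T -> probability Omega R) (Z : nat -> Omega -> T).

Definition markov_chain (p : T -> T -> R) : Prop :=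
  (forall n y, measurable (Z n @^-1` [set y])) /\
  (forall x n (s : nat -> T),
    Pr x [set w | forall i, (i <= n)%N -> Z i w = s i] =
    ((s 0%N == x)%:R * \prod_(i < n) p (s i) (s i.+1))%:E).

Definition hitting (x y : T) : R := fine (Pr x [set w | exists n, Z n w = y]).

Definition martin_kernel (o x y : T) : R := hitting x y / hitting o y.

End MarkovChain.

Section Compactifications.
Variables (R : realType) (T : countType).

(* iota identifies T with an open, discrete, dense subset of X. *)
Definition compactification (X : topologicalType) (iota : T -> X) : Prop :=
  [/\ compact [set: X], hausdorff_space X, injective iota,
      forall x, open [set iota x] & dense (range iota)].

Definition all_extend (K : T -> T -> R) (X : topologicalType) (iota : T -> X) :
    Prop :=
  forall x, exists2 g : X -> R, continuous g & forall y, g (iota y) = K x y.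

(* Smallest: every other such compactification maps continuously onto X over T
   (a map over T between compactifications is automatically onto). *)
Definition martin_compactification (K : T -> T -> R)
    (X : topologicalType) (iota : T -> X) : Prop :=
  [/\ compactification iota, all_extend K iota
    & forall (Y : topologicalType) (j : T -> Y),
        compactification j -> all_extend K j ->
        exists2 f : Y -> X, continuous f & forall y, f (j y) = iota y].

Definition boundary (X : topologicalType) (iota : T -> X) : set X :=
  ~` range iota.

End Compactifications.

Section HarmonicMeasures.
Variables (R : realType) (T : countType).
Variables (d : measure_display) (Omega : measurableType d).
Variables (Pr : T -> probability Omega R) (Z : nat -> Omega -> T).
Variables (X : topologicalType) (iota : T -> X) (Zoo : Omega -> X).

(* Zoo is a random variable (for the Borel sets) with values in the boundary. *)
Definition boundary_limit : Prop :=
  [/\ forall U : set X, open U -> measurable (Zoo @^-1` U),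
      forall w, boundary iota (Zoo w)
    & forall x, {ae Pr x, forall w, (fun n => iota (Z n w)) @ \oo --> Zoo w}].

Definition harmonic_measure (x : T) (A : set X) : \bar R :=
  Pr x (Zoo @^-1` A).

Definition harmonic_support (x : T) : set X :=
  [set xi | boundary iota xi /\
    forall U : set X, open U -> U xi ->
      (0 < harmonic_measure x (U `&` boundary iota))%E].

End HarmonicMeasures.

(* T with the power set as sigma-algebra; measurable types are pointed, whence
   the base point o. *)
Definition discrete_space (T : countType) (o : T) : Type := T.

Section DiscreteSpace.
Variables (T : countType) (o : T).

HB.instance Definition _ := Choice.on (discrete_space o).
HB.instance Definition _ := isPointed.Build (discrete_space o) o.
HB.instance Definition _ := @isMeasurable.Build default_measure_display
  (discrete_space o) discrete_measurable discrete_measurable0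
  discrete_measurableC discrete_measurableU.

End DiscreteSpace.

Section MeanValue.
Variables (R : realType) (T : countType) (o : T).
(* A charge is finite, hence of finite variation. *)
Implicit Types (mu : {charge set (discrete_space o) -> \bar R}) (h : T -> R).

Lemma hahn_sig mu :
  {PN : set (discrete_space o) * set (discrete_space o)
  | hahn_decomposition mu PN.1 PN.2}.
Proof.
apply: cid; have [P [N PN]] := Hahn_decomposition mu.
by exists (P, N).
Qed.

Definition charge_integrable mu h : Prop :=
  (charge_variation (proj2_sig (hahn_sig mu))).-integrable
    [set: discrete_space o] (EFin \o h).

Definition charge_integral mu h : \bar R :=
  (\int[jordan_pos (proj2_sig (hahn_sig mu))]_x (h x)%:E -
   \int[jordan_neg (proj2_sig (hahn_sig mu))]_x (h x)%:E)%E.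

Definition mean_deviation h mu (x : T) : \bar R :=
  (charge_integral mu h - mu [set: discrete_space o] * (h x)%:E)%E.

Definition finite_support_charge mu : Prop :=
  finite_set [set x : discrete_space o | mu [set x] != 0%E].

Definition strong_mean_value (p : T -> T -> R) mu : Prop :=
  forall h, harmonic_function p h -> charge_integrable mu h ->
    mean_deviation h mu o = 0%E.

Definition weak_mean_value (p : T -> T -> R) mu : Prop :=
  forall h, harmonic_function p h -> bounded_on_tree h -> mean_deviation h mu o = 0%E.

End MeanValue.

(* Main.v *)
Require Import Defs.
From HB Require Import structures.
From mathcomp Require Import all_boot all_order all_algebra.
From mathcomp Require Import all_classical all_reals all_analysis.
From mathcomp Require Import ring lra.

(** Write F(x,y) for the probability that the walk from x ever visits y, and
G(x,y) for its Green function.  Each condition is compared with (ii).  All the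
comparisons rest on one fact: deleting an edge disconnects the tree, so a walk
that crosses over must use that edge, and F factorizes along geodesics
([hit_branch_near], [hit_branch_far]).  Hitting probabilities are handled
analytically, as Green functions of stopped walks: F(.,y) is the smallest
nonnegative supersolution that is at least one at y ([hit_minimal]), and most
inequalities come from exhibiting a supersolution.

(i) and (ii).  Let B be the branch cut off by the edge (x,y).  Splitting the walk
from y into excursions into B gives F(y,x) (1 - U) = p(y,x), where U is the mass
of the excursions that return to y.  The walk restricted to B returns to y with
probability U / (1 - p(y,x)), so it is transient exactly when F(y,x) < 1
([transient_branchesP]).

(ii) and (iv).  The gradient of G(.,x) is a flux from x, of finite energy because
the energies of the truncated Green functions are bounded; on an edge (z,y)
oriented away from x it is proportional to G(z,x) (1 - F(y,z)) ([flux_exists]).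
Conversely, pairing a flux through (z,y) with the truncated Green functions of the
walk restricted to the branch at y bounds their values at y, so the branch is
transient ([flux_edge_hit_lt1]).  The support condition only concerns edges
oriented away from x.  For any other edge (u,v) with an infinite branch, some ray in
that branch eventually points away from x; if F(v,u) were one, then every vertex of
the branch would reach u almost surely, also across the edges of the ray
([supported_flux_hit_lt1]).  Rays exist by the ramification hypothesis.

(ii) and (iii).  By transience F(x,y) F(y,x) < 1, and therefore one of the Martin
kernels K(x,.), K(y,.) separates the branch B from its complement
([martin_separates]).  If F(y,x) = 1, the chain almost surely does not remain in B,
so no boundary point in the closure of B belongs to the support
([support_hit_lt1]).  Conversely, the Martin compactification is an image of the
closure of T in the product of lines given by the Martin kernels and the
indicators of the vertices.  A neighbourhood of a boundary point is thus described by
finitely many coordinates, all of them constant on every branch that leaves a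
large finite subtree, and it contains an infinite branch, again by ramification
([martin_nbhd_branch]).
Under (ii) the chain enters this branch and stays there with positive probability
([hit_lt1_support]).

(ii) and (v).  Under (ii) every harmonic function coincides on a finite set with a
bounded one, built from the functions 1_B (1 - F(.,x)); this gives (v)
([mean_value_of_transient]).  If F(y,x) = 1, then bounded harmonic functions agree
at x and y.  The potential of a unit current that arrives along a ray through y and
departs along a ray from x on the other side is harmonic and does not agree there,
and the unit mass at y, minus that at x, plus that at o is a charge that violates
(v) ([transient_of_mean_value]). *)

Set Implicit Arguments.
Unset Strict Implicit.
Unset Printing Implicit Defensive.

Import Order.TTheory GRing.Theory Num.Theory.
Import numFieldNormedType.Exports.

Local Open Scope classical_set_scope.
Local Open Scope ring_scope.

(** * Geometry of trees *)

Section TreeGeometry.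
Variables (T : countType) (e : rel T).
Hypothesis treeT : is_tree e.
Implicit Types (x y z u v w : T) (s : seq T) (S A : set T).

Let eirr : irreflexive e. Proof. by case: treeT. Qed.

Let esym : symmetric e. Proof. by case: treeT. Qed.

Lemma edge_neq x y : e x y -> x != y.
Proof. by move=> exy; apply/eqP => xy; rewrite xy eirr in exy. Qed.

Lemma tree_path x y : exists s, simple_path e x y s.
Proof. by case: treeT => _ _ /(_ x y)[s [ps _]]; exists s. Qed.

Lemma simple_path_uniq x y s s' :
  simple_path e x y s -> simple_path e x y s' -> s = s'.
Proof. by case: treeT => _ _ /(_ x y)[t [_ ut]] /ut <- /ut. Qed.

Lemma walk_simple_path x w s : path e x s -> last x s = w ->
  exists2 s', simple_path e x w s' & {subset s' <= s}.
Proof.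
move=> es; case: (shortenP es) => s' es' us' ss' sw; exists s' => //.
by apply/and3P; split => //; rewrite sw.
Qed.

(** A walk can be shortened to the geodesic with the same ends, so membership in
a branch may be tested on arbitrary walks. *)
Lemma branchP x y w :
  branch e x y w <-> forall s, path e x s -> last x s = w -> y \in x :: s.
Proof.
split=> [[t ht yt] s es sw|h].
  have [s' hs' ss'] := walk_simple_path es sw.
  move: yt; rewrite (simple_path_uniq ht hs') !inE => /orP[->//|/ss' ->].
  by rewrite orbT.
have [s hs] := tree_path x w; exists s => //.
by case/and3P: hs => es /eqP sw _; exact: h.
Qed.

(** For fixed y this is an equivalence relation on the vertices other than y; its
classes are the components left after y is deleted. *)
Definition avoids y x w :=
  exists s, [/\ path e x s, last x s = w & y \notin x :: s].

Lemma avoidsP y x w : avoids y x w <-> ~ branch e x y w.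
Proof.
split=> [[s [es sw ys]] /branchP /(_ s es sw)|]; first by rewrite (negbTE ys).
move=> /branchP /existsNP[s] /not_implyP[es] /not_implyP[sw /negP ys].
by exists s.
Qed.

Lemma avoids_refl x y : x != y -> avoids y x x.
Proof. by move=> xy; exists [::]; split; rewrite // inE eq_sym. Qed.

Lemma avoids_step x y z : x != y -> z != y -> e x z -> avoids y x z.
Proof.
move=> xy zy xz; exists [:: z]; split; rewrite /= ?xz //.
by rewrite !inE !negb_or !(eq_sym y) xy zy.
Qed.

Lemma avoids_trans y x z w : avoids y x z -> avoids y z w -> avoids y x w.
Proof.
move=> [s [es sz ys]] [t [et tw yt]]; exists (s ++ t); split.
- by rewrite cat_path es sz.
- by rewrite last_cat sz.
- move: ys yt; rewrite !inE mem_cat !negb_or => /andP[-> ->] /andP[_ ->] //.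
Qed.

Lemma avoids_sym y x w : avoids y x w -> avoids y w x.
Proof.
move=> [s [es sw ys]]; exists (rev (belast x s)); split.
- by rewrite -sw (eq_path (e' := fun z => e^~ z)) ?rev_path.
- by case: s es sw ys => // z s _ _ _; rewrite /= rev_cons last_rcons.
- apply: contra ys; rewrite -sw => /= ; rewrite inE mem_rev => /predU1P[->|].
    exact: mem_last.
  exact: mem_belast.
Qed.

Lemma avoids_neq y x w : avoids y x w -> w != y.
Proof.
move=> [s [_ <- ys]]; apply: contra ys => /eqP <-; exact: mem_last.
Qed.

Lemma branch_self x y : branch e x y y.
Proof. by apply/branchP => s _ <-; exact: mem_last. Qed.

Lemma branch_src x y : x != y -> ~ branch e x y x.
Proof. by move=> xy; apply/avoidsP/avoids_refl. Qed.

Lemma branch_edge_src x y : e x y -> ~ branch e x y x.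
Proof. by move/edge_neq/branch_src. Qed.

(** Deleting the edge leaves two components, one on each side. *)
Lemma branchC x y w : e x y -> branch e y x w <-> ~ branch e x y w.
Proof.
move=> exy; split=> [yxw [t ht yt]|/avoidsP[s [es sw ys]]].
  have yx : y != x by rewrite eq_sym edge_neq.
  move: yt; rewrite inE (negbTE yx)/= => yt.
  case/splitPr: yt ht => t1 t2 /and3P[].
  rewrite cat_path last_cat /= => /and3P[_ _ et2] t2w /andP[xt _].
  move/branchP: yxw => /(_ t2 et2 (eqP t2w)).
  by move: xt; rewrite mem_cat negb_or => /andP[_ /negbTE ->].
have [s' hs' ss'] := walk_simple_path es sw.
exists (x :: s'); last by rewrite !inE eqxx orbT.
case/and3P: hs' => es' s'w us'; apply/and3P; split => //=.
  by rewrite esym exy.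
move: us' => /= ->; rewrite andbT; apply: contra ys; rewrite !inE.
by move=> /orP[->//|/ss' ->]; rewrite orbT.
Qed.

(** A second edge between the two sides would join them off x or off y. *)
Lemma branch_cross x y u v : e x y -> e u v ->
  branch e x y u -> ~ branch e x y v -> u = y /\ v = x.
Proof.
have key a b c d : e a b -> e c d -> branch e a b c -> ~ branch e a b d -> c = b.
  move=> ab cd abc /avoidsP abd; apply/eqP/negPn/negP => cb.
  move: abc; apply/avoidsP; apply: (avoids_trans abd).
  by apply: avoids_step => //; [exact: avoids_neq abd|rewrite esym].
move=> exy euv xyu xyv; split; first exact: key exy euv xyu xyv.
apply: (key y x v u); rewrite 1?esym //.
- by apply/branchC.
- by move/branchC; apply.
Qed.

Lemma branch_nbr x y w z : e x y -> branch e x y w -> w != y -> e w z -> branch e x y z.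
Proof.
move=> exy Bw wy ewz; apply: contrapT => nBz.
by have [wy' _] := branch_cross exy ewz Bw nBz; rewrite wy' eqxx in wy.
Qed.

(** Otherwise some walk from x to w avoids y.  Preceded by the edge (y,x) it has to
pass through z, so it also joins x to z off y, although z lies behind y. *)
Lemma branch_nest x y z : e x y -> e y z -> z != x ->
  branch e y z `<=` branch e x y.
Proof.
move=> exy eyz zx w yzw; apply: contrapT => /avoidsP xyw.
have xyz : branch e x y z.
  apply: contrapT => nz.
  have [_ zx'] := branch_cross exy eyz (branch_self x y) nz.
  by rewrite zx' eqxx in zx.
case: xyw => s [es sw ys].
have /branchP/(_ (x :: s)) := yzw; rewrite /= esym exy es sw => /(_ isT erefl).
rewrite inE eq_sym (negbTE (edge_neq eyz)) /= => zs.
move: xyz; apply/avoidsP.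
case/splitPl: zs es ys sw => s1 s2 s1z; rewrite cat_path => /andP[es1 _] ys _.
exists s1; split => //; apply: contra ys; rewrite !inE mem_cat.
by move=> /orP[->|->]; rewrite ?orbT.
Qed.

Lemma branch_decomp x y w : e x y -> branch e x y w -> w != y ->
  exists z, [/\ e y z, z != x & branch e y z w].
Proof.
move=> exy xyw wy; have [s hs] := tree_path y w.
have nyx : ~ branch e y x w by move/branchC => /(_ exy).
case: s hs => [|z s] hs.
  by case/and3P: hs => _ /= /eqP yw; rewrite yw eqxx in wy.
exists z; split.
- by case/and3P: hs => /= /andP[].
- apply/eqP => zx; apply: nyx; exists (z :: s) => //.
  by rewrite zx !inE eqxx orbT.
- by exists (z :: s) => //; rewrite !inE eqxx orbT.
Qed.

Lemma branch_disjoint y z z' w : e y z -> e y z' -> z != z' ->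
  branch e y z w -> ~ branch e y z' w.
Proof.
move=> eyz eyz' zz' yzw yz'w.
have ezy : e z y by rewrite esym.
have /branchC : branch e z y w.
  by apply: (branch_nest ezy eyz') yz'w; rewrite eq_sym.
by move/(_ eyz); apply.
Qed.

Lemma tree_ind (Q : T -> Prop) x : Q x -> (forall u v, e u v -> Q u -> Q v) ->
  forall w, Q w.
Proof.
move=> Qx Qs w; have [s /and3P[es /eqP <- _]] := tree_path x w.
elim: s x Qx es => //= z s IH x Qx /andP[exz es].
by apply: IH es; exact: Qs Qx.
Qed.

(** A branch is connected: an edge that enters it ends at its root. *)
Lemma branch_ind (Q : T -> Prop) x y : e x y -> Q y ->
  (forall u v, e u v -> branch e x y u -> branch e x y v -> Q u -> Q v) ->
  forall w, branch e x y w -> Q w.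
Proof.
move=> exy Qy Qs w xyw.
suff : forall w, (branch e x y w -> Q w) by apply.
apply: (tree_ind (x := y)) => // u v euv Qu xyv.
have [xyu|nu] := pselect (branch e x y u); first by apply: Qs (Qu xyu).
have evu : e v u by rewrite esym.
by have [-> _] := branch_cross exy evu xyv nu.
Qed.

(** Only the last edge of the geodesic from x to y matters, which reduces branches
seen from arbitrary vertices to those cut off by an edge. *)
Lemma branch_edge x y : x != y ->
  exists2 x', e x' y & branch e x y = branch e x' y.
Proof.
move=> xy; have [s] := tree_path x y.
case: (lastP s) => [|{}s z] /and3P[].
  by move=> _ /= /eqP xy'; rewrite xy' eqxx in xy.
rewrite rcons_path last_rcons => /andP[es ez] /eqP zy us; subst z.
exists (last x s) => //.
have av : avoids y x (last x s).
  exists s; split => //; move: us; rewrite /= rcons_uniq mem_rcons !inE negb_or.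
  by rewrite (eq_sym y) negb_or => /and3P[/andP[-> _] -> _].
apply/seteqP; split=> w.
  move=> h; apply: contrapT => /avoidsP g; move: h; apply/avoidsP.
  exact: avoids_trans av g.
move=> h; apply: contrapT => /avoidsP g; move: h; apply/avoidsP.
exact: avoids_trans (avoids_sym av) g.
Qed.

Lemma branch_refl x : branch e x x = [set: T].
Proof. by apply/seteqP; split=> // w _; apply/branchP => s _ _; rewrite inE eqxx. Qed.

(** Convexity, phrased through branches: a convex set that meets the branch behind
an edge leaving c contains the end of this edge. *)
Definition subtree S :=
  forall c z a, S c -> S a -> e c z -> branch e c z a -> S z.

Lemma subtree1 x : subtree [set x].
Proof. by move=> c z a -> -> /edge_neq/branch_src. Qed.

Lemma subtreeU1 S c v : subtree S -> S c -> e c v -> subtree (v |` S).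
Proof.
move=> sS Sc ecv c' z a.
have [Sv|nSv] := pselect (S v).
  have -> : v |` S = S by apply/seteqP; split=> t; [move=> [->|]|right].
  exact: sS.
have evc : e v c by rewrite esym.
move=> [->|Sc'] [->|Sa] ez za.
- by case: (branch_src (edge_neq ez)).
- have [->|zc] := eqVneq z c; first by right.
  case: nSv; apply: (sS c v a) => //.
  exact: (branch_nest ecv ez zc).
- have [->|zv] := eqVneq z v; first by left.
  right; apply: (sS c' z c) => //; apply: contrapT => nzc.
  by have [vz _] := branch_cross ez evc za nzc; rewrite vz eqxx in zv.
- by right; exact: sS Sc' Sa ez za.
Qed.

(** Finite subtrees grow one vertex at a time, so a property that survives each
such extension holds of arbitrarily large finite subtrees. *)
Lemma subtree_hull (Q : set T -> Prop) o A : Q [set o] ->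
  (forall S c v, finite_set S -> subtree S -> S o -> S c -> e c v -> ~ S v ->
    Q S -> Q (v |` S)) ->
  finite_set A -> exists S, [/\ finite_set S, subtree S, S o, A `<=` S & Q S].
Proof.
move=> Qo Qs /finite_seqP[s ->]; elim: s => [|a s [S [fS tS So sS QS]]].
  by exists [set o]; split => //; exact: subtree1.
have [S' [fS' tS' SS' S'a QS']] : exists S', [/\ finite_set S', subtree S',
    S `<=` S', S' a & Q S'].
  move: a; apply: (tree_ind (x := o)); first by exists S; split.
  move=> u v euv [S' [fS' tS' SS' S'u QS']].
  have [S'v|nS'v] := pselect (S' v); first by exists S'; split.
  exists (v |` S'); split.
  - by rewrite finite_setU; split => //; exact: finite_set1.
  - exact: subtreeU1 tS' S'u euv.
  - by move=> t /SS'; right.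
  - by left.
  - by apply: (Qs S' u v) => //; exact: SS'.
exists S'; split => //; first exact: SS'.
by move=> t /=; rewrite inE => /predU1P[->//|/sS/SS'].
Qed.

(** This distributes the vertices off a subtree among the branches behind the edges
that leave it. *)
Lemma subtree_exit S x w : S x -> ~ S w ->
  exists c z, [/\ S c, ~ S z, e c z & branch e c z w].
Proof.
move=> Sx nSw.
suff : forall w, S w \/ exists c z, [/\ S c, ~ S z, e c z & branch e c z w].
  by move=> /(_ w)[].
apply: (tree_ind (x := x)); first by left.
move=> u v euv [Su|[c [z [Sc nSz ecz czu]]]].
  have [|nSv] := pselect (S v); first by left.
  by right; exists u, v; split => //; exact: branch_self.
have [czv|nczv] := pselect (branch e c z v); first by right; exists c, z.
by have [_ ->] := branch_cross ecz euv czu nczv; left.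
Qed.

Section Ramified.
Hypothesis ramT : ramified_at_infinite_degree e.

(** When c has finitely many neighbours this is the pigeonhole principle;
otherwise the ramification hypothesis provides infinitely many infinite branches at
c, and A cannot contain all their roots. *)
Lemma infinite_subbranch c A : finite_set A ->
  infinite_set (\bigcup_(z in [set z | e c z /\ ~ A z]) branch e c z) ->
  exists z, [/\ e c z, ~ A z & infinite_set (branch e c z)].
Proof.
move=> fA iU; apply: contrapT => no.
have nz z : e c z -> ~ A z -> finite_set (branch e c z).
  by move=> ez Az; apply: contrapT => inf; apply: no; exists z.
have [fd|/ramT id] := pselect (finite_set [set z | e c z]).
  apply: iU; apply: bigcup_finite; last by move=> z [? ?]; exact: nz.
  by apply: sub_finite_set fd => z [].
apply: id; apply: sub_finite_set fA => z /= [ez iz].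
by apply: contrapT => Az; apply: iz; exact: nz.
Qed.

Lemma infinite_child x y : e x y -> infinite_set (branch e x y) ->
  exists z, [/\ e y z, z != x & infinite_set (branch e y z)].
Proof.
move=> exy ixy.
have [//||z [eyz zx iz]] := @infinite_subbranch y [set x].
  move=> fU; apply: ixy.
  apply: (@sub_finite_set _ _ (y |` _)); last first.
    by rewrite finite_setU; split; [exact: finite_set1|exact: fU].
  move=> w xyw; have [->|wy] := eqVneq w y; first by left.
  have [z [eyz zx yzw]] := branch_decomp exy xyw wy.
  by right; exists z => //; split => //; exact/eqP.
by exists z; split => //; exact/eqP.
Qed.

(** The condition on g n.+2 excludes turning back; together with the infinite
branch ahead it makes the vertices of a ray pairwise distinct. *)
Definition ray (g : nat -> T) := forall n,
  [/\ e (g n) (g n.+1), g n.+2 != g n & infinite_set (branch e (g n) (g n.+1))].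

Lemma ray_exists x y : e x y -> infinite_set (branch e x y) ->
  exists g, [/\ ray g, g 0%N = x & g 1%N = y].
Proof.
move=> exy iB.
pose good (k : T * T) := e k.1 k.2 /\ infinite_set (branch e k.1 k.2).
have next (k : {k | good k}) : {k' : {k | good k} |
    (sval k').1 = (sval k).2 /\ (sval k').2 != (sval k).1}.
  apply: cid; case: k => -[u v] /= [euv ib].
  have [z [evz zu iz]] := infinite_child euv ib.
  have gd : good (v, z) by [].
  by exists (exist _ (v, z) gd).
pose k n := iter n (fun k => sval (next k)) (exist good (x, y) (conj exy iB)).
have kS n : (sval (k n.+1)).1 = (sval (k n)).2 /\
    (sval (k n.+1)).2 != (sval (k n)).1 by exact: svalP (next (k n)).
exists (fun n => (sval (k n)).1); split => //; last by have [->] := kS 0%N.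
move=> n; have [E1 N1] := kS n; have [E2 _] := kS n.+1.
rewrite E2 N1 E1; have [h1 h2] := svalP (k n); by split.
Qed.

Section RayGeometry.
Variable g : nat -> T.
Hypothesis rayg : ray g.
Local Notation B n := (branch e (g n) (g n.+1)).

Lemma ray_nest n k : (n <= k)%N -> B k `<=` B n.
Proof.
move=> nk; rewrite -(subnKC nk); elim: (k - n)%N => [|j IH]; first by rewrite addn0.
rewrite addnS; apply: subset_trans IH.
have [e1 n1 _] := rayg (n + j); have [e2 _ _] := rayg (n + j).+1.
exact: branch_nest.
Qed.

Lemma ray_notin n k : (n <= k)%N -> ~ B k (g n).
Proof.
by move=> nk /(ray_nest nk); apply: branch_edge_src; have [] := rayg n.
Qed.

(** The branches along a ray decrease to the empty set.  The property spreads along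
edges: a neighbour of a vertex outside all late branches can lie in one of them
only as its root, which is a vertex of the ray. *)
Lemma ray_leaves w : exists N, forall n, (N <= n)%N -> ~ B n w.
Proof.
move: w; apply: (tree_ind (x := g 0%N)).
  by exists 0%N => n _; exact: ray_notin.
move=> u v euv [N hN].
have [[n [Nn Bnv]]|no] := pselect (exists n, (N <= n)%N /\ B n v); last first.
  by exists N => n Nn Bnv; apply: no; exists n.
have [en _ _] := rayg n; have evu : e v u by rewrite esym.
have [-> _] := branch_cross en evu Bnv (hN n Nn).
by exists n.+1 => k nk; exact: ray_notin.
Qed.

End RayGeometry.
End Ramified.
End TreeGeometry.

(** * Sums of families *)

Section NonnegativeSums.
Variables (R : realType).
Local Open Scope ereal_scope.

(** One inequality, applied to c and then to its inverse, gives the equality. *)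
Lemma esumZl (I : choiceType) (S : set I) (c : R) (f : I -> \bar R) :
  (0 <= c)%R -> (forall i, 0 <= f i) ->
  \esum_(i in S) (c%:E * f i) = c%:E * \esum_(i in S) f i.
Proof.
have key (a : R) (g : I -> \bar R) : (0 <= a)%R -> (forall i, 0 <= g i) ->
    \esum_(i in S) (a%:E * g i) <= a%:E * \esum_(i in S) g i.
  move=> a0 g0; apply: ge_ereal_sup => _ [X SX <-].
  rewrite -ge0_mule_fsumr//; apply: lee_pmul => //.
    by apply: fsume_ge0 => i _.
  by apply: ereal_sup_ubound; exists X.
move=> c0 f0; apply/eqP; rewrite eq_le key//=.
have [->|cn0] := eqVneq c 0%R.
  by rewrite mul0e; apply: esum_ge0 => i _; rewrite mul0e.
have {cn0}c0 : (0 < c)%R by rewrite lt_neqAle eq_sym cn0.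
have cf0 i : 0 <= c%:E * f i by rewrite mule_ge0// lee_fin ltW.
have ci0 : (0 <= c^-1)%R by rewrite invr_ge0 ltW.
rewrite (eq_esum (b := fun i => c^-1%:E * (c%:E * f i))); last first.
  by move=> i _; rewrite muleA -EFinM mulVf ?gt_eqF// mul1e.
apply: (@le_trans _ _ (c%:E * (c^-1%:E * \esum_(i in S) (c%:E * f i)))).
  by apply: lee_pmul => //; [rewrite lee_fin ltW|apply: esum_ge0 => i _;
    rewrite mule_ge0// lee_fin|exact: key].
by rewrite muleA -EFinM divff ?gt_eqF// mul1e.
Qed.

Lemma esum_exchange (I J : choiceType) (A : set I) (B : set J)
    (a : I -> J -> \bar R) : (forall i j, 0 <= a i j) ->
  \esum_(i in A) \esum_(j in B) a i j = \esum_(j in B) \esum_(i in A) a i j.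
Proof.
move=> a0; rewrite !esum_esum//.
rewrite (reindex_esum (B `*`` (fun=> A)) _ (fun k => (k.2, k.1)))//; split.
- by move=> [i j] [/=].
- by move=> [i1 i2] [j1 j2] /= _ _ [] -> ->.
- by move=> [i1 i2] [Pi1 Qi2] /=; exists (i2, i1).
Qed.

Lemma esum_term (I : choiceType) (S : set I) (f : I -> \bar R) i :
  (forall i, 0 <= f i) -> S i -> f i <= \esum_(i in S) f i.
Proof.
move=> f0 Si; rewrite -(esum_set1 (f0 i)).
rewrite esum_mkcond [leRHS]esum_mkcond; apply: le_esum => j _.
case: ifPn => [|_]; last by case: ifP.
by rewrite inE => ->; rewrite mem_set.
Qed.

Lemma esum_single (I : choiceType) (S : set I) (f : I -> \bar R) i :
  0 <= f i -> S i -> (forall j, S j -> j != i -> f j = 0) ->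
  \esum_(j in S) f j = f i.
Proof.
move=> fi Si f0; rewrite -(esum_set1 fi) esum_mkcond [RHS]esum_mkcond.
apply: eq_esum => j _; have [->|ji] := eqVneq j i; first by rewrite !mem_set.
rewrite (@memNset _ [set i]); last by move=> /= ji'; rewrite ji' eqxx in ji.
by case: ifPn => //; rewrite inE => /f0; apply.
Qed.

Lemma le_esum_sub (I : choiceType) (S S' : set I) (f : I -> \bar R) :
  (forall i, 0 <= f i) -> S `<=` S' ->
  \esum_(i in S) f i <= \esum_(i in S') f i.
Proof.
move=> f0 sS; rewrite esum_mkcond [leRHS]esum_mkcond; apply: le_esum => j _.
case: ifPn => [|_]; last by case: ifP.
by rewrite inE => /sS Sj; rewrite mem_set.
Qed.

(** Two finite sums with the same value leave no room for a strict inequality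
between terms. *)
Lemma esum_eq_term (I : choiceType) (S : set I) (f g : I -> R) (s : R) :
  (forall i, 0 <= f i)%R -> (forall i, S i -> f i <= g i)%R ->
  \esum_(i in S) (f i)%:E = s%:E -> \esum_(i in S) (g i)%:E = s%:E ->
  forall i, S i -> f i = g i.
Proof.
move=> f0 fg sf sg i Si; apply/eqP; rewrite eq_le fg//=.
pose d j := if j \in S then (g j - f j)%R else 0%R.
have d0 j : (0 <= d j)%R by rewrite /d; case: ifPn => // /set_mem/fg; rewrite subr_ge0.
have : \esum_(i in S) (f i)%:E + \esum_(i in S) (d i)%:E = s%:E.
  rewrite -esumD; [|by move=> *; rewrite lee_fin..].
  rewrite -sg; apply: eq_esum => j Sj.
  by rewrite /d mem_set// -EFinD addrC subrK.
rewrite sf => sd.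
have {sd} sd : \esum_(i in S) (d i)%:E = 0.
  move: sd; case: (\esum_(i in S) (d i)%:E) => //= r [] /eqP.
  by move=> /eqP sr; congr (_%:E); apply: (addrI s); rewrite addr0.
have := @esum_term _ S (EFin \o d) i _ Si; rewrite sd.
move=> /(_ (fun j => d0 j)); rewrite lee_fin /d mem_set//.
by rewrite subr_le0.
Qed.

Lemma esum_nneseries (I : choiceType) (S : set I) (f : nat -> I -> \bar R) :
  (forall n i, 0 <= f n i) ->
  \esum_(i in S) \sum_(0 <= n <oo) f n i =
  \sum_(0 <= n <oo) \esum_(i in S) f n i.
Proof.
move=> f0; rewrite nneseries_esumT; last by move=> n; exact: esum_ge0.
rewrite -esum_exchange//; apply: eq_esum => i _.
by rewrite nneseries_esumT.
Qed.

Lemma le_nneseries (u : nat -> \bar R) l : (forall n, 0 <= u n) ->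
  (forall n, \sum_(0 <= k < n) u k <= l) -> \sum_(0 <= k <oo) u k <= l.
Proof.
move=> u0 ul; apply: lime_le; last exact: nearW.
by apply: is_cvg_nneseries => n _ _; exact: u0.
Qed.

Lemma nneseries_recS (u : nat -> \bar R) : (forall n, 0 <= u n) ->
  \sum_(0 <= k <oo) u k = u 0%N + \sum_(0 <= k <oo) u k.+1.
Proof.
move=> u0; rewrite nneseries_recl// -nneseries_addn//; congr (_ + _).
by apply: eq_eseriesr => i _; rewrite addn1.
Qed.

End NonnegativeSums.

Section SignedSums.
Variables (R : realType) (I : choiceType).
Implicit Types (A : set I) (f g : I -> R).

Lemma has_sumB A f g (sf sg : R) : (forall i, 0 <= f i) -> (forall i, 0 <= g i) ->
  \esum_(i in A) (f i)%:E = sf%:E -> \esum_(i in A) (g i)%:E = sg%:E ->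
  has_sum A (fun i => f i - g i) (sf - sg).
Proof.
move=> f0 g0 sfE sgE.
have sumf : summable A (EFin \o f).
  rewrite /summable (eq_esum (b := fun i => (f i)%:E)) ?sfE ?ltry//.
  by move=> i _; rewrite /= ger0_norm.
have sumg : summable A (EFin \o g).
  rewrite /summable (eq_esum (b := fun i => (g i)%:E)) ?sgE ?ltry//.
  by move=> i _; rewrite /= ger0_norm.
have E : EFin \o (fun i => f i - g i) = ((EFin \o f) \- (EFin \o g))%E by [].
split; rewrite E; first exact: summableB.
rewrite esumB//.
- by rewrite [X in (X - _)%E]sfE [X in (_ - X)%E]sgE.
- by move=> i _; rewrite lee_fin.
- by move=> i _; rewrite lee_fin.
Qed.

(** All rules for signed sums are reduced to nonnegative families by this
decomposition. *)
Lemma has_sum_posneg A f s : has_sum A f s -> exists a b : R,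
  [/\ \esum_(i in A) (Num.max (f i) 0)%:E = a%:E,
      \esum_(i in A) (Num.max (- f i) 0)%:E = b%:E & s = a - b].
Proof.
move=> [sf E].
have Ep : \esum_(i in A) ((EFin \o f)^\+ i)%E = \esum_(i in A) (Num.max (f i) 0)%:E.
  by apply: eq_esum => i _; rewrite funeposE /= EFin_max.
have En : \esum_(i in A) ((EFin \o f)^\- i)%E = \esum_(i in A) (Num.max (- f i) 0)%:E.
  by apply: eq_esum => i _; rewrite funenegE /= EFin_max.
have fin (g : I -> \bar R) : (forall i, 0 <= g i)%E -> summable A g ->
    esum A g \is a fin_num.
  move=> g0 sg; rewrite ge0_fin_numE ?esum_ge0//; apply: le_lt_trans sg.
  by apply: le_esum => i _; rewrite gee0_abs.
have fp := fin _ (fun i => funepos_ge0 _ i) (summable_funepos sf).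
have fn := fin _ (fun i => funeneg_ge0 _ i) (summable_funeneg sf).
exists (fine (esum A (EFin \o f)^\+%E)), (fine (esum A (EFin \o f)^\-%E)); split.
- by rewrite fineK.
- by rewrite fineK.
- by apply: EFin_inj; rewrite -E EFinB !fineK.
Qed.

Lemma max_decomp (x : R) : Num.max x 0 - Num.max (- x) 0 = x.
Proof. by rewrite /Num.max; case: ltP => ?; case: ltP => ?; lra. Qed.

Lemma has_sum_unique A f s t : has_sum A f s -> has_sum A f t -> s = t.
Proof. by move=> [_ h] [_]; rewrite h => -[]. Qed.

Lemma eq_has_sum A f g s : (forall i, A i -> f i = g i) -> has_sum A f s ->
  has_sum A g s.
Proof.
move=> fg [sf E]; split.
  by move: sf; rewrite /summable (eq_esum (b := abse \o (EFin \o g)))// => i /fg /= ->.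
rewrite -E; congr (_ - _)%E; apply: eq_esum => i /fg fgi.
  by rewrite !funeposE /= fgi.
by rewrite !funenegE /= fgi.
Qed.

(** The positive part of a sum is not the sum of the positive parts, but any
decomposition into a difference of nonnegative summable families will do. *)
Lemma has_sumD A f g s t : has_sum A f s -> has_sum A g t ->
  has_sum A (fun i => f i + g i) (s + t).
Proof.
move=> /has_sum_posneg[a [b [fa fb ->]]] /has_sum_posneg[c [d [gc gd ->]]].
have -> : a - b + (c - d) = (a + c) - (b + d) by ring.
have mx0 (x : R) : 0 <= Num.max x 0 by rewrite le_max lexx orbT.
apply: (eq_has_sum (f := fun i => (Num.max (f i) 0 + Num.max (g i) 0) -
    (Num.max (- f i) 0 + Num.max (- g i) 0))).
  move=> i _; rewrite -[in RHS](max_decomp (f i)) -[in RHS](max_decomp (g i)).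
  ring.
apply: has_sumB.
- by move=> i; rewrite addr_ge0.
- by move=> i; rewrite addr_ge0.
- by rewrite EFinD -fa -gc -esumD// => i _; rewrite lee_fin.
- by rewrite EFinD -fb -gd -esumD// => i _; rewrite lee_fin.
Qed.

Lemma has_sumN A f s : has_sum A f s -> has_sum A (fun i => - f i) (- s).
Proof.
move=> /has_sum_posneg[a [b [fa fb ->]]].
have mx0 (x : R) : 0 <= Num.max x 0 by rewrite le_max lexx orbT.
rewrite opprB; apply: (eq_has_sum (f := fun i => Num.max (- f i) 0 - Num.max (f i) 0)).
  by move=> i _; rewrite -[in RHS](max_decomp (f i)) opprB.
exact: has_sumB.
Qed.

Lemma has_sum_ge0 A f s : (forall i, 0 <= f i) ->
  \esum_(i in A) (f i)%:E = s%:E -> has_sum A f s.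
Proof.
move=> f0 sf; rewrite -[s]subr0.
apply: (eq_has_sum (f := fun i => f i - 0)); first by move=> i _; rewrite subr0.
by apply: has_sumB => //; rewrite esum1.
Qed.

Lemma has_sumZ A f s (c : R) : has_sum A f s -> has_sum A (fun i => c * f i) (c * s).
Proof.
have pos (d : R) g t : 0 <= d -> has_sum A g t -> has_sum A (fun i => d * g i) (d * t).
  move=> d0 /has_sum_posneg[a [b [fa fb ->]]].
  have mx0 (x : R) : 0 <= Num.max x 0 by rewrite le_max lexx orbT.
  rewrite mulrBr; apply: (eq_has_sum
    (f := fun i => d * Num.max (g i) 0 - d * Num.max (- g i) 0)).
    by move=> i _; rewrite -mulrBr max_decomp.
  apply: has_sumB.
  - by move=> i; rewrite mulr_ge0.
  - by move=> i; rewrite mulr_ge0.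
  - by rewrite EFinM -fa -esumZl// => i; rewrite lee_fin.
  - by rewrite EFinM -fb -esumZl// => i; rewrite lee_fin.
move=> fs; have [c0|c0] := leP 0 c; first exact: pos.
have c0' : 0 <= - c by rewrite oppr_ge0 ltW.
have := has_sumN (pos _ _ _ c0' fs); rewrite mulNr opprK.
by apply: eq_has_sum => i _; rewrite mulNr opprK.
Qed.

Lemma has_sum_single A f i : A i -> (forall j, A j -> j != i -> f j = 0) ->
  has_sum A f (f i).
Proof.
move=> Ai f0.
have mx0 (x : R) : 0 <= Num.max x 0 by rewrite le_max lexx orbT.
rewrite -[f i]max_decomp; apply: (eq_has_sum
  (f := fun i => Num.max (f i) 0 - Num.max (- f i) 0)).
  by move=> j _; exact: max_decomp.
apply: has_sumB => //; apply: esum_single => //.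
- by rewrite lee_fin.
- by move=> j Aj ji; rewrite f0// maxxx.
- by rewrite lee_fin.
- by move=> j Aj ji; rewrite f0// oppr0 maxxx.
Qed.

Lemma has_sum_norm A f s : has_sum A f s ->
  (`|s|%:E <= \esum_(i in A) `|f i|%:E)%E.
Proof.
move=> /has_sum_posneg[a [b [fa fb ->]]].
have mx0 (x : R) : 0 <= Num.max x 0 by rewrite le_max lexx orbT.
have a0 : 0 <= a by rewrite -lee_fin -fa; apply: esum_ge0 => i _; rewrite lee_fin.
have b0 : 0 <= b by rewrite -lee_fin -fb; apply: esum_ge0 => i _; rewrite lee_fin.
apply: (@le_trans _ _ (a + b)%:E).
  by rewrite lee_fin; apply: le_trans (ler_normB _ _) _; rewrite !ger0_norm.
rewrite EFinD -fa -fb -esumD.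
- apply: le_esum => i _; rewrite -EFinD lee_fin.
  by rewrite /Num.max; case: ltP => ?; case: ltP => ?; case: ler0P => ?; lra.
- by move=> i _; rewrite lee_fin.
- by move=> i _; rewrite lee_fin.
Qed.

(** Fatou: a bound on the sums passes to pointwise limits, since it can be tested
on finite index sets. *)
Lemma le_esum_limit A (u : nat -> I -> R) f (c : R) :
  (forall i, u ^~ i @ \oo --> f i) ->
  (forall n, \esum_(i in A) (u n i)%:E <= c%:E)%E ->
  (\esum_(i in A) (f i)%:E <= c%:E)%E.
Proof.
move=> uf uc; apply: ge_ereal_sup => _ [X [finX XA] <-].
rewrite fsumEFin// lee_fin fsbig_finite//=.
set s := finmap.enum_fset _.
have cv : (fun n => \sum_(i <- s) u n i) @ \oo --> \sum_(i <- s) f i.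
  by apply: cvg_big => [|i _]; [exact: add_continuous|exact: uf].
apply: (cvgr_to_le cv).
apply: nearW => n; rewrite -lee_fin; apply: le_trans (uc n).
apply: esum_ge; exists X; first by split.
by rewrite fsumEFin// fsbig_finite.
Qed.

End SignedSums.

(** * Countable unions *)

(** An enumeration of the index type reduces this to a sequence of null sets. *)
Lemma null_bigcup d (Om : measurableType d) (R : realType)
    (mu : {measure set Om -> \bar R}) (I : countType) (E : I -> set Om) :
  (forall i, measurable (E i)) -> (forall i, mu (E i) = 0%E) ->
  measurable (\bigcup_i E i) /\ mu (\bigcup_i E i) = 0%E.
Proof.
move=> mE E0.
pose G n := if unpickle n is Some i then E i else set0.
have GE : \bigcup_i E i = \bigcup_n G n.
  apply/seteqP; split=> [w [i _ Eiw]|w [n _]].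
    by exists (pickle i) => //; rewrite /G pickleK.
  by rewrite /G; case: (unpickle n) => // i Eiw; exists i.
have mG n : measurable (G n) by rewrite /G; case: unpickle.
have G0 n : mu (G n) = 0%E by rewrite /G; case: unpickle => [i|]; rewrite ?measure0.
have mU : measurable (\bigcup_n G n) by exact: bigcup_measurable.
rewrite GE; split => //; apply/eqP; rewrite eq_le measure_ge0 andbT.
apply: le_trans (measure_sigma_subadditive mu mG mU (@subset_refl _ _)) _.
by rewrite eseries0// => n _ _; exact: G0.
Qed.

Lemma measure_bigcup_esum d (Om : measurableType d) (R : realType)
    (mu : {measure set Om -> \bar R}) (J : countType) (E : J -> set Om) :
  (forall i, measurable (E i)) -> trivIset [set: J] E ->
  mu (\bigcup_i E i) = \esum_(i in [set: J]) mu (E i).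
Proof.
move=> mE tE; pose G n := if pickle_inv n is Some i then E i else set0.
have GE : \bigcup_i E i = \bigcup_n G n.
  apply/seteqP; split=> [w [i _ Eiw]|w [n _]].
    by exists (pickle i) => //; rewrite /G pickleK_inv.
  by rewrite /G; case: (pickle_inv n) => // i Eiw; exists i.
have mG n : measurable (G n) by rewrite /G; case: pickle_inv.
have tG : trivIset [set: nat] G.
  move=> n k _ _; rewrite /G.
  case En: (pickle_inv n) => [i|]; last by rewrite set0I => -[].
  case Ek: (pickle_inv k) => [j|]; last by rewrite setI0 => -[].
  move=> /(tE i j I I) ij.
  have := @pickle_invK J n; rewrite En /= => <-.
  by have := @pickle_invK J k; rewrite Ek /= ij => <-.
rewrite GE measure_bigcup//.
rewrite (eq_eseriesl (Q := xpredT)); last by move=> n /=; rewrite mem_set.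
rewrite nneseries_esumT//.
transitivity (\esum_(n in range (@pickle J)) mu (G n)).
  rewrite [RHS]esum_mkcond; apply: eq_esum => n _; case: ifPn => // /negP nr.
  rewrite /G; case En: (pickle_inv n) => [i|]; last by rewrite measure0.
  exfalso; apply: nr; rewrite inE; exists i => //.
  by have := @pickle_invK J n; rewrite En.
rewrite esum_image; last by move=> i j _ _; exact: (pcan_inj pickleK).
by apply: eq_esum => i _; rewrite /G pickleK_inv.
Qed.

(** * Charges with finite support *)

Section DiscreteCharges.
Variables (R : realType) (T : countType) (o : T).
Local Notation D := (discrete_space o).
Implicit Types (mu : {charge set D -> \bar R}) (h : T -> R) (s : seq T).

Let all_measurable (A : set D) : measurable A. Proof. by []. Qed.

Let all_measurable_fun (A : set D) d (U : measurableType d) (f : D -> U) :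
  measurable_fun A f.
Proof. by []. Qed.

Lemma discrete_null (nu : {measure set D -> \bar R}) (A : set D) :
  (forall x, A x -> nu [set x] = 0%E) -> nu A = 0%E.
Proof.
move=> A0; pose E (x : T) : set D := [set x] `&` A.
have AE : A = \bigcup_x E x.
  by apply/seteqP; split=> [x Ax|x [y _ [-> Ay]]//]; exists x.
rewrite AE; have [] // := @null_bigcup _ D R nu T E.
move=> x; rewrite /E; have [Ax|nAx] := pselect (A x).
  by rewrite (_ : _ `&` _ = [set x]) ?A0//; apply/seteqP; split => [y []//|y ->].
by rewrite (_ : _ `&` _ = set0) ?measure0//; apply/seteqP; split => // y [->].
Qed.

Lemma integral_concentrated (nu : {measure set D -> \bar R}) s h :
  (forall x : D, nu [set x] \is a fin_num) -> uniq s -> (forall x, x \notin s -> nu [set x] = 0%E) ->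
  (\int[nu]_x (h x)%:E)%E = (\sum_(x <- s) h x * fine (nu [set x]))%:E.
Proof.
move=> fin us out; pose F : set D := [set` s].
have F0 : nu (~` F) = 0%E.
  by apply: discrete_null => x /= /negP; exact: out.
rewrite -(setUv F) integral_setU//; last exact/disj_setPCl.
rewrite [X in (_ + X)%E]null_set_integral// adde0 /F {F F0 out}.
elim: s us => [|x s IH]; first by rewrite set_nil integral_set0 big_nil.
move=> /= /andP[xs us].
rewrite (_ : [set` x :: s] = ([set x] : set D) `|` [set` s]); last first.
  by apply/seteqP; split=> y /=; rewrite inE => /predU1P.
rewrite integral_setU//; last first.
  apply/disj_setPS => y [/= -> ys]; by move: xs; rewrite ys.
rewrite IH// big_cons EFinD; congr (_ + _)%E.
rewrite (eq_integral (fun=> (h x)%:E)); last by move=> y /[!inE] ->.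
by rewrite integral_cst// EFinM fineK.
Qed.

Section FiniteSupport.
Variables (mu : {charge set D -> \bar R}) (s : seq T).
Hypotheses (us : uniq s) (out : forall x, x \notin s -> mu [set x] = 0%E).

Let pos0 x : x \notin s -> jordan_pos (proj2_sig (hahn_sig mu)) [set x] = 0%E.
Proof.
move=> xs; rewrite jordan_posE cjordan_posE /crestr0 mem_set// /crestr.
set P := (X in [set x] `&` X); have [Px|nPx] := pselect (P x).
  by rewrite (_ : _ `&` _ = [set x]) ?out//; apply/seteqP; split => [y []//|y ->].
by rewrite (_ : _ `&` _ = set0) ?charge0//; apply/seteqP; split => // y [->].
Qed.

Let neg0 x : x \notin s -> jordan_neg (proj2_sig (hahn_sig mu)) [set x] = 0%E.
Proof.
move=> xs; rewrite jordan_negE cjordan_negE /crestr0 mem_set// /crestr.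
set P := (X in [set x] `&` X); have [Px|nPx] := pselect (P x).
  rewrite (_ : _ `&` _ = [set x]) ?out ?oppe0//.
  by apply/seteqP; split => [y []//|y ->].
rewrite (_ : _ `&` _ = set0) ?charge0 ?oppe0//.
by apply/seteqP; split => // y [->].
Qed.

(** The value does not depend on the chosen Hahn decomposition: both Jordan parts
vanish off s, and at each point their difference is mu. *)
Lemma charge_integral_finite h :
  charge_integral mu h = (\sum_(x <- s) h x * fine (mu [set x]))%:E.
Proof.
have finp (x : D) : jordan_pos (proj2_sig (hahn_sig mu)) [set x] \is a fin_num.
  exact: fin_num_measure.
have finn (x : D) : jordan_neg (proj2_sig (hahn_sig mu)) [set x] \is a fin_num.
  exact: fin_num_measure.
rewrite /charge_integral.
rewrite (integral_concentrated h finp us pos0).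
rewrite (integral_concentrated h finn us neg0) -EFinB -sumrB; congr EFin.
apply: eq_bigr => x _; rewrite -mulrBr; congr (_ * _).
rewrite (jordan_decomp (proj2_sig (hahn_sig mu))) //.
rewrite /cadd /= /cscale EFinN mulN1e -fineB ?fin_num_measure//.
Qed.

Lemma charge_integrable_finite h : charge_integrable mu h.
Proof.
apply/integrableP; split => //.
under eq_integral do rewrite abse_EFin.
rewrite (integral_concentrated (fun x => `|h x|) _ us) ?ltry// => x.
  by rewrite /charge_variation fin_numD !fin_num_measure.
move=> xs; transitivity (jordan_pos (proj2_sig (hahn_sig mu)) [set x] +
    jordan_neg (proj2_sig (hahn_sig mu)) [set x])%E => //.
by rewrite pos0// neg0// adde0.
Qed.

End FiniteSupport.

Lemma finite_support_seq mu : finite_support_charge mu -> exists2 s, uniq s &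
  forall x, x \notin s -> mu [set x] = 0%E.
Proof.
move=> /finite_seqP[s sE]; exists (undup s); first exact: undup_uniq.
move=> x; rewrite mem_undup => /negP xs; apply/eqP/negPn/negP => mx; apply: xs.
by have : [set x : D | mu [set x] != 0%E] x := mx; rewrite sE.
Qed.

(** The unit mass at o makes the total mass one, so that the mean deviation of h at
o is h y - h x. *)
Definition three_point_charge (y x : T) : {charge set D -> \bar R} :=
  cadd (cadd (charge_of_finite_measure (\d_(y : D)))
             (cscale (-1) (charge_of_finite_measure (\d_(x : D)))))
       (charge_of_finite_measure (\d_(o : D))).

Lemma three_point_chargeE y x (A : set D) : three_point_charge y x A =
  ((y \in A)%:R - (x \in A)%:R + (o \in A)%:R)%:E.
Proof.
transitivity ((\1_A (y : D))%:E + (-1)%:E * (\1_A (x : D))%:E +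
  (\1_A (o : D))%:E : \bar R)%E => //.
by rewrite !indicE -EFinM -!EFinD mulN1r.
Qed.

Let mem1 (z w : D) : (z \in ([set w] : set D)) = (z == w).
Proof. by apply/idP/eqP => [/set_mem//|->]; exact: mem_set. Qed.

Lemma three_point_out y x w : w \notin undup [:: y; x; o] ->
  three_point_charge y x [set w] = 0%E.
Proof.
rewrite mem_undup !inE !negb_or => /and3P[wy wx wo].
by rewrite three_point_chargeE !mem1 !(eq_sym _ w) (negbTE wy) (negbTE wx)
  (negbTE wo) subrr addr0.
Qed.

Lemma three_point_integral y x h :
  charge_integral (three_point_charge y x) h = (h y - h x + h o)%:E.
Proof.
rewrite (charge_integral_finite (undup_uniq [:: y; x; o]) (@three_point_out y x)).
congr EFin; set s := undup _.
have sum1 (z : T) : z \in s -> \sum_(w <- s) h w * (z == w)%:R = h z.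
  move=> zs; rewrite (bigD1_seq z) ?undup_uniq//= eqxx mulr1 big1 ?addr0// => w.
  by rewrite eq_sym => /negbTE ->; rewrite mulr0.
rewrite (eq_bigr (fun w => h w * (y == w)%:R - h w * (x == w)%:R + h w * (o == w)%:R)).
  by rewrite big_split sumrB !sum1// /s mem_undup !inE eqxx ?orbT.
move=> w _; rewrite three_point_chargeE /= !mem1.
by rewrite mulrDr mulrBr.
Qed.

End DiscreteCharges.

(** * Green functions and Dirichlet forms *)

Section GreenFunction.
Variables (R : realType) (T : countType) (S : set T) (q : T -> T -> R).
Hypothesis q0 : forall x y, 0 <= q x y.
Local Open Scope ereal_scope.
Implicit Types (u f : T -> \bar R).

Definition step u x := \esum_(z in S) ((q x z)%:E * u z).

Lemma nstepS n x y : nstep S q n.+1 x y = step (nstep S q n ^~ y) x.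
Proof. by []. Qed.

Lemma step_ge0 u x : (forall z, 0 <= u z) -> 0 <= step u x.
Proof. by move=> u0; apply: esum_ge0 => z _; rewrite mule_ge0// lee_fin. Qed.

Lemma le_step u v x : (forall z, S z -> u z <= v z) -> step u x <= step v x.
Proof.
by move=> uv; apply: le_esum => z Sz; apply: lee_wpmul2l; rewrite ?lee_fin ?uv.
Qed.

Lemma stepD u v x : (forall z, 0 <= u z) -> (forall z, 0 <= v z) ->
  step (u \+ v) x = step u x + step v x.
Proof.
move=> u0 v0; rewrite /step -esumD; last 2 first.
- by move=> z _; rewrite mule_ge0// lee_fin.
- by move=> z _; rewrite mule_ge0// lee_fin.
by apply: eq_esum => z _; rewrite ge0_muleDr.
Qed.

Lemma stepZ (c : R) u x : (0 <= c)%R -> (forall z, 0 <= u z) ->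
  step (fun z => c%:E * u z) x = c%:E * step u x.
Proof.
move=> c0 u0; rewrite /step -esumZl//; last first.
  by move=> z; rewrite mule_ge0// lee_fin.
by apply: eq_esum => z _; rewrite muleCA.
Qed.

Lemma nstep_ge0 n x y : 0 <= nstep S q n x y.
Proof.
by elim: n x => [|n IH] x /=; [rewrite lee_fin|apply: step_ge0 => z].
Qed.

Lemma green_ge0 x y : 0 <= green S q x y.
Proof. by apply: nneseries_ge0 => n _ _; exact: nstep_ge0. Qed.

(** First-step decomposition. *)
Lemma greenE x y :
  green S q x y = (x == y)%:R%:E + step (green S q ^~ y) x.
Proof.
rewrite /green nneseries_recS; last by move=> n; exact: nstep_ge0.
congr (_ + _); rewrite /step.
rewrite (eq_esum (b := fun z =>
  \sum_(0 <= n <oo) (q x z)%:E * nstep S q n z y)); last first.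
  by move=> z _; rewrite nneseriesZl// => n _; exact: nstep_ge0.
rewrite esum_nneseries//.
by move=> n z; rewrite mule_ge0 ?lee_fin// nstep_ge0.
Qed.

Definition truncated_green n x y := \sum_(0 <= k < n) nstep S q k x y.

Lemma truncated_green_ge0 n x y : 0 <= truncated_green n x y.
Proof. by apply: sume_ge0 => k _; exact: nstep_ge0. Qed.

Lemma truncated_greenS n x y : truncated_green n.+1 x y =
  (x == y)%:R%:E + step (truncated_green n ^~ y) x.
Proof.
rewrite /truncated_green big_nat_recl//; congr (_ + _).
elim: n => [|n IH].
  by rewrite big_nil /step esum1// => z _; rewrite big_nil mule0.
rewrite big_nat_recr//= IH -stepD; last 2 first.
- by move=> z; exact: truncated_green_ge0.
- by move=> z; exact: nstep_ge0.
by apply: eq_esum => z _; rewrite big_nat_recr.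
Qed.

Lemma le_truncated_green n x y : truncated_green n x y <= green S q x y.
Proof. by apply: nneseries_lim_ge => k _ _; exact: nstep_ge0. Qed.

(** The Green function is the smallest supersolution: by induction every truncated
sum stays below f.  Upper bounds on Green functions and on hitting probabilities
are all obtained by exhibiting such an f. *)
Lemma green_minimal (c : R) f y : (0 <= c)%R -> (forall z, 0 <= f z) ->
  (forall x, S x -> c%:E * (x == y)%:R%:E + step f x <= f x) ->
  forall x, S x -> c%:E * green S q x y <= f x.
Proof.
move=> c0 f0 hf x Sx.
have -> : c%:E * green S q x y = \sum_(0 <= k <oo) c%:E * nstep S q k x y.
  by rewrite /green nneseriesZl// => n _; exact: nstep_ge0.
apply: le_nneseries => n; first by rewrite mule_ge0// nstep_ge0.
rewrite -ge0_sume_distrr; last by move=> k _; exact: nstep_ge0.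
elim: n x Sx => [|n IH] x Sx; first by rewrite big_nil mule0.
rewrite -/(truncated_green n.+1 x y) truncated_greenS.
rewrite ge0_muleDr; last 2 first.
- by rewrite lee_fin.
- by apply: step_ge0 => z; exact: truncated_green_ge0.
apply: le_trans (hf x Sx); apply: leeD => //.
rewrite -stepZ//; last by move=> z; exact: truncated_green_ge0.
by apply: le_step => z Sz; exact: IH.
Qed.

End GreenFunction.

Section DirichletForm.
Variables (R : realType) (T : countType) (S : set T) (q : T -> T -> R).
Variable mu : T -> R.
Hypothesis q0 : forall x y, 0 <= q x y.
Hypothesis mu0 : forall x, 0 <= mu x.
Hypothesis qsub : forall x, S x -> (\esum_(y in S) (q x y)%:E <= 1)%E.
Hypothesis mu_sym : forall x y, S x -> S y -> mu x * q x y = mu y * q y x.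
Implicit Types (f : T -> R) (x y w v : T).

Definition dirichlet f : \bar R := \esum_(w in S) \esum_(v in S)
  (mu w * q w v * (f w - f v) ^+ 2)%:E.

(** Summation by parts.  With A the squared norm of f and B the sum of
mu w * q w v * (f w * f v), expanding the square gives an energy of at most
2 (A - B), and the hypothesis on f, multiplied by mu w * f w and summed, gives
A - B <= mu y * f y.  The finiteness of A allows the subtractions. *)
Lemma dirichlet_le f y : (forall w, 0 <= f w) ->
  (\esum_(w in S) (mu w * f w ^+ 2)%:E < +oo)%E ->
  (forall w, S w -> ((f w)%:E <= (w == y)%:R%:E + step S q (EFin \o f) w)%E) ->
  S y -> (dirichlet f <= (2 * (mu y * f y))%:E)%E.
Proof.
move=> f0 Afin fP Sy.
have c0 w v : 0 <= mu w * q w v by rewrite mulr_ge0.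
pose A := \esum_(w in S) (mu w * f w ^+ 2)%:E.
pose A' := \esum_(w in S) \esum_(v in S) (mu w * q w v * f w ^+ 2)%:E.
pose B := \esum_(w in S) \esum_(v in S) (mu w * q w v * (f w * f v))%:E.
have A'A : (A' <= A)%E.
  apply: le_esum => w Sw.
  rewrite (eq_esum (b := fun v => ((mu w * f w ^+ 2)%:E * (q w v)%:E)%E)); last first.
    by move=> v _; rewrite -EFinM; congr EFin; ring.
  rewrite esumZl ?mulr_ge0 ?sqr_ge0//; last by move=> ?; rewrite lee_fin.
  rewrite -[leRHS]mule1; apply: lee_wpmul2l; last exact: qsub.
  by rewrite lee_fin mulr_ge0// sqr_ge0.
have DB : (dirichlet f + (B + B) = A' + A')%E.
  have sym : A' = \esum_(w in S) \esum_(v in S) (mu w * q w v * f v ^+ 2)%:E.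
    rewrite [RHS]esum_exchange; last by move=> *; rewrite lee_fin mulr_ge0// sqr_ge0.
    apply: eq_esum => w Sw; apply: eq_esum => v Sv.
    by rewrite mu_sym.
  rewrite {2}sym /dirichlet /A' /B.
  have add (g h : T -> T -> R) : (forall w v, 0 <= g w v) ->
      (forall w v, 0 <= h w v) ->
      (\esum_(w in S) \esum_(v in S) (g w v)%:E +
       \esum_(w in S) \esum_(v in S) (h w v)%:E =
       \esum_(w in S) \esum_(v in S) (g w v + h w v)%:E)%E.
    move=> g0 h0; rewrite -esumD; last 2 first.
    - by move=> w _; apply: esum_ge0 => v _; rewrite lee_fin.
    - by move=> w _; apply: esum_ge0 => v _; rewrite lee_fin.
    by apply: eq_esum => w _; rewrite -esumD// => v _; rewrite lee_fin.
  have ff0 w v : 0 <= mu w * q w v * (f w * f v) by rewrite !mulr_ge0.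
  have sq0 w v t : 0 <= mu w * q w v * t ^+ 2 by rewrite mulr_ge0 ?sqr_ge0.
  rewrite !add//; last by move=> w v; rewrite addr_ge0.
  apply: eq_esum => w Sw; apply: eq_esum => v Sv; congr EFin; ring.
have AB : (A <= (mu y * f y)%:E + B)%E.
  apply: (@le_trans _ _ (\esum_(w in S)
     ((mu w * f w * (w == y)%:R)%:E + (mu w * f w)%:E * step S q (EFin \o f) w))%E).
    apply: le_esum => w Sw.
    rewrite [X in (X + _)%E]EFinM -ge0_muleDr; last 2 first.
    - by rewrite lee_fin.
    - by apply: step_ge0 => // z; rewrite lee_fin.
    by rewrite expr2 mulrA EFinM; apply: lee_wpmul2l; rewrite ?fP// lee_fin mulr_ge0.
  rewrite esumD; last 2 first.
  - by move=> w _; rewrite lee_fin mulr_ge0// mulr_ge0.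
  - move=> w _; rewrite mule_ge0 ?lee_fin ?mulr_ge0//.
    by apply: step_ge0 => // z; rewrite lee_fin.
  apply: leeD.
    rewrite (esum_single (i := y)) ?eqxx ?mulr1// => [|w _ /negbTE ->].
      by rewrite lee_fin mulr_ge0.
    by rewrite mulr0.
  apply: le_esum => w Sw; rewrite /step -esumZl; last 2 first.
  - by rewrite mulr_ge0.
  - by move=> v; rewrite mule_ge0 ?lee_fin.
  by apply: le_esum => v Sv; rewrite -!EFinM lee_fin le_eqVlt; apply/orP; left;
    apply/eqP; ring.
have D0 : (0 <= dirichlet f)%E.
  by apply: esum_ge0 => w _; apply: esum_ge0 => v _; rewrite lee_fin mulr_ge0 ?sqr_ge0.
have B0 : (0 <= B)%E.
  by apply: esum_ge0 => w _; apply: esum_ge0 => v _; rewrite lee_fin !mulr_ge0.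
have A'0 : (0 <= A')%E.
  by apply: esum_ge0 => w _; apply: esum_ge0 => v _; rewrite lee_fin mulr_ge0 ?sqr_ge0.
move: DB AB A'A Afin D0 B0 A'0; rewrite -/A.
case: (A) => [a| |] //; case: (A') => [a'| |] //; case: B => [b| |] //;
  case: (dirichlet f) => [r| |] //.
rewrite -!EFinD !lee_fin => -[]; move=> ? ? ? _ _ _ _; lra.
Qed.

Lemma nstep_le1 n x y : S x -> (nstep S q n x y <= 1)%E.
Proof.
elim: n x => [|n IH] x Sx /=; first by rewrite lee_fin; case: (x == y).
apply: le_trans (qsub Sx); apply: le_esum => z Sz.
by rewrite -[leRHS]mule1; apply: lee_wpmul2l; rewrite ?lee_fin ?IH.
Qed.

(** Reversibility turns column sums into row sums. *)
Lemma nstep_col_sum n y : S y ->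
  (\esum_(x in S) ((mu x)%:E * nstep S q n x y) <= (mu y)%:E)%E.
Proof.
move=> Sy; elim: n => [|n IH].
  rewrite (esum_single (i := y)) /= ?eqxx ?mule1 ?lee_fin//.
  by move=> x _ /negbTE ->; rewrite mule0.
apply: le_trans IH; rewrite (eq_esum (b := fun x => \esum_(z in S)
    ((mu x)%:E * ((q x z)%:E * nstep S q n z y))%E)); last first.
  move=> x Sx; rewrite nstepS esumZl// => z.
  by rewrite mule_ge0 ?lee_fin// nstep_ge0.
rewrite esum_exchange; last first.
  by move=> x z; rewrite mule_ge0 ?mule_ge0 ?lee_fin// nstep_ge0.
apply: le_esum => z Sz.
rewrite (eq_esum (b := fun x => ((mu z)%:E * nstep S q n z y * (q z x)%:E)%E)); last first.
  by move=> x Sx; rewrite muleA -EFinM mu_sym// EFinM muleAC.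
have : (0 <= nstep S q n z y)%E by exact: nstep_ge0.
have := nstep_le1 n y Sz; case: (nstep S q n z y) => // r _; rewrite lee_fin => r0.
rewrite -EFinM esumZl ?mulr_ge0//; last by move=> ?; rewrite lee_fin.
by rewrite -[leRHS]mule1; apply: lee_wpmul2l; rewrite ?lee_fin ?mulr_ge0 ?qsub.
Qed.

(** Unlike the Green function itself, its truncations are always bounded and square
summable. *)
Definition rtruncated n y x : R := fine (truncated_green S q n x y).

Lemma truncated_green_le n x y : S x -> (truncated_green S q n x y <= n%:R%:E)%E.
Proof.
move=> Sx; elim: n => [|n IH]; first by rewrite /truncated_green big_nil.
rewrite /truncated_green big_nat_recr//= -natr1 EFinD.
by apply: leeD => //; exact: nstep_le1.
Qed.

Lemma rtruncated_ge0 n y x : 0 <= rtruncated n y x.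
Proof. by apply: fine_ge0; exact: truncated_green_ge0. Qed.

Lemma rtruncatedE n y x : S x ->
  (rtruncated n y x)%:E = truncated_green S q n x y.
Proof.
move=> Sx; rewrite fineK// ge0_fin_numE; last exact: truncated_green_ge0.
exact: le_lt_trans (truncated_green_le n y Sx) (ltry _).
Qed.

Lemma rtruncated_l2 n y : S y ->
  (\esum_(w in S) (mu w * rtruncated n y w ^+ 2)%:E < +oo)%E.
Proof.
move=> Sy; apply: (@le_lt_trans _ _
  (n%:R%:E * \sum_(0 <= k < n) (mu y)%:E)%E); last first.
  by rewrite sumEFin -EFinM ltry.
apply: (@le_trans _ _ (n%:R%:E * \sum_(0 <= k < n)
   \esum_(x in S) ((mu x)%:E * nstep S q k x y))%E); last first.
  apply: lee_wpmul2l => //.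
  by apply: lee_sum => k _; exact: nstep_col_sum.
rewrite -esum_sum; last by move=> x k _ _; rewrite mule_ge0 ?lee_fin ?nstep_ge0.
rewrite -esumZl//; last first.
  by move=> x; apply: sume_ge0 => k _; rewrite mule_ge0 ?lee_fin ?nstep_ge0.
apply: le_esum => w Sw.
rewrite -ge0_sume_distrr; last by move=> k _; exact: nstep_ge0.
rewrite -/(truncated_green S q n w y) -rtruncatedE// -!EFinM lee_fin.
rewrite expr2 mulrCA ler_wpM2r ?mulr_ge0 ?rtruncated_ge0//.
by rewrite -lee_fin rtruncatedE// truncated_green_le.
Qed.

(** The energy is controlled by the value at the pole, uniformly in n. *)
Lemma dirichlet_rtruncated n y : S y ->
  (dirichlet (rtruncated n y) <= (2 * (mu y * rtruncated n y y))%:E)%E.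
Proof.
move=> Sy; apply: dirichlet_le.
- exact: rtruncated_ge0.
- exact: rtruncated_l2.
- move=> w Sw; rewrite rtruncatedE//.
  apply: (@le_trans _ _ (truncated_green S q n.+1 w y)).
    by rewrite [leRHS]/truncated_green big_nat_recr//= leeDl// nstep_ge0.
  rewrite truncated_greenS//; apply: leeD => //; apply: le_step => // z Sz.
  by rewrite /= rtruncatedE.
- by [].
Qed.

End DirichletForm.

(** * Compactifications from bounded functions *)

Section PointwiseHull.
Variables (R : realType) (T : countType) (J : choiceType) (phi : T -> J -> R).
Implicit Types (f g : J -> R) (w : T) (i : J).
Local Notation PT := (prod_topology (fun _ : J => R : topologicalType)).

Lemma pointwise_nbhs (f : PT) (U : set PT) : nbhs f U ->
  exists (s : seq J) (eps : R), 0 < eps /\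
    forall g : PT, (forall i, i \in s -> `|g i - f i| < eps) -> U g.
Proof.
pose B (q : seq J * R) : set PT := [set g | forall i, i \in q.1 -> `|g i - f i| < q.2].
pose F : set_system PT := filter_from [set q | 0 < q.2] B.
have FF : Filter F.
  apply: filter_from_filter; first by exists ([::], 1) => /=.
  move=> [s a] [t b] /= a0 b0; exists (s ++ t, Num.min a b) => /=.
    by rewrite lt_min a0.
  move=> g hg; split=> i /= hi.
    by have := hg i; rewrite /= mem_cat hi lt_min => /(_ isT)/andP[].
  by have := hg i; rewrite /= mem_cat hi orbT lt_min => /(_ isT)/andP[].
suff Ff : F --> f by move=> /Ff[[s eps] /= e0 h]; exists s, eps.
apply/cvg_sup => i V [W [[C oC <-] Cf WV]].
have /nbhs_ballP[eps /= e0 h] : nbhs (f i) C by exact: open_nbhs_nbhs.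
exists ([:: i], eps) => // g /(_ i); rewrite inE eqxx => /(_ isT) gi.
by apply: WV; apply: h; rewrite /ball /= distrC.
Qed.

Lemma coordinate_continuous i : continuous (fun f : PT => f i).
Proof. exact: (@proj_continuous J (fun=> R : topologicalType) i). Qed.

(** The functions phi^~ i are the coordinates of a map from T to a product of
lines.  Its closure is compact when each of them is bounded, and is a
compactification of T when moreover every point is isolated by one of them. *)
Definition pointwise_hull : set PT := closure (range phi : set PT).

Definition hull_point w : pointwise_hull :=
  exist _ (phi w : PT) (mem_set (subset_closure (imageT phi w))).

Lemma hull_nbhs (f : pointwise_hull) (U : set pointwise_hull) : nbhs f U ->
  exists (s : seq J) (eps : R), 0 < eps /\ forall g : pointwise_hull,
    (forall i, i \in s -> `|val g i - val f i| < eps) -> U g.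
Proof.
move=> [V [[W oW <-] Wf VU]].
have /pointwise_nbhs[s [eps [e0 h]]] : nbhs (val f : PT) W by exact: open_nbhs_nbhs.
by exists s, eps; split => // g gf; apply: VU; exact: h.
Qed.

Lemma hull_coordinate_continuous i : continuous (fun f : pointwise_hull => val f i).
Proof.
move=> f; apply: (@continuous_comp _ PT _ (val : pointwise_hull -> PT) (fun f : PT => f i)).
  exact: initial_continuous.
exact: coordinate_continuous.
Qed.

Lemma hull_dense : dense (range hull_point).
Proof.
move=> O [f Of] oO; have [W oW WO] := oO.
have : closure (range phi : set PT) (val f) by apply: set_mem; exact: valP.
have Wf : W (val f) by rewrite -WO in Of.
move=> /(_ W (open_nbhs_nbhs (conj oW Wf)))[_ [[w _ <-] Ww]].
by exists (hull_point w); split; [rewrite -WO|exists w].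
Qed.

Hypothesis phi_bounded : forall i, exists M, forall w, `|phi w i| <= M.

(** A closed subset of a product of segments. *)
Lemma hull_compact : compact [set: pointwise_hull].
Proof.
have cH : compact pointwise_hull.
  have [M MP] := choice phi_bounded.
  pose K i := `[- M i, M i]%classic.
  have cK : compact [set f : PT | forall i, K i (f i)].
    by apply: (@tychonoff J (fun=> R : topologicalType) K) => i; exact: segment_compact.
  apply: (subclosed_compact _ cK); first exact: closed_closure.
  have /closure_id -> : closed [set f : PT | forall i, K i (f i)].
    apply: compact_closed => //.
    by apply: (@hausdorff_product J (fun=> R : topologicalType)) => i; exact: Rhausdorff.
  by apply: closure_subset => _ [w _ <-] i; rewrite /K /= in_itv /= -ler_norml.
move=> F FF _.
have [|f [Hf cf]] := cH ((val : pointwise_hull -> PT) @ F) _.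
  rewrite /nbhs /=; apply: (@filterS _ F _ setT); last exact: filterT.
  by move=> g _; apply: (set_mem (valP g)).
exists (exist _ f (mem_set Hf)); split => // A B FA [V [[W oW <-] Wf VB]].
have [] := cf ((val : pointwise_hull -> PT) @` A) W.
- by rewrite /nbhs /=; apply: (@filterS _ F _ A) => // g Ag; exists g.
- exact: open_nbhs_nbhs.
- by move=> _ [[g Ag <-] Wg]; exists g; split => //; exact: VB.
Qed.

Lemma hull_hausdorff : hausdorff_space pointwise_hull.
Proof.
move=> f g fg; apply: val_inj.
apply: (@hausdorff_product J (fun=> R : topologicalType)) => [i|]; first exact: Rhausdorff.
move=> A B Af Bg.
have [] := fg (val @^-1` A) (val @^-1` B).
- exact: (@initial_continuous pointwise_hull PT val f).
- exact: (@initial_continuous pointwise_hull PT val g).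
- by move=> h [? ?]; exists (val h).
Qed.

Hypothesis phi_isolated : forall w, exists i c,
  c < phi w i /\ forall w', w' != w -> phi w' i <= c.

Lemma hull_point_inj : injective hull_point.
Proof.
move=> w w' [] ww'; apply/eqP; apply: contrapT => /negP ne.
have [i [c [cw /(_ w')]]] := phi_isolated w.
by rewrite eq_sym -ww' leNgt cw => /(_ ne).
Qed.

(** The half-space where the isolating coordinate exceeds c is open and meets T only
at w; since T is dense, it contains nothing else. *)
Lemma hull_point_open w : open [set hull_point w].
Proof.
have [i [c [cw le_c]]] := phi_isolated w.
have oc : open ((fun f : pointwise_hull => val f i) @^-1` [set r | c < r]).
  by apply: open_comp; [move=> g _; exact: hull_coordinate_continuous|exact: open_gt].
have -> : [set hull_point w] = (fun f : pointwise_hull => val f i) @^-1` [set r | c < r].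
  apply/seteqP; split=> [f -> //|f /= cf]; apply: contrapT => fw.
  have [] := hull_dense (O := [set f | c < val f i] `\ hull_point w).
  - by exists f.
  - apply: openI; last first.
      apply: closed_openC; apply: accessible_closed_set1; apply: hausdorff_accessible.
      exact: hull_hausdorff.
    exact: oc.
  - move=> g [[cg gw] [w' _ E]]; rewrite -{g}E in cg gw.
    have [w'w|/le_c] := eqVneq w' w; first by apply: gw; rewrite w'w.
    by rewrite leNgt cg.
exact: oc.
Qed.

Lemma hull_compactification : compactification hull_point.
Proof.
split; [exact: hull_compact|exact: hull_hausdorff|exact: hull_point_inj| |].
- exact: hull_point_open.
- exact: hull_dense.
Qed.

End PointwiseHull.

Section CompactificationTheory.
Variables (T : countType) (X : topologicalType) (iota : T -> X).
Hypothesis iotaP : compactification iota.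

(** Use a cluster point of the complements in A of finite sets; it is not a vertex
because vertices are isolated. *)
Lemma infinite_boundary_point (A : set T) : infinite_set A ->
  exists xi, boundary iota xi /\ closure (iota @` A) xi.
Proof.
case: iotaP => cX _ iota_inj iota_open _ infA.
pose F : set_system X := filter_from finite_set (fun D => iota @` (A `\` D)).
have FF : ProperFilter F.
  apply: filter_from_proper; last first.
    move=> D fD; apply/set0P/negP => /eqP E; apply: infA.
    apply: (sub_finite_set _ fD) => w Aw; apply: contrapT => nD.
    suff : (iota @` (A `\` D)) (iota w) by rewrite E.
    by exists w.
  apply: filter_from_filter; first by exists set0; exact: finite_set0.
  move=> D D' fD fD'; exists (D `|` D'); first by rewrite finite_setU.
  move=> _ [w [Aw nw] <-]; split; exists w => //; split => // h; apply: nw;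
    by [left|right].
have [xi [_ cxi]] := cX F FF filterT.
exists xi; split => [[w _ wxi]|V Vxi].
  rewrite -wxi in cxi.
  have /cxi /(_ (open_nbhs_nbhs (conj (iota_open w) erefl))) :
      F (iota @` (A `\` [set w])).
    by exists [set w] => //; exact: finite_set1.
  by move=> [_ [[v [_ vw] <-] /iota_inj]].
by apply: cxi => //; exists set0; [exact: finite_set0|rewrite setD0].
Qed.

(** The image is closed and contains the dense set T. *)
Lemma dominated_surjective (Y : topologicalType) (j : T -> Y) (f : Y -> X) :
  compact [set: Y] -> continuous f -> (forall w, f (j w) = iota w) ->
  forall x, exists y, f y = x.
Proof.
case: iotaP => _ hX _ _ dX cY cf fj x.
have : closed (range f).
  apply: compact_closed => //; apply: continuous_compact => //.
  exact: continuous_subspaceT.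
move=> clf; apply: contrapT => nx.
have [z [nf [w _ wz]]] : (~` range f) `&` range iota !=set0.
  apply: dX; last exact: closed_openC.
  by exists x => -[y _ yx]; apply: nx; exists y.
by apply: nf; exists (j w) => //; rewrite fj.
Qed.

Lemma separating_open (R : realType) (g : X -> R) (c0 c1 : R) (B : set T) :
  continuous g -> c0 < c1 ->
  (forall w, B w -> c1 <= g (iota w)) -> (forall w, ~ B w -> g (iota w) <= c0) ->
  exists U : set X, [/\ open U, closure (iota @` B) `<=` U &
    forall w, U (iota w) -> B w].
Proof.
move=> cg c01 gB gnB; exists (g @^-1` [set r | c0 < r]); split.
- by apply: open_comp; [move=> x _; exact: cg|exact: open_gt].
- apply: (@subset_trans _ (g @^-1` [set r | c1 <= r])); last first.
    by move=> x /=; exact: lt_le_trans.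
  have /closure_id -> : closed (g @^-1` [set r | c1 <= r]).
    by apply: closed_comp; [move=> x _; exact: cg|exact: closed_ge].
  by apply: closure_subset => _ [w Bw <-]; exact: gB.
- by move=> w /= gw; apply: contrapT => /gnB; rewrite leNgt gw.
Qed.

End CompactificationTheory.

(** * First passage on a tree *)

Section NearestNeighbourWalk.
Variables (R : realType) (T : countType) (e : rel T) (p : T -> T -> R).
Hypothesis treeT : is_tree e.
Hypothesis markovP : markov_operator p.
Hypothesis nnP : nearest_neighbour e p.
Implicit Types (x y z u v w : T) (C : set T).

Let eirr : irreflexive e. Proof. by case: treeT. Qed.

Let esym : symmetric e. Proof. by case: treeT. Qed.

Lemma p_ge0 x y : 0 <= p x y. Proof. by case: markovP. Qed.

Lemma p_sum x : \esum_(y in [set: T]) (p x y)%:E = 1%E.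
Proof. by case: markovP. Qed.

Lemma p_gt0 x y : e x y -> 0 < p x y. Proof. by move/nnP. Qed.

Lemma p_eq0 x y : ~ e x y -> p x y = 0.
Proof.
move=> nexy; apply/eqP; rewrite eq_le p_ge0 andbT leNgt.
by apply/negP => /nnP.
Qed.

Local Notation P := (step [set: T] p).

Lemma P_const (c : R) x : 0 <= c -> P (fun=> c%:E) x = c%:E.
Proof.
move=> c0; rewrite /step (eq_esum (b := fun y => (c%:E * (p x y)%:E)%E)).
  by rewrite esumZl ?p_sum ?mule1// => i; rewrite lee_fin p_ge0.
by move=> y _; rewrite muleC.
Qed.

Lemma le_P_local (f g : T -> \bar R) x :
  (forall y, e x y -> (f y <= g y)%E) -> (P f x <= P g x)%E.
Proof.
move=> fg; apply: le_esum => y _.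
have [/fg fg'|/p_eq0 ->] := pselect (e x y); last by rewrite !mul0e.
by apply: lee_wpmul2l; rewrite ?lee_fin ?p_ge0.
Qed.

(** The walk is killed after its first visit to y, so that its expected number of
visits to y is the probability of a visit. *)
Definition stopped y x z : R := if x == y then 0 else p x z.

Lemma stopped_ge0 y x z : 0 <= stopped y x z.
Proof. by rewrite /stopped; case: ifP => // _; exact: p_ge0. Qed.

Lemma step_stopped y (f : T -> \bar R) x :
  step [set: T] (stopped y) f x = if x == y then 0%E else P f x.
Proof.
rewrite /step /stopped; case: ifP => // _.
by rewrite esum1// => z _; rewrite mul0e.
Qed.

Definition hit x y : R := fine (green [set: T] (stopped y) x y).

Lemma hitE x y : (hit x y)%:E = green [set: T] (stopped y) x y.
Proof.
rewrite fineK// ge0_fin_numE; last exact: green_ge0 (stopped_ge0 y) x y.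
apply: (@le_lt_trans _ _ 1%E); last exact: ltry.
rewrite -[leLHS]mul1e.
apply: (green_minimal (stopped_ge0 y) (f := fun=> 1%E)) => //.
move=> {}x _.
rewrite step_stopped P_const//; case: eqP => _ /=; first by rewrite adde0 mul1e.
by rewrite mule0 add0e.
Qed.

Lemma hit_ge0 x y : 0 <= hit x y.
Proof. by rewrite -lee_fin hitE; exact: green_ge0 (stopped_ge0 y) x y. Qed.

Lemma hit_step x y : x != y -> P (EFin \o hit^~ y) x = (hit x y)%:E.
Proof.
move=> xy; rewrite hitE greenE; last exact: stopped_ge0.
rewrite step_stopped (negbTE xy) add0e; apply: eq_esum => z _.
by rewrite /= hitE.
Qed.

Lemma hitxx x : hit x x = 1.
Proof.
apply: EFin_inj; rewrite hitE greenE; last exact: stopped_ge0.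
by rewrite step_stopped eqxx adde0.
Qed.

(** Comparison with an explicit supersolution replaces arguments about paths. *)
Lemma hit_minimal (c : R) (f : T -> \bar R) y : 0 <= c ->
  (forall z, 0 <= f z)%E -> (c%:E <= f y)%E ->
  (forall x, x != y -> (P f x <= f x)%E) ->
  forall x, ((c * hit x y)%:E <= f x)%E.
Proof.
move=> c0 f0 cf fP x; rewrite EFinM hitE.
apply: (green_minimal (S := [set: T])) => //; first exact: stopped_ge0.
move=> {}x _; rewrite step_stopped; case: eqVneq => [->|xy].
  by rewrite mule1 adde0.
by rewrite mule0 add0e; exact: fP.
Qed.

Lemma hit_le1 x y : hit x y <= 1.
Proof.
rewrite -lee_fin -[hit x y]mul1r.
by apply: (@hit_minimal 1 (fun=> 1%E)) => // z _; rewrite P_const.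
Qed.

Lemma hit_superharmonic y x : (P (EFin \o hit^~ y) x <= (hit x y)%:E)%E.
Proof.
have [->|xy] := eqVneq x y; last by rewrite hit_step.
rewrite hitxx -(P_const y ler01).
by apply: le_P_local => z _; rewrite lee_fin hit_le1.
Qed.

(** One way to visit z is to visit y first. *)
Lemma hit_triangle x y z : hit x y * hit y z <= hit x z.
Proof.
rewrite -lee_fin mulrC.
apply: (hit_minimal (f := EFin \o hit^~ z)) => //=; first exact: hit_ge0.
  by move=> w; rewrite lee_fin hit_ge0.
by move=> w _; exact: hit_superharmonic.
Qed.

Lemma hit_gt0 x y : 0 < hit x y.
Proof.
move: x; apply: (tree_ind treeT (x := y)); first by rewrite hitxx.
move=> u v euv; have [->|vy] := eqVneq v y; first by rewrite hitxx.
move=> hu; apply: (@lt_le_trans _ _ (p v u * hit u y)).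
  by rewrite mulr_gt0// p_gt0// esym.
rewrite -lee_fin -(hit_step vy) EFinM.
apply: (@esum_term R T [set: T] (fun z => (p v z)%:E * (hit z y)%:E)%E) => // z.
by rewrite -EFinM lee_fin mulr_ge0 ?p_ge0 ?hit_ge0.
Qed.

(** From w in C the walk leaves C through y.  The function equal to
hit u y * hit y z on C and to hit u z elsewhere is a supersolution off z, which
gives the inequality opposite to [hit_triangle]. *)
Lemma hit_separated C y z w : ~ C z ->
  (forall u v, e u v -> C u -> ~ C v -> u = y) -> C w ->
  hit w z = hit w y * hit y z.
Proof.
move=> nCz sep Cw; apply/eqP; rewrite eq_le hit_triangle andbT.
pose f u := if `[< C u >] then hit u y * hit y z else hit u z.
have fle u : f u <= hit u z by rewrite /f; case: ifP => // _; exact: hit_triangle.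
have f0 u : 0 <= f u.
  by rewrite /f; case: ifP => _; rewrite ?mulr_ge0 ?hit_ge0.
suff : hit w z <= f w by rewrite /f asboolT.
rewrite -[hit w z]mul1r -lee_fin.
apply: (hit_minimal (f := EFin \o f)) => //=.
  by rewrite /f asboolF// hitxx.
move=> u uz.
have easy : f u = hit u z -> (P (EFin \o f) u <= (f u)%:E)%E.
  move=> ->; rewrite -hit_step//; apply: le_P_local => v _.
  by rewrite lee_fin fle.
have [Cu|nCu] := pselect (C u); last by apply: easy; rewrite /f asboolF.
have [uy|uy] := eqVneq u y.
  by apply: easy; rewrite /f asboolT// uy hitxx mul1r.
have -> : f u = hit y z * hit u y by rewrite /f asboolT// mulrC.
rewrite EFinM -(hit_step uy) -stepZ; last 3 first.
- exact: p_ge0.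
- exact: hit_ge0.
- by move=> v; rewrite lee_fin hit_ge0.
apply: le_P_local => v euv.
have Cv : C v by apply: contrapT => nCv; rewrite (sep u v euv Cu nCv) eqxx in uy.
by rewrite /= /f asboolT// (mulrC (hit v y)) EFinM.
Qed.

Lemma hit_branch_near x y w z : e x y -> branch e x y w -> ~ branch e x y z ->
  hit w z = hit w y * hit y z.
Proof.
move=> exy bw bz; apply: (hit_separated (C := branch e x y)) => // u v euv bu bv.
by have [] := branch_cross treeT exy euv bu bv.
Qed.

Lemma hit_branch_far x y w z : e x y -> branch e x y w -> ~ branch e x y z ->
  hit w z = hit w x * hit x z.
Proof.
move=> exy bw bz; have [->|zx] := eqVneq z x; first by rewrite hitxx mulr1.
apply: (hit_separated (C := x |` branch e x y)); last by right.
  by move=> [zx'|//]; rewrite zx' eqxx in zx.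
move=> u v euv [//|bu] nv; apply: contrapT => _; apply: nv.
have [?|nbv] := pselect (branch e x y v); first by right.
by left; have [] := branch_cross treeT exy euv bu nbv.
Qed.

(** Otherwise the walk would return to x almost surely; quantitatively,
G(x,x) >= 1 + F(x,y) F(y,x) G(x,x). *)
Lemma transient_hit_lt1 x y : transient p -> x != y -> hit x y * hit y x < 1.
Proof.
move=> trP xy; pose u w := green [set: T] p w x.
have u0 w : (0 <= u w)%E by exact: green_ge0 p_ge0 w x.
have ufin w : u w \is a fin_num by rewrite ge0_fin_numE//; exact: trP.
have uK w : (fine (u w))%:E = u w by rewrite fineK.
have fu0 w : 0 <= fine (u w) by rewrite fine_ge0.
have uE w : u w = ((w == x)%:R%:E + P u w)%E by apply: greenE; exact: p_ge0.
have uP w : (P u w <= u w)%E by rewrite [leRHS]uE leeDr// lee_fin.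
have h1 w v : fine (u v) * hit w v <= fine (u w).
  by rewrite -lee_fin uK; apply: hit_minimal; rewrite ?uK.
rewrite ltNge; apply/negP => h.
have : 1 + fine (u y) * hit x y <= fine (u x).
  rewrite -lee_fin uK [leRHS]uE eqxx EFinD; apply: leeD => //.
  rewrite EFinM -hit_step// -stepZ//; last 2 first.
  - exact: p_ge0.
  - by move=> w; rewrite lee_fin hit_ge0.
  by apply: le_P_local => w _ /=; rewrite -(uK w) -EFinM lee_fin h1.
have := ler_wpM2r (hit_ge0 x y) (h1 y x).
have := ler_wpM2l (fu0 x) h.
nra.
Qed.

(** The value one is an average of values that are at most one, so it spreads from
each vertex to its neighbours. *)
Lemma hit_one_branch u v : e u v -> hit v u = 1 ->
  forall w, branch e u v w -> hit w u = 1.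
Proof.
move=> euv h1; apply: (branch_ind treeT euv) => // w w' eww' bw bw' hw.
have wu : w != u.
  by apply/eqP => wu; move: bw; rewrite wu; exact: branch_edge_src.
have : p w w' * hit w' u = p w w'.
  apply: (@esum_eq_term R T [set: T] (fun z => p w z * hit z u) (p w) 1) => //.
  - by move=> z; rewrite mulr_ge0 ?p_ge0 ?hit_ge0.
  - by move=> z _; rewrite ler_piMr ?p_ge0 ?hit_le1.
  - by rewrite -hw -(hit_step wu); apply: eq_esum => z _; rewrite EFinM.
  - exact: p_sum.
move/eqP; rewrite -{2}[p w w']mulr1 => /eqP/mulfI; apply.
by rewrite gt_eqF// p_gt0.
Qed.

(** A maximum of a subharmonic function spreads to the neighbours. *)
Lemma max_principle (D : T -> R) (M : R) w0 : (forall w, 0 <= D w) ->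
  (forall w, D w <= M) -> (forall w, ((D w)%:E <= P (EFin \o D) w)%E) ->
  D w0 = M -> forall w, D w = M.
Proof.
move=> D0 DM DP Dw0; apply: (tree_ind treeT Dw0) => u v euv Du.
have M0 : 0 <= M by rewrite -Dw0.
have : p u v * D v = p u v * M.
  apply: (@esum_eq_term R T [set: T] (fun z => p u z * D z) (fun z => p u z * M) M) => //.
  - by move=> z; rewrite mulr_ge0 ?p_ge0.
  - by move=> z _; rewrite ler_wpM2l ?p_ge0.
  - apply/eqP; rewrite eq_le; apply/andP; split.
      rewrite -[leRHS](P_const u M0); apply: le_esum => z _.
      by rewrite -EFinM lee_fin ler_wpM2l ?p_ge0.
    rewrite -{1}Du; apply: le_trans (DP u) _.
    by apply: le_esum => z _; rewrite -EFinM.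
  - by rewrite -(P_const u M0); apply: eq_esum => z _; rewrite EFinM.
by move/mulfI; apply; rewrite gt_eqF// p_gt0.
Qed.

(** Finiteness of the branch makes D attain its maximum, and the maximum principle
makes D constant, with value zero at c. *)
Lemma finite_branch_subharmonic c v (D : T -> R) : e c v ->
  finite_set (branch e c v) -> (forall w, 0 <= D w) ->
  (forall w, ~ branch e c v w -> D w = 0) ->
  (forall w, branch e c v w -> ((D w)%:E <= P (EFin \o D) w)%E) ->
  forall w, D w = 0.
Proof.
move=> ecv /finite_seqP[s sE] D0 Dout Din.
have [w0 Dmax] : exists w0, forall w, D w <= D w0.
  have [w0 hw0] : exists w0, forall w, w \in s -> D w <= D w0.
    elim: s {sE} => [|t s [w0 hw0]]; first by exists c.
    have [tw|wt] := leP (D t) (D w0).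
      by exists w0 => w; rewrite inE => /predU1P[->|/hw0].
    exists t => w; rewrite inE => /predU1P[->//|/hw0 h].
    exact: le_trans h (ltW wt).
  exists w0 => w; have [bw|nbw] := pselect (branch e c v w); last by rewrite Dout.
  by apply: hw0; move: bw; rewrite sE.
have DP w : ((D w)%:E <= P (EFin \o D) w)%E.
  have [/Din//|nbw] := pselect (branch e c v w).
  by rewrite (Dout _ nbw); apply: step_ge0 => [|z]; [exact: p_ge0|rewrite lee_fin].
have Dcst := max_principle D0 Dmax DP erefl.
by move=> w; rewrite Dcst -(Dcst c) Dout//; exact: branch_edge_src.
Qed.

Lemma finite_branch_hit c v : e c v -> finite_set (branch e c v) -> hit v c = 1.
Proof.
move=> ecv fB.
pose D w := if `[< branch e c v w >] then 1 - hit w c else 0.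
have D0 w : 0 <= D w by rewrite /D; case: ifP => // _; rewrite subr_ge0 hit_le1.
suff : D v = 0.
  rewrite /D asboolT; last exact: branch_self.
  by move=> /eqP; rewrite subr_eq0 => /eqP.
apply: (finite_branch_subharmonic ecv fB) => // [w nbw|w bw].
  by rewrite /D asboolF.
have wc : w != c.
  by apply/eqP => wc; move: bw; rewrite wc; exact: branch_edge_src.
have E : P (EFin \o (fun z => 1 - hit z c)) w = (1 - hit w c)%:E.
  have : (P (EFin \o (fun z => (1 - hit z c)%R)) w + P (EFin \o hit^~ c) w = 1%:E)%E.
    rewrite -stepD; last 3 first.
    - exact: p_ge0.
    - by move=> z; rewrite lee_fin subr_ge0 hit_le1.
    - by move=> z; rewrite lee_fin hit_ge0.
    rewrite -(P_const w ler01); apply: eq_esum => z _ /=.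
    by rewrite -EFinD subrK.
  rewrite (hit_step wc); case: (P _ w) => // r [] <-; congr EFin; ring.
rewrite {1}/D asboolT// -E; apply: le_P_local => z ewz /=.
rewrite lee_fin /D; case: asboolP => // nbz.
by have [_ ->] := branch_cross treeT ecv ewz bw nbz; rewrite hitxx subrr.
Qed.

(** * Harmonic functions *)

Lemma mean_const (c : R) u : has_sum [set: T] (fun v => p u v * c) c.
Proof.
have := has_sumZ c (has_sum_ge0 (p_ge0 u) (p_sum u)); rewrite mulr1.
by apply: eq_has_sum => v _; rewrite mulrC.
Qed.

Lemma mean_local (f h : T -> R) u s : (forall v, e u v -> f v = h v) ->
  has_sum [set: T] (fun v => p u v * f v) s ->
  has_sum [set: T] (fun v => p u v * h v) s.
Proof.
move=> fh; apply: eq_has_sum => v _.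
by have [/fh ->//|/p_eq0 ->] := pselect (e u v); rewrite !mul0r.
Qed.

Lemma mean_hit u c : u != c -> has_sum [set: T] (fun v => p u v * hit v c) (hit u c).
Proof.
move=> uc; apply: has_sum_ge0; last by rewrite -(hit_step uc).
by move=> v; rewrite mulr_ge0 ?p_ge0 ?hit_ge0.
Qed.

Lemma mean_zero (f : T -> R) u : (forall v, e u v -> f v = 0) ->
  has_sum [set: T] (fun v => p u v * f v) 0.
Proof.
move=> f0; apply: (mean_local (f := fun=> 0)) => [v /f0//|].
by have := mean_const 0 u.
Qed.

Lemma mean_single (f : T -> R) u y : e u y -> (forall v, e u v -> v != y -> f v = 0) ->
  has_sum [set: T] (fun v => p u v * f v) (p u y * f y).
Proof.
move=> euy f0; apply: (has_sum_single (f := fun v => p u v * f v)) => // v _ vy.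
have [/f0 ->//|/p_eq0 ->] := pselect (e u v); rewrite ?mulr0 ?mul0r//.
Qed.

Lemma meanD (f h : T -> R) u s t :
  has_sum [set: T] (fun v => p u v * f v) s ->
  has_sum [set: T] (fun v => p u v * h v) t ->
  has_sum [set: T] (fun v => p u v * (f v + h v)) (s + t).
Proof.
by move=> fs ht; apply: eq_has_sum (has_sumD fs ht) => v _; rewrite mulrDr.
Qed.

Lemma meanZ (c : R) (f : T -> R) u s :
  has_sum [set: T] (fun v => p u v * f v) s ->
  has_sum [set: T] (fun v => p u v * (c * f v)) (c * s).
Proof. by move=> fs; apply: eq_has_sum (has_sumZ c fs) => v _; rewrite mulrCA. Qed.

Lemma meanB (f h : T -> R) u s t :
  has_sum [set: T] (fun v => p u v * f v) s ->
  has_sum [set: T] (fun v => p u v * h v) t ->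
  has_sum [set: T] (fun v => p u v * (f v - h v)) (s - t).
Proof.
move=> fs /(meanZ (-1)) ht; rewrite -mulN1r; apply: eq_has_sum (meanD fs ht) => v _.
by rewrite mulN1r.
Qed.

Section BranchFunctions.
Variables x y : T.
Hypothesis exy : e x y.
Local Notation B := (branch e x y).

(** The indicator of a branch is harmonic except at the two ends of the edge. *)
Lemma branch_indicator_mean u :
  has_sum [set: T] (fun v => p u v * (`[< B v >])%:R)
    ((`[< B u >])%:R + (u == x)%:R * p x y - (u == y)%:R * p y x).
Proof.
have xy := edge_neq treeT exy.
have nBx : ~ B x by exact: branch_edge_src.
have By : B y by exact: branch_self.
have [Bu|nBu] := pselect (B u).
  have ux : (u == x) = false by apply/negbTE/eqP => ux; move: Bu; rewrite ux.
  rewrite ux mul0r addr0 (asboolT Bu); case: eqVneq => [->|uy].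
    rewrite mul1r; apply: (mean_local (f := fun v => 1 - (v == x)%:R)).
      move=> v eyv; case: eqVneq => [->|vx]; first by rewrite asboolF// subrr.
      by rewrite asboolT ?subr0//; apply: (branch_nest treeT exy eyv vx); exact: branch_self.
    apply: meanB; first exact: mean_const.
    have := @mean_single (fun v => (v == x)%:R) y x.
    rewrite eqxx mulr1; apply; first by rewrite esym.
    by move=> v _ /negbTE ->.
  rewrite mul0r subr0; apply: (mean_local (f := fun=> 1)); last exact: mean_const.
  by move=> v euv; rewrite asboolT//; exact: (branch_nbr treeT exy Bu uy euv).
have uy : (u == y) = false by apply/negbTE/eqP => uy; apply: nBu; rewrite uy.
have out v : e u v -> B v -> u = x /\ v = y.
  move=> euv Bv; have evu : e v u by rewrite esym.
  by have [-> ->] := branch_cross treeT exy evu Bv nBu.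
rewrite uy mul0r subr0 (asboolF nBu) add0r; case: eqVneq => [ux|ux].
  rewrite mul1r ux; have := @mean_single (fun v => (`[< B v >])%:R) x y exy.
  rewrite (asboolT By) mulr1; apply => v exv vy; rewrite asboolF// => Bv.
  by have [] := out v; rewrite ?ux// => _ vy'; rewrite vy' eqxx in vy.
rewrite mul0r; apply: mean_zero => v euv; rewrite asboolF// => Bv.
by have [ux' _] := out v euv Bv; rewrite ux' eqxx in ux.
Qed.

(** The probability of never visiting x, cut off outside the branch. *)
Definition bump w : R := if `[< B w >] then 1 - hit w x else 0.

Lemma bump_out w : ~ B w -> bump w = 0.
Proof. by move=> nB; rewrite /bump asboolF. Qed.

Lemma bump_root : bump y = 1 - hit y x.
Proof. by rewrite /bump asboolT//; exact: branch_self. Qed.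

Lemma bump_bounded w : `|bump w| <= 1.
Proof.
rewrite /bump; case: ifP => _; last by rewrite normr0.
by rewrite ger0_norm ?subr_ge0 ?hit_le1// gerBl hit_ge0.
Qed.

(** The only defect of harmonicity is a source at x, positive exactly when the
branch is transient; two bumps on different branches at x can thus be balanced
against each other. *)
Lemma bump_mean u : has_sum [set: T] (fun v => p u v * bump v)
  (bump u + (u == x)%:R * (p x y * (1 - hit y x))).
Proof.
have nBx : ~ B x by exact: branch_edge_src.
have [Bu|nBu] := pselect (B u).
  have ux : u != x by apply/eqP => ux; move: Bu; rewrite ux.
  rewrite (negbTE ux) mul0r addr0 {2}/bump asboolT//.
  apply: (mean_local (f := fun v => 1 - hit v x)); last first.
    by apply: meanB; [exact: mean_const|exact: mean_hit].
  move=> v euv; rewrite /bump; case: asboolP => // nBv.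
  by have [_ ->] := branch_cross treeT exy euv Bu nBv; rewrite hitxx subrr.
have out v : e u v -> B v -> u = x /\ v = y.
  move=> euv Bv; have evu : e v u by rewrite esym.
  by have [-> ->] := branch_cross treeT exy evu Bv nBu.
rewrite (bump_out nBu) add0r; case: eqVneq => [ux|ux].
  rewrite mul1r -bump_root ux; apply: mean_single => // v exv vy.
  apply: bump_out => Bv.
  by have [] := out v; rewrite ?ux// => _ vy'; rewrite vy' eqxx in vy.
rewrite mul0r; apply: mean_zero => v euv; apply: bump_out => Bv.
by have [ux' _] := out v euv Bv; rewrite ux' eqxx in ux.
Qed.

End BranchFunctions.

Lemma harmonicB (f h : T -> R) : harmonic_function p f -> harmonic_function p h ->
  harmonic_function p (fun w => f w - h w).
Proof. by move=> hf hh u; apply: meanB; [exact: hf|exact: hh]. Qed.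

Lemma harmonicD (f h : T -> R) : harmonic_function p f -> harmonic_function p h ->
  harmonic_function p (fun w => f w + h w).
Proof. by move=> hf hh u; apply: meanD; [exact: hf|exact: hh]. Qed.

Lemma harmonic_const (c : R) : harmonic_function p (fun=> c).
Proof. by move=> u; exact: mean_const. Qed.

(** The triangle inequality. *)
Lemma harmonic_subharmonic (h : T -> R) c : harmonic_function p h ->
  forall w, (`|h w - c|%:E <= P (fun v => `|h v - c|%:E) w)%E.
Proof.
move=> hh w; apply: le_trans (has_sum_norm (meanB (hh w) (mean_const c w))) _.
by apply: le_esum => v _; rewrite normrM ger0_norm ?p_ge0.
Qed.

(** Optional stopping at x.  In terms of supersolutions: with C a bound of
|h - h x|, the function C - |h - h x| is nonnegative, superharmonic, and equal to C
at x; as x is reached almost surely from y, it equals C at y as well. *)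
Lemma bounded_harmonic_recurrent (h : T -> R) x y : harmonic_function p h ->
  bounded_on_tree h -> hit y x = 1 -> h y = h x.
Proof.
move=> hh [M hM] h1; pose D w := `|h w - h x|; pose C := 2 * M.
have DC w : D w <= C.
  rewrite /D /C; apply: le_trans (ler_normB _ _) _.
  by have := hM w; have := hM x; lra.
have D0 w : 0 <= D w by exact: normr_ge0.
have C0 : 0 <= C := le_trans (D0 x) (DC x).
have CD0 w : 0 <= C - D w by rewrite subr_ge0.
have : ((C * hit y x)%:E <= (C - D y)%:E)%E.
  apply: (hit_minimal (f := fun w => (C - D w)%:E)) => //.
  - by rewrite /D subrr normr0 subr0.
  move=> w _; have := harmonic_subharmonic (h x) hh w.
  have : (P (fun v => (C - D v)%:E) w + P (fun v => (D v)%:E) w = C%:E)%E.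
    rewrite -stepD; last 3 first.
    - exact: p_ge0.
    - by move=> z; rewrite lee_fin.
    - by move=> z; rewrite lee_fin.
    rewrite -(P_const w C0); apply: eq_esum => z _ /=.
    by rewrite -EFinD subrK.
  rewrite -/(D w) => + /le_trans; rewrite -/(fun v => (D v)%:E).
  have : (P (fun v => (D v)%:E) w <= C%:E)%E.
    by rewrite -(P_const w C0); apply: le_P_local => v _; rewrite lee_fin.
  have : (0 <= P (fun v => (D v)%:E) w)%E.
    by apply: step_ge0 => [|v]; [exact: p_ge0|rewrite lee_fin].
  move=> + + + /(_ _ (lexx _)).
  change (fun v => `|h v - h x|%:E) with (fun v => (D v)%:E).
  case: (P (fun v => (D v)%:E) w) => // r _ _.
  case: (P (fun v => (C - D v)%:E) w) => // s [] sr; rewrite !lee_fin; lra.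
rewrite h1 mulr1 lee_fin => CD; have /normr0_eq0/eqP : D y = 0.
  by apply/eqP; rewrite eq_le D0 andbT; lra.
by rewrite subr_eq0 => /eqP.
Qed.

(** The function |h - h c|, cut off outside the branch, is subharmonic on it. *)
Lemma finite_branch_harmonic c v (h : T -> R) : e c v ->
  finite_set (branch e c v) -> harmonic_function p h -> h v = h c.
Proof.
move=> ecv fB hh.
pose D w := if `[< branch e c v w >] then `|h w - h c| else 0.
suff : D v = 0.
  rewrite /D asboolT; last exact: branch_self.
  by move=> /normr0_eq0/eqP; rewrite subr_eq0 => /eqP.
apply: (finite_branch_subharmonic ecv fB) => [w|w nbw|w bw].
- by rewrite /D; case: ifP.
- by rewrite /D asboolF.
rewrite {1}/D asboolT//; apply: le_trans (harmonic_subharmonic (h c) hh w) _.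
apply: le_P_local => z ewz /=; rewrite lee_fin /D; case: asboolP => // nbz.
by have [_ ->] := branch_cross treeT ecv ewz bw nbz; rewrite subrr normr0.
Qed.

Definition bounded_match S := forall h, harmonic_function p h ->
  exists h', [/\ harmonic_function p h', bounded_on_tree h' &
    forall w, S w -> h' w = h w].

(** Induction on a growing finite subtree.  When v is attached to c, the
discrepancy g = h - h' is harmonic and vanishes on the old subtree, so its mean over
the neighbours of c is zero: if g v is not zero, then neither is g z for another
neighbour z.  Harmonic functions are constant on finite branches, so both branches
are infinite, and by hypothesis they carry bumps.  The bump at v corrects h', and
the bump at z cancels the source that it creates at c. *)
Lemma bounded_match_finite (o : T) (A : set T) :
  (forall x y, e x y -> infinite_set (branch e x y) -> hit y x < 1) ->
  finite_set A -> bounded_match A.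
Proof.
move=> h2 fA.
have [S [_ _ _ AS mS]] : exists S, [/\ finite_set S, subtree e S, S o, A `<=` S &
    bounded_match S].
  apply: (subtree_hull treeT) => //.
    move=> h hh; exists (fun=> h o); split; first exact: harmonic_const.
      by exists `|h o|.
    by move=> w ->.
  move=> S c v _ tS _ Sc ecv nSv mS h hh.
  have [h' [hh' [M hM] h'S]] := mS h hh.
  pose g w := h w - h' w.
  have hg : harmonic_function p g by exact: harmonicB.
  have gS w : S w -> g w = 0 by move=> Sw; rewrite /g h'S// subrr.
  have [gv|gv] := eqVneq (g v) 0.
    exists h'; split=> //; first by exists M.
    move=> w [->|/h'S//]; move/eqP: gv; rewrite subr_eq0 => /eqP ->//.
  have inf z : e c z -> g z != 0 -> infinite_set (branch e c z).
    by move=> ecz + fB; rewrite (finite_branch_harmonic ecz fB hg) gS ?eqxx.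
  have [z [ecz zv gz]] : exists z, [/\ e c z, z != v & g z != 0].
    apply: contrapT => no.
    have g0 z : e c z -> z != v -> g z = 0.
      by move=> ez zv; apply/eqP/negPn/negP => gz; apply: no; exists z.
    have /eqP := has_sum_unique (mean_single ecv g0) (hg c).
    by rewrite (gS c)// mulf_eq0 (negbTE gv) orbF gt_eqF// p_gt0.
  have iv := inf v ecv gv; have iz := inf z ecz gz.
  have hv1 := h2 _ _ ecv iv; have hz1 := h2 _ _ ecz iz.
  have nSz : ~ S z by move=> Sz; rewrite gS ?eqxx in gz.
  (* al corrects the value at v, be cancels the source at c *)
  pose al := g v / (1 - hit v c).
  pose be := al * (p c v * (1 - hit v c)) / (p c z * (1 - hit z c)).
  exists (fun w => h' w + (al * bump c v w - be * bump c z w)); split.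
  - apply: harmonicD => // u.
    have := meanB (meanZ al (bump_mean ecv u)) (meanZ be (bump_mean ecz u)).
    congr has_sum; case: (u == c); rewrite /= ?mul0r ?addr0// !mul1r.
    suff : be * (p c z * (1 - hit z c)) = al * (p c v * (1 - hit v c)).
      by move=> E; rewrite mulrDr (mulrDr be) E; ring.
    rewrite /be divfK// mulf_neq0// gt_eqF ?p_gt0// subr_gt0//.
  - exists (M + (`|al| + `|be|)) => w.
    apply: le_trans (ler_normD _ _) _; apply: lerD => //.
    apply: le_trans (ler_normB _ _) _; rewrite !normrM.
    by apply: lerD; rewrite -[leRHS]mulr1 ler_wpM2l// bump_bounded.
  - move=> w [->|Sw].
      rewrite bump_root// (bump_out (x := c) (y := z)); last first.
        apply: (branch_disjoint treeT ecv ecz); first by rewrite eq_sym.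
        exact: branch_self.
      rewrite mulr0 subr0 /al divfK; first by rewrite /g addrC subrK.
      by rewrite gt_eqF// subr_gt0.
    rewrite !bump_out ?mulr0 ?subr0 ?addr0 ?h'S//.
      by move=> bw; apply: nSz; exact: (tS c z w).
    by move=> bw; apply: nSv; exact: (tS c v w).
by move=> h /mS[h' [? ? h'S]]; exists h'; split => // w /AS/h'S.
Qed.

(** Only the values of h at o and on the support matter, and they are those of a
bounded harmonic function. *)
Lemma mean_value_of_transient (o : T) :
  (forall x y, e x y -> infinite_set (branch e x y) -> hit y x < 1) ->
  forall mu : {charge set (discrete_space o) -> \bar R},
    finite_support_charge mu -> weak_mean_value p mu <-> strong_mean_value p mu.
Proof.
move=> h2 mu /finite_support_seq[s us out]; split=> [weak h hh _|strong h hh _].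
  have [h' [hh' bh' h'E]] := @bounded_match_finite o [set` o :: s] h2 (finite_seq _) h hh.
  have := weak h' hh' bh'; rewrite /mean_deviation !(charge_integral_finite us out).
  rewrite h'E /= ?mem_head//; congr (_ - _ = _)%E; congr EFin.
  apply: eq_big_seq => x xs; rewrite h'E//=.
  by rewrite inE xs orbT.
by apply: strong => //; exact: (charge_integrable_finite us out).
Qed.

(** * The law of the chain *)

Section Chain.
Variables (d : measure_display) (Omega : measurableType d).
Variables (Pr : T -> probability Omega R) (Z : nat -> Omega -> T).
Hypothesis chainZ : markov_chain Pr Z p.
Implicit Types (s : nat -> T) (k n : nat).

Let measZ n (A : set T) : measurable (Z n @^-1` A).
Proof.
have -> : Z n @^-1` A = \bigcup_y (Z n @^-1` ([set y] `&` A)).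
  apply/seteqP; split=> [w Aw|w [y _ [/= -> //]]].
  by exists (Z n w).
apply: countable_bigcupT_measurable; first exact: countableP.
move=> y.
have [Ay|nAy] := pselect (A y).
  rewrite (_ : _ `&` _ = [set y]); first by case: chainZ.
  by apply/seteqP; split=> [z []//|z ->].
by rewrite (_ : _ `&` _ = set0) ?preimage_set0//; apply/seteqP; split=> // z [->].
Qed.

Definition prefix k s : set Omega := [set w | forall i, (i <= k)%N -> Z i w = s i].

Definition prefix_weight x k s : R :=
  (s 0%N == x)%:R * \prod_(i < k) p (s i) (s i.+1).

Lemma prefix_weight_ge0 x k s : 0 <= prefix_weight x k s.
Proof. by rewrite mulr_ge0// prodr_ge0// => i _; exact: p_ge0. Qed.

Lemma prefix_prob x k s : Pr x (prefix k s) = (prefix_weight x k s)%:E.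
Proof. by case: chainZ => _; exact. Qed.

Lemma prefix_measurable k s : measurable (prefix k s).
Proof.
have -> : prefix k s = \bigcap_(i in [set i | (i <= k)%N]) (Z i @^-1` [set s i]).
  by apply/seteqP; split.
by apply: bigcap_measurableType => i _; exact: measZ.
Qed.

Definition extend k s z i := if (i <= k)%N then s i else z.

Lemma prefix_weightS x k s z : prefix_weight x k.+1 (extend k s z) =
  prefix_weight x k s * p (s k) z.
Proof.
rewrite /prefix_weight big_ord_recr /= {1}/extend leq0n mulrA; congr (_ * _ * _).
  by apply: eq_bigr => i _; rewrite /extend (ltnW (ltn_ord i)) ltn_ord.
by rewrite /extend leqnn ltnn.
Qed.

Lemma prefix_extend k s z : prefix k.+1 (extend k s z) =
  prefix k s `&` Z k.+1 @^-1` [set z].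
Proof.
apply/seteqP; split=> [w h|w [h zw] i].
  split=> [i ik|]; first by rewrite h ?/extend ?ik// ltnW.
  by rewrite /= h// /extend ltnn.
rewrite leq_eqVlt => /predU1P[->|]; first by rewrite /extend ltnn.
by rewrite ltnS => ik; rewrite /extend ik; exact: h.
Qed.

Definition first_hit y k s n : set Omega :=
  prefix k s `&` [set w | (forall i, (i < n)%N -> Z (k + i)%N w != y) /\
                          Z (k + n)%N w = y].

Lemma first_hit_measurable y k s n : measurable (first_hit y k s n).
Proof.
apply: measurableI; first exact: prefix_measurable.
have -> : [set w | (forall i, (i < n)%N -> Z (k + i)%N w != y) /\ Z (k + n)%N w = y] =
   \bigcap_(i in [set i | (i < n)%N]) (Z (k + i)%N @^-1` [set z | z != y]) `&`
   Z (k + n)%N @^-1` [set y].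
  by apply/seteqP; split.
apply: measurableI; last exact: measZ.
by apply: bigcap_measurableType => i _; exact: measZ.
Qed.

(** Keeping an arbitrary prefix in the statement lets the induction on n use the
cylinder formula alone, without a Markov property for shifted trajectories. *)
Lemma first_hit_prob x y k s n : Pr x (first_hit y k s n) =
  ((prefix_weight x k s)%:E * nstep [set: T] (stopped y) n (s k) y)%E.
Proof.
elim: n k s => [|n IH] k s.
  rewrite /=; case: eqVneq => [sk|sk].
    rewrite mule1 -prefix_prob; congr (Pr x _).
    apply/seteqP; split=> [w []//|w hw]; split=> //; split=> //.
    by rewrite addn0 hw.
  rewrite mule0; have -> : first_hit y k s 0 = set0; last by rewrite measure0.
  apply/seteqP; split=> // w [hw [_]]; rewrite addn0 hw// => sk'.
  by rewrite sk' eqxx in sk.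
rewrite nstepS step_stopped; case: eqVneq => [sk|sk].
  rewrite mule0; have -> : first_hit y k s n.+1 = set0; last by rewrite measure0.
  apply/seteqP; split=> // w [hw [/(_ 0%N isT)]].
  by rewrite addn0 hw// sk eqxx.
have -> : first_hit y k s n.+1 = \bigcup_z first_hit y k.+1 (extend k s z) n.
  apply/seteqP; split=> [w [hw [h1 h2]]|w [z _]].
    exists (Z k.+1 w) => //; split; first by rewrite prefix_extend; split.
    split=> [i iN|]; last by rewrite addSnnS.
    by rewrite addSnnS; exact: h1.
  rewrite /first_hit prefix_extend => -[[hw zw] [h1 h2]]; split => //; split.
    case=> [_|i iN]; first by rewrite addn0 hw.
    by rewrite -addSnnS; exact: h1.
  by rewrite -addSnnS.
rewrite measure_bigcup_esum; last 2 first.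
- by move=> z; exact: first_hit_measurable.
- move=> z z' _ _ [w []].
  by rewrite /first_hit !prefix_extend => -[[_ /= <-] _] [[_ /= <-] _].
rewrite /step -esumZl; last 2 first.
- exact: prefix_weight_ge0.
- move=> z; rewrite mule_ge0 ?lee_fin ?p_ge0//.
  by apply: nstep_ge0; exact: stopped_ge0.
apply: eq_esum => z _; rewrite [LHS]IH prefix_weightS EFinM muleA.
congr (_ * nstep _ _ _ _ _)%E.
by rewrite /extend ltnn.
Qed.

Definition prefix_then_hit y k s : set Omega :=
  prefix k s `&` [set w | exists n, Z (k + n)%N w = y].

Lemma prefix_then_hitE y k s : prefix_then_hit y k s = \bigcup_n first_hit y k s n.
Proof.
apply/seteqP; split=> [w [hw ex]|w [n _ [hw [_ h]]]]; last by split=> //; exists n.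
have ex' : exists n, Z (k + n)%N w == y by case: ex => n /eqP; exists n.
exists (ex_minn ex') => //; split => //; case: ex_minnP => n /eqP zn nmin.
split => // i iN; apply/negP => /nmin; by rewrite leqNgt iN.
Qed.

Lemma prefix_then_hit_measurable y k s : measurable (prefix_then_hit y k s).
Proof.
by rewrite prefix_then_hitE; apply: bigcup_measurable => n _; exact: first_hit_measurable.
Qed.

Lemma prefix_then_hit_prob x y k s :
  Pr x (prefix_then_hit y k s) = (prefix_weight x k s * hit (s k) y)%:E.
Proof.
rewrite prefix_then_hitE measure_bigcup//; last 2 first.
- by move=> n _; exact: first_hit_measurable.
- move=> i j _ _ [w [[_ [hi zi]] [_ [hj zj]]]].
  case: (ltngtP i j) => // ij; first by have := hj i ij; rewrite zi eqxx.
  by have := hi j ij; rewrite zj eqxx.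
rewrite (eq_eseriesl (Q := xpredT)); last by move=> n /=; rewrite mem_set.
rewrite EFinM hitE /green -nneseriesZl; last first.
  by move=> n _; apply: nstep_ge0; exact: stopped_ge0.
by apply: eq_eseriesr => n _; rewrite [LHS]first_hit_prob.
Qed.

Definition prefix_then_miss y k s : set Omega :=
  prefix k s `&` [set w | forall n, Z (k + n)%N w != y].

Lemma prefix_split y k s :
  prefix k s = prefix_then_hit y k s `|` prefix_then_miss y k s.
Proof.
apply/seteqP; split=> [w hw|w [[]|[]]//].
have [ex|nex] := pselect (exists n, Z (k + n)%N w = y); first by left.
by right; split => // n; apply/eqP => h; apply: nex; exists n.
Qed.

Lemma prefix_then_miss_measurable y k s : measurable (prefix_then_miss y k s).
Proof.
have -> : prefix_then_miss y k s = prefix k s `\` prefix_then_hit y k s.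
  apply/seteqP; split=> [w [hw h]|w [hw h]]; split => //.
    by move=> [_ [n]]; apply/eqP.
  by move=> n; apply/eqP => hn; apply: h; split => //; exists n.
apply: measurableD; [exact: prefix_measurable|exact: prefix_then_hit_measurable].
Qed.

Lemma prefix_then_miss_prob x y k s :
  Pr x (prefix_then_miss y k s) = (prefix_weight x k s * (1 - hit (s k) y))%:E.
Proof.
have : (Pr x (prefix k s) = Pr x (prefix_then_hit y k s) +
    Pr x (prefix_then_miss y k s))%E.
  rewrite {1}(prefix_split y) measureU//.
  - exact: prefix_then_hit_measurable.
  - exact: prefix_then_miss_measurable.
  - apply/seteqP; split => // w [[_ [n zn]] [_ /(_ n)]].
    by rewrite zn eqxx.
rewrite prefix_prob prefix_then_hit_prob.
have : Pr x (prefix_then_miss y k s) \is a fin_num.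
  by apply: fin_num_measure; exact: prefix_then_miss_measurable.
case: (Pr x _) => // r _ [] E; congr EFin; lra.
Qed.

(** The event is compared with [prefix_then_hit] after the trivial prefix, which
has full probability. *)
Lemma hittingE x y : hitting Pr Z x y = hit x y.
Proof.
rewrite /hitting.
have mH : measurable [set w | exists n, Z n w = y].
  have -> : [set w | exists n, Z n w = y] = \bigcup_n (Z n @^-1` [set y]).
    by apply/seteqP; split=> w; [move=> [n]; exists n|move=> [n _]; exists n].
  by apply: bigcup_measurable => n _; exact: measZ.
suff -> : Pr x [set w | exists n, Z n w = y] = (hit x y)%:E by [].
have P1 : Pr x (prefix 0 (fun=> x)) = 1%E.
  by rewrite prefix_prob /prefix_weight eqxx big_ord0 mulr1.
have m0 := prefix_measurable 0 (fun=> x).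
have P0 : Pr x (~` prefix 0 (fun=> x)) = 0%E.
  by rewrite probability_setC// P1 subee.
have -> : (hit x y)%:E = Pr x (prefix_then_hit y 0 (fun=> x)).
  by rewrite prefix_then_hit_prob /prefix_weight eqxx big_ord0 !mul1r.
have -> : prefix_then_hit y 0 (fun=> x) =
    prefix 0 (fun=> x) `&` [set w | exists n, Z n w = y] by [].
rewrite setIC -[in LHS](setIT [set w | _]) -(setUv (prefix 0 (fun=> x))) setIUr.
rewrite measureU; last 3 first.
- exact: measurableI.
- by apply: measurableI => //; exact: measurableC.
- by rewrite setIACA setICr setI0.
rewrite -[RHS]adde0; congr (_ + _)%E; apply/eqP.
rewrite eq_le measure_ge0 andbT -P0 le_measure ?inE//.
- by apply: measurableI => //; exact: measurableC.
- exact: measurableC.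
Qed.

Lemma prefix_reach x z : exists k s, [/\ s 0%N = x, s k = z & 0 < prefix_weight x k s].
Proof.
move: z; apply: (tree_ind treeT (x := x)).
  by exists 0%N, (fun=> x); split; rewrite // /prefix_weight eqxx big_ord0 mulr1.
move=> u v euv [k [s [s0 sk w0]]]; exists k.+1, (extend k s v); split => //.
- by rewrite /extend ltnn.
- by rewrite prefix_weightS mulr_gt0// sk p_gt0.
Qed.

Variable o : T.

(** Finite sequences code the prefixes by a countable type. *)
Definition word_prefix (l : seq T) := prefix (size l).-1 (nth o l).

Lemma word_prefixP (w : Omega) k : exists2 l, size l = k.+1 &
  word_prefix l w /\ nth o l k = Z k w.
Proof.
exists (mkseq (fun i => Z i w) k.+1); first by rewrite size_mkseq.
split; last by rewrite nth_mkseq.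
by move=> i; rewrite size_mkseq => ik; rewrite nth_mkseq.
Qed.

(** The chain respects the edges only almost surely: these are the trajectories
that begin with a prefix of weight zero. *)
Definition impossible_step : set Omega := \bigcup_l
  if prefix_weight (nth o l 0) (size l).-1 (nth o l) == 0 then word_prefix l else set0.

Lemma impossible_step_null x : measurable impossible_step /\ Pr x impossible_step = 0%E.
Proof.
apply: null_bigcup => l; case: ifP => // /eqP w0.
- exact: prefix_measurable.
- rewrite [LHS]prefix_prob /prefix_weight.
  move: w0; rewrite /prefix_weight eqxx mul1r => ->.
  by rewrite mulr0.
Qed.

Lemma possible_edge (w : Omega) i : ~ impossible_step w -> e (Z i w) (Z i.+1 w).
Proof.
move=> nw; apply/negPn/negP => /negP ne; apply: nw.
have [l sl [lw _]] := word_prefixP w i.+1; exists l => //.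
have lZ j : (j <= i.+1)%N -> nth o l j = Z j w.
  by move=> ji; rewrite lw// sl.
by rewrite sl /= /prefix_weight big_ord_recr /= !lZ ?(p_eq0 ne) ?mulr0 ?eqxx.
Qed.

(** A trajectory that follows edges can leave the branch only through c. *)
Lemma survives_in_branch c z k s (w : Omega) : e c z -> s k = z ->
  prefix_then_miss c k s w -> ~ impossible_step w ->
  forall n, branch e c z (Z (k + n)%N w).
Proof.
move=> ecz sk [hw miss] nw; elim=> [|n IH].
  by rewrite addn0 hw// sk; exact: branch_self.
apply: contrapT => nb; rewrite addnS in nb.
have [_ zc] := branch_cross treeT ecz (possible_edge (k + n) nw) IH nb.
by have := miss n.+1; rewrite addnS zc eqxx.
Qed.

(** Staying in the branch from time k on means that a prefix of length k ends in
the branch and x is missed ever after.  From each vertex of the branch x is reached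
almost surely, and there are countably many prefixes. *)
Lemma branch_left_as x y v : e x y -> hit y x = 1 -> exists N : set Omega,
  [/\ measurable N, Pr v N = 0%E &
    [set w | exists k, forall n, (k <= n)%N -> branch e x y (Z n w)] `<=` N].
Proof.
move=> exy h1.
pose E (l : seq T) := if `[< branch e x y (nth o l (size l).-1) >]
  then prefix_then_miss x (size l).-1 (nth o l) else set0.
exists (\bigcup_l E l).
have mE l : measurable (E l).
  by rewrite /E; case: ifP => // _; exact: prefix_then_miss_measurable.
have E0 l : Pr v (E l) = 0%E.
  rewrite /E; case: asboolP => [bl|_]; last by rewrite measure0.
  by rewrite prefix_then_miss_prob (hit_one_branch exy h1 bl) subrr mulr0.
have [mN N0] := @null_bigcup _ Omega R (Pr v) _ E mE E0.
split => // w [k hk]; have [l sl [lw lk]] := word_prefixP w k.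
exists l => //; rewrite /E sl /= lk asboolT; last exact: hk.
split; first by move: lw; rewrite /word_prefix sl.
move=> n; apply/eqP => zx; have := hk (k + n)%N (leq_addr _ _).
by rewrite zx; exact: branch_edge_src.
Qed.

(** * The Martin boundary *)
Hypothesis trP : transient p.

Lemma martin_kernelE x w : martin_kernel Pr Z o x w = hit x w / hit o w.
Proof. by rewrite /martin_kernel !hittingE. Qed.

(** From x and from o alike the walk enters the branch through c, and the factor
hit c w cancels. *)
Lemma kernel_branch c z x w : e c z -> ~ branch e c z o -> ~ branch e c z x ->
  branch e c z w -> martin_kernel Pr Z o x w = martin_kernel Pr Z o x c.
Proof.
move=> ecz bo bx bw; have ezc : e z c by rewrite esym.
have through v : ~ branch e c z v -> hit v w = hit v c * hit c w.
  move=> bv; apply: (hit_branch_near ezc); first exact/(branchC treeT v ecz).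
  by move/(branchC treeT w ecz).
rewrite !martin_kernelE (through x bx) (through o bo) -mulf_div divff ?mulr1//.
exact/lt0r_neq0/hit_gt0.
Qed.

Lemma kernel_inside x y w : e x y -> ~ branch e x y o -> branch e x y w ->
  martin_kernel Pr Z o y w = (hit o y)^-1.
Proof.
move=> exy bo bw; have eyx : e y x by rewrite esym.
rewrite martin_kernelE (hit_branch_far (z := w) eyx (w := o)); last 2 first.
- exact/(branchC treeT o exy).
- by move/(branchC treeT w exy).
by rewrite invfM mulrC divfK//; exact/lt0r_neq0/hit_gt0.
Qed.

Lemma kernel_outside x y w : e x y -> ~ branch e x y w ->
  martin_kernel Pr Z o y w <= hit y x / hit o x.
Proof.
move=> exy bw; rewrite martin_kernelE.
rewrite (hit_branch_far exy (branch_self treeT x y) bw).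
rewrite ler_pdivrMr ?hit_gt0// -mulrA ler_wpM2l ?hit_ge0//.
by rewrite mulrC ler_pdivlMr ?hit_gt0// mulrC hit_triangle.
Qed.

(** Up to the factor 1 / hit o y this is F(x,y) F(y,x) < 1. *)
Lemma kernel_gap x y : e x y -> ~ branch e x y o -> hit y x / hit o x < (hit o y)^-1.
Proof.
move=> exy bo; have eyx : e y x by rewrite esym.
rewrite (hit_branch_near (z := y) eyx (w := o)); last 2 first.
- exact/(branchC treeT o exy).
- by move/(branchC treeT y exy); apply; exact: branch_self.
rewrite invfM mulrC ltr_pM2l ?invr_gt0 ?hit_gt0//.
rewrite -[ltRHS]mul1r ltr_pdivlMr ?hit_gt0// mulrC.
exact: transient_hit_lt1 trP (edge_neq treeT exy).
Qed.

Variables (That : topologicalType) (iota : T -> That) (Zoo : Omega -> That).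
Hypothesis martinT : martin_compactification (martin_kernel Pr Z o) iota.
Hypothesis limZ : boundary_limit Pr Z iota Zoo.
Local Notation K := (martin_kernel Pr Z o).

(** The kernel of y or that of x, according to the side of the edge on which o
lies. *)
Lemma martin_separates x y : e x y -> exists U : set That,
  [/\ open U, closure (iota @` branch e x y) `<=` U &
      forall w, U (iota w) -> branch e x y w].
Proof.
move=> exy; have eyx : e y x by rewrite esym.
case: martinT => _ ext _.
have [bo|bo] := pselect (branch e x y o); last first.
  have [g cg gE] := ext y.
  apply: (separating_open cg (kernel_gap exy bo)) => w bw; rewrite gE.
    by rewrite (kernel_inside exy bo bw).
  exact: kernel_outside.
have bo' : ~ branch e y x o by move/(branchC treeT o exy).
have [g cg gE] := ext x.
have gap := kernel_gap eyx bo'; rewrite -ltrN2 in gap.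
apply: (separating_open (g := -%R \o g) _ gap) => [v|w bw|w bw] /=.
- by apply: continuousN; exact: cg.
- rewrite lerN2 gE; apply: kernel_outside => //.
  by move/(branchC treeT w exy).
- rewrite lerN2 gE (kernel_inside eyx)//; exact/(branchC treeT w exy).
Qed.

(** The indicators isolate the vertices; the kernels alone might not. *)
Definition kernel_coordinate w (i : T + T) : R :=
  match i with inl x => K x w | inr x => (w == x)%:R end.
Local Notation j := (hull_point kernel_coordinate).

Lemma kernel_coordinate_bounded i : exists M, forall w, `|kernel_coordinate w i| <= M.
Proof.
case: i => x /=; last by exists 1 => w; case: (_ == _); rewrite ?normr1 ?normr0.
exists (hit o x)^-1 => w; rewrite martin_kernelE ger0_norm ?divr_ge0 ?hit_ge0//.
rewrite ler_pdivrMr ?hit_gt0// mulrC ler_pdivlMr ?hit_gt0// mulrC.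
exact: hit_triangle.
Qed.

Lemma kernel_coordinate_isolated w : exists i c, c < kernel_coordinate w i /\
  forall w', w' != w -> kernel_coordinate w' i <= c.
Proof.
exists (inr w), 0; split; first by rewrite /= eqxx.
by move=> w' /negPf /= ->.
Qed.

Lemma martin_hull_extend : all_extend K j.
Proof.
by move=> x; exists (fun g => val g (inl x)) => //; exact: hull_coordinate_continuous.
Qed.

Let jP := hull_compactification kernel_coordinate_bounded kernel_coordinate_isolated.

(** The set where this coordinate is not zero is open and meets T only at x. *)
Lemma hull_boundary0 (eta : pointwise_hull kernel_coordinate) x :
  ~ range j eta -> val eta (inr x) = 0.
Proof.
move=> nj; apply: contrapT => n0.
have [g [[gx0 gx] [w _ wg]]] : ((fun g : pointwise_hull kernel_coordinate =>
    val g (inr x)) @^-1` (~` [set 0]) `\ j x) `&` range j !=set0.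
  apply: hull_dense; first by exists eta; split => // ex; apply: nj; exists x.
  apply: openI.
    apply: open_comp; first by move=> g _; exact: hull_coordinate_continuous.
    apply: closed_openC; exact: closed_eq.
  apply: closed_openC; apply: accessible_closed_set1; apply: hausdorff_accessible.
  exact: hull_hausdorff.
move: gx0; rewrite -wg /=; case: eqVneq => //= wx _.
by apply: gx; rewrite -wg wx.
Qed.

Lemma cylinder_nbhs (eta : pointwise_hull kernel_coordinate) (s : seq (T + T)) eps :
  0 < eps -> nbhs eta [set g : pointwise_hull kernel_coordinate |
    forall i, i \in s -> `|val g i - val eta i| < eps].
Proof.
move=> e0; elim: s => [|i s IH].
  by apply: (@filterS _ _ _ setT) => //; exact: filterT.
have := @hull_coordinate_continuous _ _ _ kernel_coordinate i eta.
move=> /cvgrPdist_lt /(_ _ e0) ci.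
apply: filterS2 ci IH => g gi gs k; rewrite inE => /predU1P[->|]; last exact: gs.
by rewrite distrC.
Qed.

Hypothesis ramT : ramified_at_infinite_degree e.

(** The neighbourhood contains every vertex whose coordinates in a finite set s are
close to those of a preimage eta of xi.  Let S be a finite subtree that contains o
and the indices of s.  On a branch behind an edge (c,z) leaving S the kernels of S
take their values at c, so such a branch is entirely good or entirely bad, and this
depends on c alone.  The good vertices are infinitely many, so some good c carries
infinitely many of them behind it, and one of the branches there is infinite. *)
Lemma martin_nbhd_branch xi (V : set That) : boundary iota xi -> open V -> V xi ->
  exists c z, [/\ e c z, infinite_set (branch e c z) &
    forall w, branch e c z w -> V (iota w)].
Proof.
move=> bxi oV Vxi; case: martinT => iotaP _ /(_ _ _ jP martin_hull_extend)[f cf fj].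
have [eta fe] := dominated_surjective iotaP (hull_compact kernel_coordinate_bounded) cf fj xi.
have nj : ~ range j eta by move=> [w _ we]; apply: bxi; exists w => //; rewrite -fj we.
have /hull_nbhs[s [eps [e0 sV]]] : nbhs eta (f @^-1` V).
  by apply: cf; apply: open_nbhs_nbhs; rewrite fe.
pose A : set T := [set match i with inl x => x | inr x => x end | i in [set` s]].
have [S [fS tS So AS _]] : exists S, [/\ finite_set S, subtree e S, S o, A `<=` S & True].
  apply: (subtree_hull treeT (Q := fun=> True)) => //.
  by apply: finite_image; exact: finite_seq.
pose G := [set w | ~ S w /\
  forall i, i \in s -> `|kernel_coordinate w i - val eta i| < eps].
have infG : infinite_set G.
  move=> fG; have cl : closed (j @` (G `|` S)).
    have /accessible_finite_set_closed fcl :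
        accessible_space (pointwise_hull kernel_coordinate).
      by apply: hausdorff_accessible; exact: hull_hausdorff.
    by apply: fcl; apply: finite_image; rewrite finite_setU.
  have : nbhs eta (~` (j @` (G `|` S))).
    apply: open_nbhs_nbhs; split; first exact: closed_openC.
    by move=> [w _ we]; apply: nj; exists w.
  move=> /filterI /(_ (cylinder_nbhs eta s e0)).
  rewrite nbhsE => -[W [oW We] WU].
  have [g [Wg [w _ wg]]] := hull_dense (ex_intro _ eta We) oW.
  rewrite -wg in Wg; have [nGS ws] := WU _ Wg.
  by apply: nGS; exists w => //; apply: contrapT => h; apply: (h);
    left; split => // Sw; apply: h; right.
pose Q c := [set z | e c z /\ ~ S z].
pose act := [set c | S c /\ exists w z, [/\ G w, Q c z & branch e c z w]].
have [c [[Sc [w0 [z0 [Gw0 [ecz0 Sz0] bw0]]]] infc]] : exists c, act c /\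
    infinite_set (\bigcup_(z in Q c) branch e c z).
  apply: contrapT => no; apply: infG.
  apply: (@sub_finite_set _ _ (\bigcup_(c in act) \bigcup_(z in Q c) branch e c z)).
    move=> w Gw; have [c [z [Sc Sz ecz bw]]] := subtree_exit treeT So Gw.1.
    by exists c; [split => //; exists w, z|exists z].
  apply: bigcup_finite; first by apply: sub_finite_set fS => c [].
  by move=> c ac; apply: contrapT => inf; apply: no; exists c.
have [z [ecz Sz infz]] := infinite_subbranch ramT fS infc.
exists c, z; split => // w bw.
have off v u : e c v -> ~ S v -> S u -> ~ branch e c v u.
  by move=> ecv Sv Su bu; apply: Sv; exact: tS Sc Su ecv bu.
rewrite -fj; apply: sV => i si /=; have Si := AS _ (ex_intro2 _ _ i si erefl).
case: i si Si => x si Sx; last first.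
  have wx : (w == x) = false.
    by apply/negP => /eqP wx; apply: (off z x) => //; rewrite -wx.
  by rewrite /kernel_coordinate wx hull_boundary0// subrr normr0.
have := Gw0.2 _ si; rewrite /kernel_coordinate.
rewrite (kernel_branch ecz0 (off _ _ ecz0 Sz0 So) (off _ _ ecz0 Sz0 Sx) bw0).
by rewrite (kernel_branch ecz (off _ _ ecz Sz So) (off _ _ ecz Sz Sx) bw).
Qed.

(** Convergence to a point near the closure of the branch forces the chain to stay
in the branch from some time on, which has probability zero if hit y x = 1. *)
Lemma support_hit_lt1 x0 x y : harmonic_support Pr iota Zoo x0 = boundary iota ->
  e x y -> infinite_set (branch e x y) -> hit y x < 1.
Proof.
move=> supp exy infb; rewrite lt_neqAle hit_le1 andbT; apply/eqP => h1.
case: martinT => iotaP _ _; case: limZ => mZoo bZoo convZ.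
have [xi [bxi cxi]] := infinite_boundary_point iotaP infb.
have [U [oU clU UB]] := martin_separates exy.
have : harmonic_support Pr iota Zoo x0 xi by rewrite supp.
move=> [_ /(_ U oU (clU _ cxi))].
have [N [mN N0 leftN]] := branch_left_as x0 exy h1.
have [N' [mN' N'0 convN']] := convZ x0.
rewrite /harmonic_measure => lt0; suff : (Pr x0 (N `|` N') = 0)%E.
  move=> NN0; move: lt0; rewrite ltNge => /negP; apply.
  rewrite -NN0; apply: le_measure; rewrite ?inE.
  - rewrite (_ : Zoo @^-1` _ = Zoo @^-1` U); first exact: mZoo.
    by apply/seteqP; split=> [w []|w Uw].
  - exact: measurableU.
  move=> w [Uw _]; have [cw|ncw] := pselect ((fun n => iota (Z n w)) @ \oo --> Zoo w).
    left; apply: leftN.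
    have [k _ hk] : \forall n \near \oo, U (iota (Z n w)).
      by apply: cw; apply: open_nbhs_nbhs.
    by exists k => n kn; apply: UB; exact: hk.
  by right; apply: convN'.
by transitivity (Pr x0 N); first exact: measureU0.
Qed.

(** The chain reaches the root of a branch that is contained in V and then misses
the vertex behind it with positive probability.  Its limit is in the closure of V,
whence the need to choose V with closure inside U. *)
Lemma hit_lt1_support x0 :
  (forall x y, e x y -> infinite_set (branch e x y) -> hit y x < 1) ->
  harmonic_support Pr iota Zoo x0 = boundary iota.
Proof.
move=> lt1; apply/seteqP; split=> [xi []//|xi bxi]; split => // U oU Uxi.
case: (martinT) => iotaP _ _; case: limZ => mZoo bZoo convZ.
case: (iotaP) => cX hX _ _ _.
have [V [oV Vxi] clV] : exists2 V, open_nbhs xi V & closure V `<=` U.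
  have [W Wxi WU] := compact_regular hX cX (filterT : nbhs xi setT)
    (open_nbhs_nbhs (conj oU Uxi)).
  move: Wxi; rewrite nbhsE => -[V oV VW]; exists V => //.
  by apply: subset_trans WU; exact: closure_subset.
have [c [z [ecz infz zV]]] := martin_nbhd_branch bxi oV Vxi.
have [k [s [s0 sk w0]]] := prefix_reach x0 z.
have [mI I0] := impossible_step_null x0.
have [N [mN N0 convN]] := convZ x0.
have mM := prefix_then_miss_measurable c k s.
have : (0 < Pr x0 (prefix_then_miss c k s `\` (impossible_step `|` N)))%E.
  have nul : Pr x0 (prefix_then_miss c k s `&` (impossible_step `|` N)) = 0%E.
    apply/eqP; rewrite eq_le measure_ge0 andbT.
    rewrite -(_ : Pr x0 (impossible_step `|` N) = 0)%E.
      apply: le_measure; rewrite ?inE.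
      - by apply: measurableI => //; exact: measurableU.
      - exact: measurableU.
      - exact: subIsetr.
    by transitivity (Pr x0 impossible_step); first exact: measureU0.
  rewrite measureD//; last 2 first.
  - exact: measurableU.
  - by rewrite ltey_eq fin_num_measure.
  rewrite [X in (_ - X)%E]nul sube0 [ltRHS]prefix_then_miss_prob lte_fin mulr_gt0// subr_gt0 sk.
  exact: lt1.
move=> /lt_le_trans; apply; rewrite /harmonic_measure.
rewrite (_ : Zoo @^-1` (U `&` _) = Zoo @^-1` U); last first.
  by apply/seteqP; split=> [w []|w Uw].
apply: le_measure; rewrite ?inE; last 2 first.
- exact: mZoo.
- move=> w [mw /not_orP[nI nN]]; apply: clV.
  have cw : (fun n => iota (Z n w)) @ \oo --> Zoo w.
    by apply: contrapT => h; apply: nN; exact: convN.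
  move=> W WZ; have [n [Wn kn]] : exists n, W (iota (Z n w)) /\ (k <= n)%N.
    have [l _ hl] : \forall n \near \oo, W (iota (Z n w)) by exact: cw.
    exists (maxn k l); split; last exact: leq_maxl.
    by apply: hl; exact: leq_maxr.
  exists (iota (Z n w)); split => //; apply: zV.
  rewrite -(subnKC kn); exact: survives_in_branch ecz sk mw nI _.
- by apply: measurableD => //; exact: measurableU.
Qed.

End Chain.

(** * Branches as networks *)

Section Reversible.
Variable m : T -> R.
Hypothesis revP : reversing p m.

Let m_gt0 x : 0 < m x. Proof. by case: revP. Qed.

Local Notation a := (conductance p m).

Lemma conductanceC x y : a x y = a y x.
Proof. by case: revP => _; apply. Qed.

Lemma conductance_ge0 x y : 0 <= a x y.
Proof. by rewrite mulr_ge0 ?p_ge0 ?ltW. Qed.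

Lemma conductance_gt0 x y : e x y -> 0 < a x y.
Proof. by move=> /p_gt0 pxy; rewrite mulr_gt0. Qed.

Section Branch.
Variables x y : T.
Hypothesis exy : e x y.
Local Notation B := (branch e x y).
Local Notation q := (restricted_walk a B).

Lemma conductance_branch_sum w : \esum_(z in B) (a w z)%:E =
  ((m w)%:E * \esum_(z in B) (p w z)%:E)%E.
Proof.
rewrite -esumZl; last 2 first.
- exact: ltW.
- by move=> z; rewrite lee_fin p_ge0.
by apply: eq_esum => z _; rewrite EFinM.
Qed.

Lemma P_branch (f : T -> \bar R) w : B w -> w != y ->
  P f w = \esum_(z in B) ((p w z)%:E * f z)%E.
Proof.
move=> Bw wy; rewrite [RHS]esum_mkcond; apply: eq_esum => z _.
case: ifPn => // /negP nBz; rewrite p_eq0 ?mul0e// => ewz.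
by apply: nBz; rewrite inE; apply: (branch_nbr treeT exy) ewz.
Qed.

(** From the root the walk can go to x or stay in the branch. *)
Lemma P_branch_root (f : T -> \bar R) : (forall z, 0 <= f z)%E ->
  P f y = ((p y x)%:E * f x + \esum_(z in B) ((p y z)%:E * f z))%E.
Proof.
move=> f0.
have g0 z : (0 <= (p y z)%:E * f z)%E by rewrite mule_ge0// lee_fin p_ge0.
rewrite /step (esumID B)//.
rewrite setTI addeC; congr (_ + _)%E; apply: esum_single => //.
  by split => //; exact: branch_edge_src.
move=> z [_ nBz] zx; rewrite p_eq0 ?mul0e// => eyz; apply: nBz => /=.
exact: (branch_nest treeT exy eyz zx) (branch_self treeT y z).
Qed.

(** The probability of a step from y into the branch, by which the walk restricted
to the branch divides its steps from y. *)
Definition inner_mass := 1 - p y x.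

Lemma inner_massE : \esum_(z in B) (p y z)%:E = inner_mass%:E.
Proof.
have := P_branch_root (f := fun=> 1%E) (fun=> lee01).
rewrite (P_const y ler01) mule1 (eq_esum (b := fun z => (p y z)%:E)); last first.
  by move=> z _; rewrite mule1.
rewrite /inner_mass; case: (\esum_(z in B) (p y z)%:E)%E => // r [] h.
by congr (_%:E); rewrite h addrAC subrr add0r.
Qed.

Lemma inner_mass_lt1 : inner_mass < 1.
Proof. by rewrite /inner_mass ltrBlDr ltrDl p_gt0// esym. Qed.

Lemma inner_mass_gt0 : infinite_set B -> 0 < inner_mass.
Proof.
move=> iB; rewrite lt_neqAle; apply/andP; split; last first.
  by rewrite -lee_fin -inner_massE; apply: esum_ge0 => z _; rewrite lee_fin p_ge0.
apply/eqP => s0; apply: iB.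
apply: (@sub_finite_set _ _ [set y]); last exact: finite_set1.
move=> w Bw; apply: contrapT => /eqP wy.
have [z [eyz zx Bz]] := branch_decomp treeT exy Bw wy.
have : ((p y z)%:E <= inner_mass%:E)%E.
  rewrite -inner_massE; apply: (@esum_term R T B (fun z => (p y z)%:E)).
    by move=> ?; rewrite lee_fin p_ge0.
  exact: (branch_nest treeT exy eyz zx) (branch_self treeT y z).
by rewrite -s0 lee_fin leNgt p_gt0.
Qed.

Lemma restricted_walk_ge0 w z : 0 <= q w z.
Proof.
rewrite divr_ge0 ?conductance_ge0//; apply: fine_ge0; apply: esum_ge0 => v _.
by rewrite lee_fin conductance_ge0.
Qed.

Lemma restricted_walk_inner w z : B w -> w != y -> q w z = p w z.
Proof.
move=> Bw wy; rewrite /restricted_walk conductance_branch_sum.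
have -> : \esum_(z0 in B) (p w z0)%:E = 1%E.
  rewrite -(P_const w ler01) (P_branch _ Bw wy).
  by apply: eq_esum => ? _; rewrite mule1.
by rewrite mule1/= /conductance mulrAC divff ?mul1r// gt_eqF.
Qed.

Lemma restricted_walk_root z : q y z = p y z / inner_mass.
Proof.
rewrite /restricted_walk conductance_branch_sum inner_massE /= /conductance.
by rewrite -mulf_div divff ?mul1r// gt_eqF.
Qed.

Lemma step_restricted_inner (f : T -> \bar R) w : B w -> w != y ->
  step B q f w = P f w.
Proof.
move=> Bw wy; rewrite (P_branch _ Bw wy); apply: eq_esum => z _.
by rewrite restricted_walk_inner.
Qed.

Lemma step_restricted_root (f : T -> \bar R) : (forall z, 0 <= f z)%E ->
  0 < inner_mass ->
  step B q f y = ((inner_mass^-1)%:E * \esum_(z in B) ((p y z)%:E * f z))%E.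
Proof.
move=> f0 s0; rewrite -esumZl.
- by apply: eq_esum => z _; rewrite restricted_walk_root mulrC EFinM muleA.
- by rewrite invr_ge0 ltW.
- by move=> z; rewrite mule_ge0// lee_fin p_ge0.
Qed.

(** The probability that the walk from y steps into the branch and returns to y. *)
Definition inner_return := fine (\esum_(z in B) ((p y z)%:E * (hit z y)%:E))%E.

Lemma inner_returnE :
  inner_return%:E = \esum_(z in B) ((p y z)%:E * (hit z y)%:E)%E.
Proof.
rewrite fineK// ge0_fin_numE; last first.
  by apply: esum_ge0 => z _; rewrite -EFinM lee_fin mulr_ge0 ?p_ge0 ?hit_ge0.
apply: (@le_lt_trans _ _ inner_mass%:E); last exact: ltry.
rewrite -inner_massE; apply: le_esum => z _.
by rewrite -EFinM lee_fin ler_piMr ?p_ge0 ?hit_le1.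
Qed.

Lemma inner_return_le : inner_return <= inner_mass.
Proof.
rewrite -lee_fin inner_returnE -inner_massE; apply: le_esum => z _.
by rewrite -EFinM lee_fin ler_piMr ?p_ge0 ?hit_le1.
Qed.

(** First-step decomposition at y: the walk goes to x, or makes an excursion into
the branch and starts over. *)
Lemma hit_root : hit y x * (1 - inner_return) = p y x.
Proof.
have nBx : ~ B x by exact: branch_edge_src.
have yx : y != x by rewrite eq_sym; exact: (edge_neq treeT exy).
have := hit_step yx; rewrite P_branch_root; last first.
  by move=> z; rewrite lee_fin hit_ge0.
rewrite /= hitxx mule1 (eq_esum
  (b := fun z => ((hit y x)%:E * ((p y z)%:E * (hit z y)%:E))%E)); last first.
  by move=> z Bz; rewrite (hit_branch_near exy Bz nBx) -!EFinM; congr EFin; ring.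
rewrite esumZl -?inner_returnE; last 2 first.
- exact: hit_ge0.
- by move=> z; rewrite -EFinM lee_fin mulr_ge0 ?p_ge0 ?hit_ge0.
by rewrite -EFinM -EFinD => -[]; lra.
Qed.

(** Both sides say that some excursions into the branch never return. *)
Lemma hit_root_lt1 : (hit y x < 1) = (inner_return < inner_mass).
Proof.
have := hit_root; have := inner_return_le; have := inner_mass_lt1.
have : 0 < p y x by rewrite p_gt0// esym.
rewrite /inner_mass; set h := hit y x; set U := inner_return => p0 sl Ul hU.
by apply/idP/idP => hlt; nra.
Qed.

(** If excursions lose mass, a multiple of hit^~ y is a supersolution of the
equation of the restricted Green function with pole y. *)
Lemma green_root_lty : infinite_set B -> hit y x < 1 ->
  forall w, B w -> (green B q w y < +oo)%E.
Proof.
move=> iB; rewrite hit_root_lt1 => Us w Bw.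
have s0 := inner_mass_gt0 iB.
(* the constant for which the inequality at y is an equality *)
pose C := inner_mass / (inner_mass - inner_return).
have C0 : 0 <= C by rewrite divr_ge0 ?ltW// subr_gt0.
apply: (@le_lt_trans _ _ (C * hit w y)%:E); last exact: ltry.
rewrite -[leLHS]mul1e.
apply: (green_minimal restricted_walk_ge0 (f := fun w => (C * hit w y)%:E)) => //.
  by move=> z; rewrite lee_fin mulr_ge0// hit_ge0.
move=> {w Bw}w Bw.
have [->|wy] := eqVneq w y.
  rewrite step_restricted_root//; last first.
    by move=> z; rewrite lee_fin mulr_ge0// hit_ge0.
  rewrite (eq_esum (b := fun z => (C%:E * ((p y z)%:E * (hit z y)%:E))%E));
    last by move=> z _; rewrite -!EFinM; congr EFin; ring.
  rewrite esumZl -?inner_returnE//; last first.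
    by move=> z; rewrite -EFinM lee_fin mulr_ge0 ?p_ge0 ?hit_ge0.
  rewrite hitxx -!EFinM -EFinD lee_fin le_eqVlt; apply/orP; left; apply/eqP.
  have -> : (true%:R : R) = 1 by [].
  by rewrite /C; field; rewrite ?gt_eqF// subr_gt0.
rewrite mule0 add0e step_restricted_inner//.
have -> : (fun w => (C * hit w y)%:E) = (fun w => (C%:E * (EFin \o hit^~ y) w)%E).
  by apply/funext => z; rewrite EFinM.
by rewrite stepZ// ?hit_step// => [|z]; [exact: p_ge0|rewrite lee_fin hit_ge0].
Qed.

(** If excursions lose no mass, the restricted walk returns to y almost surely, and
its finite expected number of visits g would satisfy 1 + g <= g. *)
Lemma green_root_recurrent : infinite_set B -> (green B q y y < +oo)%E ->
  hit y x < 1.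
Proof.
move=> iB Gfin; rewrite hit_root_lt1 ltNge; apply/negP => sU.
have s0 := inner_mass_gt0 iB.
have {sU}Us : inner_return = inner_mass by apply/eqP; rewrite eq_le inner_return_le.
have G0 w : (0 <= green B q w y)%E by exact: green_ge0 restricted_walk_ge0 _ _.
pose g := fine (green B q y y).
have gE : g%:E = green B q y y by rewrite fineK// ge0_fin_numE.
have g0 : 0 <= g by rewrite -lee_fin gE.
have Gh z : B z -> ((g * hit z y)%:E <= green B q z y)%E.
  move=> Bz.
  pose f w := if `[< B w >] then green B q w y else (g * hit w y)%:E.
  suff : ((g * hit z y)%:E <= f z)%E by rewrite /f asboolT.
  apply: hit_minimal => //.
  - by move=> w; rewrite /f; case: ifP => // _; rewrite lee_fin mulr_ge0// hit_ge0.
  - by rewrite /f asboolT ?gE//; exact: branch_self.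
  move=> w wy; rewrite {2}/f; case: asboolP => Bw.
    rewrite greenE; last exact: restricted_walk_ge0.
    rewrite (negbTE wy) add0e step_restricted_inner//.
    apply: le_P_local => v ewv; rewrite /f asboolT//; exact: (branch_nbr treeT exy) ewv.
  rewrite EFinM -(hit_step wy) -stepZ//; last 2 first.
  - exact: p_ge0.
  - by move=> v; rewrite lee_fin hit_ge0.
  apply: le_P_local => v ewv /=; rewrite /f; case: asboolP => [Bv|_]; last first.
    by rewrite EFinM.
  have evw : e v w by rewrite esym.
  by have [-> _] := branch_cross treeT exy evw Bv Bw; rewrite hitxx mule1 gE.
have : (1 + g%:E <= g%:E)%E.
  rewrite {2}gE greenE; last exact: restricted_walk_ge0.
  rewrite eqxx; apply: leeD => //.
  apply: (@le_trans _ _ (step B q (fun z => (g * hit z y)%:E) y)); last first.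
    apply: le_step; first exact: restricted_walk_ge0.
    by move=> z Bz; exact: Gh.
  rewrite step_restricted_root//; last first.
    by move=> z; rewrite lee_fin mulr_ge0// hit_ge0.
  rewrite (eq_esum (b := fun z => (g%:E * ((p y z)%:E * (hit z y)%:E))%E));
    last by move=> z _; rewrite -!EFinM; congr EFin; ring.
  rewrite esumZl -?inner_returnE//; last first.
    by move=> z; rewrite -EFinM lee_fin mulr_ge0 ?p_ge0 ?hit_ge0.
  by rewrite Us -!EFinM lee_fin mulrCA mulVf ?mulr1// gt_eqF.
by rewrite -EFinD lee_fin; lra.
Qed.

(** Finiteness passes from the pole u to a neighbouring pole v, since each visit to
v is followed by a step to u with probability q v u. *)
Lemma branch_transient : infinite_set B -> hit y x < 1 -> transient_on B q.
Proof.
move=> iB hlt.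
suff : forall v, B v -> forall w, B w -> (green B q w v < +oo)%E.
  by move=> h w v Bw Bv; exact: h.
apply: (branch_ind treeT exy); first exact: green_root_lty.
move=> u v euv Bu Bv Gu w Bw.
have qvu : 0 < q v u.
  have pvu : 0 < p v u by rewrite p_gt0// esym.
  have [vy|vy] := eqVneq v y; last by rewrite restricted_walk_inner.
  by move: pvu; rewrite vy restricted_walk_root => ?; rewrite divr_gt0 ?inner_mass_gt0.
have nle n z : (nstep B q n z v * (q v u)%:E <= nstep B q n.+1 z u)%E.
  elim: n z => [|n IH] z.
    rewrite /=; case: eqVneq => [->|_]; last first.
      by rewrite mul0e; apply: step_ge0 => [|?]; [exact: restricted_walk_ge0|
        rewrite lee_fin].
    rewrite mul1e.
    apply: le_trans (@esum_term _ _ B (fun t => (q v t)%:E * ((t == u)%:R)%:E)%E u _ Bu).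
      by rewrite eqxx mule1.
    by move=> t; rewrite -EFinM lee_fin mulr_ge0// restricted_walk_ge0.
  rewrite nstepS muleC -stepZ; last 3 first.
  - exact: restricted_walk_ge0.
  - exact: ltW.
  - by move=> t; exact: nstep_ge0 restricted_walk_ge0 _ _ _.
  rewrite [leRHS]nstepS; apply: le_step; first exact: restricted_walk_ge0.
  by move=> t _; rewrite muleC; exact: IH.
rewrite ltey; apply/eqP => Gv.
have : ((q v u)%:E * green B q w v <= green B q w u)%E.
  rewrite /green -nneseriesZl; last by move=> n _; exact: nstep_ge0 restricted_walk_ge0 _ _ _.
  rewrite [leRHS]nneseries_recS; last by move=> n; exact: nstep_ge0 restricted_walk_ge0 _ _ _.
  apply: le_trans (leeDr _ _); last by rewrite lee_fin.
  by apply: lee_nneseries => n _; [move=> _; rewrite mule_ge0 ?lee_fin ?restricted_walk_ge0//;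
    exact: nstep_ge0 restricted_walk_ge0 _ _ _|rewrite muleC; exact: nle].
rewrite Gv gt0_muley ?lte_fin// leye_eq => /eqP Gu'.
by have := Gu w Bw; rewrite Gu'.
Qed.

End Branch.

Lemma restricted_walkT : restricted_walk a [set: T] = p.
Proof.
apply/funext => w; apply/funext => z; rewrite /restricted_walk.
rewrite (eq_esum (b := fun z => ((m w)%:E * (p w z)%:E)%E)); last by [].
rewrite esumZl ?p_sum ?ltW//; last by move=> ?; rewrite lee_fin p_ge0.
by rewrite mule1/= /conductance mulrAC divff ?mul1r// gt_eqF.
Qed.

(** In (i) the two vertices are arbitrary.  When they coincide the branch is the
whole tree, transient by assumption; otherwise the branch is cut off by an edge. *)
Lemma transient_branchesP : transient p ->
  (forall x y, infinite_set (branch e x y) ->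
      transient_on (branch e x y) (restricted_walk a (branch e x y))) <->
  (forall x y, e x y -> infinite_set (branch e x y) -> hit y x < 1).
Proof.
move=> trP; split=> [h x y exy iB|h x y iB].
  apply: green_root_recurrent => //; apply: h => //; exact: branch_self.
have [->|xy] := eqVneq x y; first by rewrite branch_refl// restricted_walkT.
have [x' ex'y bE] := branch_edge treeT xy; rewrite bE in iB *.
by apply: branch_transient => //; exact: h.
Qed.

(** * Fluxes *)

Lemma m_dirichlet_hyp : (forall x, (0 : R) <= m x) /\
  (forall x, [set: T] x -> (\esum_(y in [set: T]) (p x y)%:E <= 1)%E).
Proof. by split=> x; [exact: ltW|rewrite p_sum]. Qed.

Lemma esum_nbr (h : T -> R) z : (forall y, 0 <= h y) ->
  \esum_(y in [set y | e z y]) (a z y * h y)%:E =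
  ((m z)%:E * P (EFin \o h) z)%E.
Proof.
move=> h0; rewrite /step -esumZl; last 2 first.
- exact: ltW.
- by move=> y; rewrite -EFinM lee_fin mulr_ge0 ?p_ge0.
rewrite esum_mkcond; apply: eq_esum => y _ /=.
rewrite -!EFinM; case: ifPn => [_|/negP nzy]; first by rewrite /conductance mulrA.
by rewrite p_eq0 ?mul0r ?mulr0// => ezy; apply: nzy; rewrite inE.
Qed.

Section CanonicalFlux.
Hypothesis trP : transient p.
Variable x : T.

Definition rgreen w : R := fine (green [set: T] p w x).

Lemma rgreenE w : (rgreen w)%:E = green [set: T] p w x.
Proof.
rewrite fineK// ge0_fin_numE; last exact: (green_ge0 _ p_ge0).
exact: trP.
Qed.

Lemma rgreen_ge0 w : 0 <= rgreen w.
Proof. by rewrite -lee_fin rgreenE; exact: (green_ge0 _ p_ge0). Qed.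

Lemma rgreen_step w :
  ((rgreen w)%:E = (w == x)%:R%:E + P (EFin \o rgreen) w)%E.
Proof.
rewrite rgreenE greenE; last exact: p_ge0.
by congr (_ + _)%E; apply: eq_esum => z _; rewrite /= rgreenE.
Qed.

(** The walk from w accumulates visits to x only after it has reached x. *)
Lemma rgreen_hit w : rgreen w = rgreen x * hit w x.
Proof.
have le1 v : rgreen x * hit v x <= rgreen v.
  rewrite -lee_fin; apply: (hit_minimal (f := EFin \o rgreen)) => //.
  - exact: rgreen_ge0.
  - by move=> z; rewrite lee_fin rgreen_ge0.
  - by move=> z zx; rewrite /= rgreen_step (negbTE zx) add0e.
apply/eqP; rewrite eq_le le1 andbT -lee_fin rgreenE -[leLHS]mul1e.
apply: (green_minimal p_ge0 (f := fun v => (rgreen x * hit v x)%:E)) => //.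
  by move=> z; rewrite lee_fin mulr_ge0 ?rgreen_ge0 ?hit_ge0.
move=> v _; rewrite mul1e.
have [->|vx] := eqVneq v x.
  rewrite hitxx mulr1 [leRHS]rgreen_step eqxx; apply: leeD => //.
  by apply: le_P_local => z _; rewrite lee_fin.
rewrite add0e EFinM -(hit_step vx) -stepZ; last 3 first.
- exact: p_ge0.
- exact: rgreen_ge0.
- by move=> z; rewrite lee_fin hit_ge0.
by apply: le_P_local => z _; rewrite EFinM.
Qed.

Lemma rgreen_gt0 w : 0 < rgreen w.
Proof.
rewrite rgreen_hit mulr_gt0 ?hit_gt0//.
have : (1%:E <= (rgreen x)%:E)%E.
  rewrite rgreen_step eqxx leeDl//; apply: step_ge0; first exact: p_ge0.
  by move=> z; rewrite lee_fin rgreen_ge0.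
by rewrite lee_fin; apply: lt_le_trans.
Qed.

(** Truncated Green functions have bounded energy; pass to the limit. *)
Lemma rgreen_energy :
  (dirichlet [set: T] p m rgreen <= (2 * (m x * rgreen x))%:E)%E.
Proof.
have [m0 ps] := m_dirichlet_hyp.
have sym w v : [set: T] w -> [set: T] v -> m w * p w v = m v * p v w.
  by move=> _ _; exact: conductanceC.
pose g n := rtruncated [set: T] p n x.
have gle n w : g n w <= rgreen w.
  rewrite -lee_fin rtruncatedE// ?rgreenE; last exact: p_ge0.
  by apply: le_truncated_green; exact: p_ge0.
have gcvg w : g ^~ w @ \oo --> rgreen w.
  apply: fine_cvg; rewrite rgreenE.
  apply: is_cvg_nneseries => n _ _; exact: (nstep_ge0 _ p_ge0).
have c0 w v t : 0 <= m w * p w v * t ^+ 2.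
  by rewrite mulr_ge0 ?sqr_ge0// mulr_ge0 ?p_ge0.
rewrite /dirichlet esum_esum; last by move=> *; rewrite lee_fin.
apply: (@le_esum_limit _ _ _ (fun n k =>
   m k.1 * p k.1 k.2 * (g n k.1 - g n k.2) ^+ 2)).
  move=> [w v] /=; apply: cvgM; first exact: cvg_cst.
  have : (fun n => g n w - g n v) @ \oo --> rgreen w - rgreen v.
    by apply: cvgB; exact: gcvg.
  by move=> h; under eq_fun do rewrite expr2; rewrite expr2; apply: cvgM.
move=> n; rewrite -(esum_esum (a := fun w v =>
  (m w * p w v * (g n w - g n v) ^+ 2)%:E)); last first.
  by move=> *; rewrite lee_fin.
apply: le_trans (@dirichlet_rtruncated R T [set: T] p m p_ge0 m0 ps sym n x I) _.
by rewrite lee_fin ler_wpM2l// ler_wpM2l// gle.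
Qed.

(** The flux is the gradient of G(.,x), normalized.  Its divergence is given by the
first-step decomposition, its energy is finite by [rgreen_energy], and on an edge
(z,y) away from x it does not vanish because G(y,x) = F(y,z) G(z,x). *)
Lemma flux_exists :
  (forall x y, e x y -> infinite_set (branch e x y) -> hit y x < 1) ->
  exists2 phi, flux_to_infinity e a x phi & supported_on_infinite_branches e x phi.
Proof.
move=> h2; pose phi z y := a z y * rgreen z / m x - a z y * rgreen y / m x.
have phiE z y : phi z y = a z y * (rgreen z - rgreen y) / m x.
  by rewrite /phi mulrBr mulrBl.
exists phi; last first.
  move=> z y ezy bx iB; rewrite phiE !mulf_neq0 ?invr_eq0 ?gt_eqF//.
    exact: p_gt0.
  rewrite subr_gt0 (rgreen_hit y) (hit_branch_far ezy (branch_self treeT z y) bx).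
  rewrite mulrCA -rgreen_hit; have := h2 z y ezy iB; have := rgreen_gt0 z; nra.
split.
- by move=> z y ezy; rewrite !phiE (conductanceC y z); field; rewrite gt_eqF.
- move=> z.
  have Pu : P (EFin \o rgreen) z = (rgreen z - (z == x)%:R)%:E.
    have := rgreen_step z; case: (P (EFin \o rgreen) z) => // r [] ->.
    by congr EFin; rewrite addrAC subrr add0r.
  have -> : (z == x)%:R = m z * rgreen z / m x - m z * (rgreen z - (z == x)%:R) / m x.
    case: eqVneq => [->|_]; last by rewrite subr0 subrr.
    by rewrite -mulrBl -mulrBr; field; rewrite gt_eqF.
  have ar0 u v : 0 <= a z u * rgreen v / m x.
    apply: divr_ge0; last exact: ltW.
    by apply: mulr_ge0; [exact: conductance_ge0|exact: rgreen_ge0].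
  apply: has_sumB.
  + by move=> y; exact: ar0.
  + by move=> y; exact: ar0.
  + have k0 y : (fun=> rgreen z / m x) y >= 0 :> R by rewrite divr_ge0 ?rgreen_ge0 ?ltW.
    have := esum_nbr z k0; rewrite (P_const z (k0 z)) -EFinM mulrA => <-.
    by apply: eq_esum => y _; rewrite mulrA.
  + have k0 y : rgreen y / m x >= 0 by rewrite divr_ge0 ?rgreen_ge0 ?ltW.
    have E := esum_nbr z k0.
    rewrite (eq_esum (b := fun y => (a z y * (rgreen y / m x))%:E)); last first.
      by move=> y _; rewrite mulrA.
    rewrite E.
    have -> : P (EFin \o (fun y => rgreen y / m x)) z =
        ((m x)^-1%:E * P (EFin \o rgreen) z)%E.
      rewrite -stepZ; last 3 first.
      * exact: p_ge0.
      * by rewrite invr_ge0 ltW.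
      * by move=> y; rewrite lee_fin rgreen_ge0.
      by apply: eq_esum => y _; rewrite /= mulrC EFinM.
    by rewrite Pu -!EFinM; congr EFin; ring.
- apply: (@le_lt_trans _ _ ((m x ^- 2)%:E * dirichlet [set: T] p m rgreen)%E).
    have c0 w v : (0 <= (m w * p w v * (rgreen w - rgreen v) ^+ 2)%:E)%E.
      by rewrite lee_fin mulr_ge0 ?sqr_ge0// mulr_ge0 ?p_ge0 ?ltW.
    rewrite /dirichlet esum_esum// -esumZl//; last by rewrite invr_ge0 sqr_ge0.
    have k0 (k : T * T) : (0 <= (m x ^- 2)%:E *
        (m k.1 * p k.1 k.2 * (rgreen k.1 - rgreen k.2) ^+ 2)%:E)%E.
      by rewrite mule_ge0// lee_fin invr_ge0 sqr_ge0.
    apply: (@le_trans _ _ (\esum_(k in [set zy : T * T | e zy.1 zy.2]) ((m x ^- 2)%:E *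
        (m k.1 * p k.1 k.2 * (rgreen k.1 - rgreen k.2) ^+ 2)%:E))%E); last first.
      by apply: le_esum_sub.
    apply: le_esum => -[z y] /= ezy; rewrite -EFinM lee_fin phiE /conductance.
    rewrite le_eqVlt; apply/orP; left; apply/eqP; field.
    by rewrite !gt_eqF ?p_gt0.
  apply: (@le_lt_trans _ _ ((m x ^- 2)%:E * (2 * (m x * rgreen x))%:E)%E).
    by apply: lee_wpmul2l; [rewrite lee_fin invr_ge0 sqr_ge0|exact: rgreen_energy].
  by rewrite -EFinM ltry.
Qed.

End CanonicalFlux.

Section FluxTransience.
Variables (z y : T) (psi : T -> T -> R) (E : R).
Hypothesis ezy : e z y.
Local Notation B := (branch e z y).
Hypothesis iB : infinite_set B.
Hypothesis antisym : forall u v, e u v -> psi u v = - psi v u.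
Hypothesis div0 : forall w, B w -> has_sum [set v | e w v] (psi w) 0.
Hypothesis energy : (\esum_(zy in [set zy : T * T | e zy.1 zy.2])
  (psi zy.1 zy.2 ^+ 2 / a zy.1 zy.2)%:E <= E%:E)%E.
Hypothesis psi_gt0 : 0 < psi y z.
Local Notation q := (restricted_walk a B).

Let mB w := fine (\esum_(v in B) (a w v)%:E)%E.

Let mBE w : (mB w)%:E = \esum_(v in B) (a w v)%:E.
Proof.
rewrite fineK// ge0_fin_numE; last first.
  by apply: esum_ge0 => v _; rewrite lee_fin conductance_ge0.
rewrite conductance_branch_sum; apply: (@le_lt_trans _ _ ((m w)%:E * 1)%E).
  apply: lee_wpmul2l; first by rewrite lee_fin ltW.
  rewrite -(p_sum w); apply: le_esum_sub => // v; by rewrite lee_fin p_ge0.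
by rewrite mule1 ltry.
Qed.

Let mB_ge0 w : 0 <= mB w.
Proof.
by rewrite -lee_fin mBE; apply: esum_ge0 => v _; rewrite lee_fin conductance_ge0.
Qed.

Let mB_gt0 w : B w -> 0 < mB w.
Proof.
move=> Bw; rewrite -lte_fin mBE conductance_branch_sum.
have [->|wy] := eqVneq w y.
  by rewrite (inner_massE ezy) -EFinM lte_fin mulr_gt0// inner_mass_gt0.
have -> : \esum_(v in B) (p w v)%:E = 1%E.
  rewrite -(P_const w ler01) (P_branch ezy _ Bw wy).
  by apply: eq_esum => ? _; rewrite mule1.
by rewrite mule1 lte_fin.
Qed.

Let mBq w v : B w -> mB w * q w v = a w v.
Proof.
by move=> Bw; rewrite /restricted_walk -/(mB w) mulrC divfK// gt_eqF ?mB_gt0.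
Qed.

Let qsub w : B w -> (\esum_(v in B) (q w v)%:E <= 1)%E.
Proof.
move=> Bw; rewrite (eq_esum (b := fun v => ((mB w)^-1%:E * (a w v)%:E)%E)); last first.
  by move=> v _; rewrite -EFinM mulrC.
rewrite esumZl ?invr_ge0//; last by move=> v; rewrite lee_fin conductance_ge0.
by rewrite -mBE -EFinM mulVf// gt_eqF ?mB_gt0.
Qed.

Let msym w v : B w -> B v -> mB w * q w v = mB v * q v w.
Proof. by move=> Bw Bv; rewrite !mBq// conductanceC. Qed.

Let c w v := if e w v then Num.max (psi w v) 0 else 0.

Let c_ge0 w v : 0 <= c w v.
Proof. by rewrite /c; case: ifP => // _; rewrite le_max lexx orbT. Qed.

Let balance w : B w -> exists2 s : R, \esum_(v in [set: T]) (c w v)%:E = s%:E &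
  \esum_(v in [set: T]) (c v w)%:E = s%:E.
Proof.
move=> Bw; have [s [t [sE tE st]]] := has_sum_posneg (div0 Bw).
have {}st : t = s by apply/eqP; rewrite eq_sym -subr_eq0 -st.
exists s.
  rewrite -sE [RHS]esum_mkcond; apply: eq_esum => v _ /=.
  by rewrite /c; case: ifPn => ewv; [rewrite mem_set|rewrite memNset//; exact/negP].
rewrite -st -tE [RHS]esum_mkcond; apply: eq_esum => v _ /=.
rewrite /c esym; case: ifPn => ewv; last by rewrite memNset//; exact/negP.
by rewrite mem_set// (antisym (u := v)) ?opprK// esym.
Qed.

Let inner_split w (f : T -> R) : B w -> (forall v, 0 <= f v) ->
  (forall v, ~ e w v -> f v = 0) ->
  \esum_(v in [set: T]) (f v)%:E =
    (\esum_(v in B) (f v)%:E + (if w == y then f z else 0)%:E)%E.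
Proof.
move=> Bw f0 fe; rewrite (esumID B)//; last by move=> v _; rewrite lee_fin.
rewrite setTI; congr (_ + _)%E; rewrite setTI.
have out v : ~ B v -> f v != 0 -> w = y /\ v = z.
  move=> nBv fv; apply: (branch_cross treeT ezy) => //.
  by apply: contrapT => /fe fv0; rewrite fv0 eqxx in fv.
case: eqVneq => [wy|wy].
  apply: (@esum_single _ _ _ (fun v => (f v)%:E)).
  - by rewrite lee_fin.
  - exact: branch_edge_src.
  - move=> v nBv vz; congr EFin; apply/eqP/negPn/negP => /(out _ nBv)[_ vz'].
    by rewrite vz' eqxx in vz.
apply: esum1 => v nBv; congr EFin; apply/eqP/negPn/negP => /(out _ nBv)[wy' _].
by rewrite wy' eqxx in wy.
Qed.

Let energyB :
  (\esum_(w in B) \esum_(v in B) (c w v ^+ 2 / a w v)%:E <= E%:E)%E.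
Proof.
have k0 w v : (0 <= (c w v ^+ 2 / a w v)%:E)%E.
  by rewrite lee_fin divr_ge0 ?sqr_ge0 ?conductance_ge0.
rewrite esum_esum//; apply: le_trans energy.
rewrite [leRHS]esum_mkcond [leLHS]esum_mkcond; apply: le_esum => -[w v] _ /=.
have r0 : (0 <= if (w, v) \in [set zy : T * T | e zy.1 zy.2] then
   (psi w v ^+ 2 / a w v)%:E else 0)%E.
  by case: ifP => // _; rewrite lee_fin divr_ge0 ?sqr_ge0 ?conductance_ge0.
case: ifP => // _; rewrite /c; case: ifPn => ewv; last first.
  by rewrite expr0n mul0r.
rewrite mem_set// lee_fin ler_wpM2r ?invr_ge0 ?conductance_ge0//.
by case: (leP (psi w v) 0) => h; rewrite ?expr0n ?sqr_ge0.
Qed.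

(** Multiply the balance of incoming and outgoing flow at w by f w and sum over the
branch: what leaves through (y,z) is at most the sum of |f v - f w| * c w v, where c
is the positive part of psi.  The arithmetic-geometric mean inequality with weight t
then separates the energy of psi from that of f.  Square summability of f makes the
sums finite, so that the common part can be cancelled. *)
Lemma flux_bound (f : T -> R) : (forall w, 0 <= f w) ->
  (\esum_(w in B) (mB w * f w ^+ 2)%:E < +oo)%E ->
  forall t, 0 < t ->
  ((f y * psi y z)%:E <= (t * E)%:E + t^-1%:E * dirichlet B q mB f)%E.
Proof.
move=> f0 l2 t t0.
have fc0 u w v : 0 <= f u * c w v by rewrite mulr_ge0.
pose X := \esum_(w in B) \esum_(v in B) (f w * c w v)%:E.
pose W := \esum_(w in B) \esum_(v in B) (`|f v - f w| * c w v)%:E.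
have L : (\esum_(w in B) ((f w)%:E * \esum_(v in [set: T]) (c w v)%:E) =
    X + (f y * psi y z)%:E)%E.
  rewrite (eq_esum (b := fun w => (\esum_(v in B) (f w * c w v)%:E +
    (f w * (if w == y then c w z else 0))%:E)%E)); last first.
    move=> w Bw; rewrite (inner_split Bw)//; last by move=> v /negP; rewrite /c => /negbTE ->.
    rewrite ge0_muleDr ?lee_fin//; last 2 first.
    - by apply: esum_ge0 => v _; rewrite lee_fin.
    - by case: ifP.
    rewrite -esumZl//; last by move=> v; rewrite lee_fin.
  rewrite esumD; last 2 first.
  - by move=> w _; apply: esum_ge0 => v _; rewrite lee_fin.
  - by move=> w _; rewrite lee_fin; case: ifP => _; rewrite ?mulr0.
  congr (_ + _)%E; rewrite (esum_single (i := y)).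
  - rewrite eqxx /c esym ezy max_l//; exact: ltW.
  - by rewrite lee_fin; case: ifP => _; rewrite ?mulr0.
  - exact: branch_self.
  - by move=> w _ /negbTE ->; rewrite mulr0.
have Rr : (\esum_(w in B) ((f w)%:E * \esum_(v in [set: T]) (c v w)%:E) =
    \esum_(w in B) \esum_(v in B) (f v * c w v)%:E)%E.
  rewrite [RHS]esum_exchange; last by move=> *; rewrite lee_fin.
  apply: eq_esum => w Bw; rewrite (inner_split Bw)//; last first.
    by move=> v nwv; rewrite /c esym; case: ifP.
  have -> : (if w == y then c z w else 0) = 0.
    case: eqP => // ->; rewrite /c ezy; apply/max_idPr.
    by rewrite antisym// oppr_le0 ltW.
  by rewrite adde0 -esumZl// => v; rewrite lee_fin.
have RL : (X + (f y * psi y z)%:E = \esum_(w in B) \esum_(v in B) (f v * c w v)%:E)%E.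
  rewrite -L -Rr; apply: eq_esum => w Bw.
  by have [s -> ->] := balance Bw.
have aC w v : e w v -> 0 < a w v by exact: conductance_gt0.
have amgm w v (s r : R) : 0 < s -> 0 <= r -> r * c w v <= s * (c w v ^+ 2 / a w v) +
    s^-1 * (a w v * r ^+ 2).
  move=> s0 r0; have [ewv|ewv] := boolP (e w v); last first.
    rewrite {1 2}/c (negbTE ewv) mulr0 expr0n mul0r mulr0 add0r.
    by rewrite mulr_ge0 ?invr_ge0 ?(ltW s0)// mulr_ge0 ?sqr_ge0 ?conductance_ge0.
  move: (a w v) (c w v) (aC _ _ ewv) (c_ge0 w v) => A C A0 C0.
  have -> : s * (C ^+ 2 / A) + s^-1 * (A * r ^+ 2) =
      ((s * C) ^+ 2 + (A * r) ^+ 2) / (s * A).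
    by field; rewrite !gt_eqF.
  rewrite ler_pdivlMr ?mulr_gt0//.
  have := sqr_ge0 (s * C - A * r).
  have : 0 <= s * C * (A * r) by rewrite !mulr_ge0// ltW.
  nra.
have l2E : \esum_(w in B) \esum_(v in B) (a w v * f w ^+ 2)%:E =
    \esum_(w in B) (mB w * f w ^+ 2)%:E.
  apply: eq_esum => w Bw; rewrite EFinM mBE muleC -esumZl ?sqr_ge0//.
    by apply: eq_esum => v _; rewrite -EFinM mulrC.
  by move=> v; rewrite lee_fin conductance_ge0.
have amgmB (s : R) (r : T -> T -> R) : 0 < s -> (forall w v, 0 <= r w v) ->
    (\esum_(w in B) \esum_(v in B) (r w v * c w v)%:E <=
     (s * E)%:E + s^-1%:E * \esum_(w in B) \esum_(v in B) (a w v * r w v ^+ 2)%:E)%E.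
  move=> s0 r0.
  have k0 w v : (0 <= (c w v ^+ 2 / a w v)%:E)%E.
    by rewrite lee_fin divr_ge0 ?sqr_ge0 ?conductance_ge0.
  have k1 w v : (0 <= (a w v * r w v ^+ 2)%:E)%E.
    by rewrite lee_fin mulr_ge0 ?sqr_ge0 ?conductance_ge0.
  apply: (@le_trans _ _ (s%:E * (\esum_(w in B) \esum_(v in B) (c w v ^+ 2 / a w v)%:E) +
      s^-1%:E * \esum_(w in B) \esum_(v in B) (a w v * r w v ^+ 2)%:E)%E); last first.
    by apply: leeD2r; rewrite EFinM; apply: lee_wpmul2l; [rewrite lee_fin ltW|].
  rewrite -!esumZl ?invr_ge0 ?(ltW s0)//; last 2 first.
  - by move=> w; apply: esum_ge0.
  - by move=> w; apply: esum_ge0.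
  rewrite -esumD; last 2 first.
  - by move=> w _; rewrite mule_ge0 ?esum_ge0// lee_fin ltW.
  - by move=> w _; rewrite mule_ge0 ?esum_ge0// lee_fin invr_ge0 ltW.
  apply: le_esum => w Bw.
  rewrite -!esumZl ?invr_ge0 ?(ltW s0)// -esumD; last 2 first.
  - by move=> v _; rewrite mule_ge0// lee_fin ltW.
  - by move=> v _; rewrite mule_ge0// lee_fin invr_ge0 ltW.
  by apply: le_esum => v Bv; rewrite -!EFinM -EFinD lee_fin amgm.
have Xfin : (X < +oo)%E.
  apply: le_lt_trans (amgmB 1 (fun w _ => f w) ltr01 (fun w _ => f0 w)) _.
  rewrite l2E invr1 mul1e; apply: lte_add_pinfty => //; exact: ltry.
have X0 : (0 <= X)%E.
  by apply: esum_ge0 => w _; apply: esum_ge0 => v _; rewrite lee_fin.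
have XW : (\esum_(w in B) \esum_(v in B) (f v * c w v)%:E <= X + W)%E.
  rewrite -esumD; last 2 first.
  - by move=> w _; apply: esum_ge0 => v _; rewrite lee_fin.
  - by move=> w _; apply: esum_ge0 => v _; rewrite lee_fin mulr_ge0.
  apply: le_esum => w _; rewrite -esumD; last 2 first.
  - by move=> v _; rewrite lee_fin.
  - by move=> v _; rewrite lee_fin mulr_ge0.
  apply: le_esum => v _; rewrite -EFinD lee_fin -mulrDl ler_wpM2r//.
  by rewrite -lerBlDl ler_norm.
have {XW}XW : ((f y * psi y z)%:E <= W)%E.
  by move: XW; rewrite -RL leeD2lE// ge0_fin_numE.
apply: (le_trans XW).
apply: le_trans (amgmB t (fun w v => `|f v - f w|) t0 (fun w v => normr_ge0 _)) _.
apply: leeD2l; apply: lee_wpmul2l; first by rewrite lee_fin invr_ge0 ltW.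
apply: le_esum => w Bw; apply: le_esum => v Bv.
by rewrite lee_fin mBq// real_normK ?num_real// -sqrrN opprB.
Qed.

(** Apply [flux_bound] to the truncated Green functions of the branch.  Their energy
is at most a multiple of their value at y, which a suitable t absorbs; so they are
bounded at y independently of the truncation. *)
Lemma positive_flux_hit_lt1 : hit y z < 1.
Proof.
have E0 : 0 <= E.
  rewrite -lee_fin; apply: le_trans energy; apply: esum_ge0 => -[u v] _.
  by rewrite lee_fin divr_ge0 ?sqr_ge0 ?conductance_ge0.
have q0 := restricted_walk_ge0 z y.
have By : B y by exact: branch_self.
apply: green_root_recurrent => //.
(* with this weight the energy of f is worth at most half of f y * psi y z *)
pose t := 4 * mB y / psi y z.
have t0 : 0 < t by rewrite divr_gt0 ?mulr_gt0 ?mB_gt0.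
apply: (@le_lt_trans _ _ (2 * t * E / psi y z)%:E); last exact: ltry.
apply: le_nneseries => [n|n]; first exact: nstep_ge0.
rewrite -/(truncated_green B q n y y) -(rtruncatedE q0 qsub)//.
set f := rtruncated B q n y.
have := flux_bound (rtruncated_ge0 B q0 n y)
  (rtruncated_l2 q0 mB_ge0 qsub msym n By) t0.
have := dirichlet_rtruncated q0 mB_ge0 qsub msym n By.
rewrite -/f; have f0 : 0 <= f y by exact: rtruncated_ge0.
have : (0 <= dirichlet B q mB f)%E.
  apply: esum_ge0 => w _; apply: esum_ge0 => v _.
  by rewrite lee_fin mulr_ge0 ?sqr_ge0// mulr_ge0.
case: (dirichlet B q mB f) => [D| |] // _.
rewrite -EFinM -EFinD !lee_fin => h1 h2.
rewrite ler_pdivlMr//.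
have h3 : t^-1 * D <= f y * psi y z / 2.
  apply: (@le_trans _ _ (t^-1 * (2 * (mB y * f y)))).
    by rewrite ler_wpM2l// invr_ge0 ltW.
  rewrite le_eqVlt; apply/orP; left; apply/eqP; rewrite /t.
  by field; rewrite !gt_eqF// mB_gt0.
lra.
Qed.

End FluxTransience.

(** If the flux enters the branch, reverse its sign. *)
Lemma flux_edge_hit_lt1 x phi z y : flux_to_infinity e a x phi ->
  e z y -> ~ branch e z y x -> infinite_set (branch e z y) -> phi z y != 0 ->
  hit y z < 1.
Proof.
move=> [asym div en] ezy nx iB phi0.
have fin : \esum_(zy in [set zy : T * T | e zy.1 zy.2])
    (phi zy.1 zy.2 ^+ 2 / a zy.1 zy.2)%:E \is a fin_num.
  rewrite ge0_fin_numE//; apply: esum_ge0 => -[u v] _.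
  by rewrite lee_fin divr_ge0 ?sqr_ge0 ?conductance_ge0.
have div0 w : branch e z y w -> has_sum [set v | e w v] (phi w) 0.
  by move=> Bw; have := div w; case: eqVneq Bw => [->|].
have pyz : phi y z = - phi z y by rewrite asym// esym.
case: (ltrgt0P (phi z y)) phi0 => // phi0 _.
  apply: (@positive_flux_hit_lt1 z y (fun u v => - phi u v) _ ezy iB _ _ (_ : _ <= (fine _)%:E)%E).
  - by move=> u v euv; rewrite asym.
  - by move=> w Bw; rewrite -oppr0; apply: has_sumN; exact: div0.
  - rewrite fineK; last exact: fin.
    by apply: le_esum => -[u v] _ /=; rewrite sqrrN.
  - by rewrite pyz opprK.
apply: (@positive_flux_hit_lt1 z y phi _ ezy iB asym div0 (_ : _ <= (fine _)%:E)%E).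
- by rewrite fineK; last exact: fin.
- by rewrite pyz oppr_gt0.
Qed.

Hypothesis ramT : ramified_at_infinite_degree e.

(** Follow a ray through (u,v) up to an edge that points away from x; the flux is
nonzero there, so the walk crosses it back with probability less than one.  If u
were reached almost surely from v, it would also be from beyond that edge. *)
Lemma supported_flux_hit_lt1 x phi : flux_to_infinity e a x phi ->
  supported_on_infinite_branches e x phi ->
  forall u v, e u v -> infinite_set (branch e u v) -> hit v u < 1.
Proof.
move=> fphi sphi u v euv iB.
have [g [rayg g0 g1]] := ray_exists treeT ramT euv iB.
have [N hN] := ray_leaves treeT rayg x.
have [eN _ iN] := rayg N.
have nx : ~ branch e (g N) (g N.+1) x by exact: hN.
have lt1 : hit (g N.+1) (g N) < 1.
  by apply: (flux_edge_hit_lt1 fphi) => //; exact: sphi.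
rewrite lt_neqAle hit_le1 andbT; apply/eqP => h1.
have bN : branch e u v (g N.+1).
  have : branch e (g 0%N) (g 1%N) (g N.+1).
    by apply: (ray_nest treeT rayg (leq0n N)); exact: branch_self.
  by rewrite g0 g1.
have := hit_one_branch euv h1 bN.
have nu : ~ branch e (g N) (g N.+1) u by rewrite -g0; exact: (ray_notin treeT rayg).
rewrite (hit_branch_far eN (branch_self treeT _ _) nu).
have := hit_le1 (g N) u; have := hit_ge0 (g N) u.
have := hit_ge0 (g N.+1) (g N); nra.
Qed.

(** * Unbounded harmonic functions *)

Section Potential.
Variable g : nat -> T.
Hypothesis rayg : ray e g.
Local Notation B n := (branch e (g n) (g n.+1)).

Definition ray_bound w := sval (cid (ray_leaves treeT rayg w)).

Lemma ray_boundP w n : (ray_bound w <= n)%N -> ~ B n w.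
Proof. by rewrite /ray_bound; case: cid => N /= hN; exact: hN. Qed.

(** Each edge of the ray contributes its resistance to the vertices behind it. *)
Definition ray_partial N w : R :=
  \sum_(n < N) (if `[< B n w >] then (a (g n) (g n.+1))^-1 else 0).

(** The potential of a unit current along the ray. *)
Definition ray_potential w : R := ray_partial (ray_bound w) w.

Lemma ray_potentialE w N : (forall n, (N <= n)%N -> ~ B n w) ->
  ray_potential w = ray_partial N w.
Proof.
have key M K v : (M <= K)%N -> (forall n, (M <= n)%N -> ~ B n v) ->
    ray_partial K v = ray_partial M v.
  move=> MK hM; rewrite /ray_partial -(subnKC MK).
  elim: (K - M)%N => [|j IH]; first by rewrite addn0.
  rewrite addnS big_ord_recr /= IH asboolF ?addr0//; apply: hM; exact: leq_addr.
move=> hN; rewrite /ray_potential; have [le|lt] := leqP (ray_bound w) N.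
  by rewrite -(key _ _ _ le)//; exact: ray_boundP.
by rewrite (key _ _ _ (ltnW lt)).
Qed.

Lemma ray_potential_out w : ~ B 0%N w -> ray_potential w = 0.
Proof.
move=> nB; rewrite (@ray_potentialE w 0%N) ?/ray_partial ?big_ord0// => n n0 Bn.
by apply: nB; exact: (ray_nest treeT rayg (leq0n n)).
Qed.

Lemma ray_potential1 : ray_potential (g 1%N) = (a (g 0%N) (g 1%N))^-1.
Proof.
rewrite (@ray_potentialE _ 1%N); last by move=> n; exact: (ray_notin treeT rayg).
by rewrite /ray_partial big_ord1 asboolT//; exact: branch_self.
Qed.

(** The indicator of each branch along the ray creates defects at the two ends of
its edge; weighted by the resistances they telescope, and only the one at the start
of the ray is left. *)
Lemma ray_potential_mean u :
  has_sum [set: T] (fun v => p u v * ray_potential v)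
    (ray_potential u + (u == g 0%N)%:R / m u).
Proof.
set N := ray_bound u.
have uB n : (N <= n)%N -> ~ B n u by exact: ray_boundP.
have ug n : (N < n)%N -> u != g n.
  case: n => // n Nn; apply/eqP => un; apply: (uB n) => //.
  by rewrite un; exact: branch_self.
have vB v : e u v -> forall n, (N.+1 <= n)%N -> ~ B n v.
  move=> euv n Nn Bv; have [en _ _] := rayg n.
  have evu : e v u by rewrite esym.
  have [_ uE] := branch_cross treeT en evu Bv (uB n (ltnW Nn)).
  by move: (ug n Nn); rewrite -uE eqxx.
have -> : ray_potential u = ray_partial N.+1 u.
  by apply: ray_potentialE => n /ltnW; exact: uB.
apply: (eq_has_sum (f := fun v => p u v * ray_partial N.+1 v)).
  move=> v _; have [euv|/p_eq0 ->] := pselect (e u v); last by rewrite !mul0r.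
  by rewrite (ray_potentialE (vB v euv)).
have term K : has_sum [set: T] (fun v => p u v * ray_partial K v)
    (ray_partial K u + ((u == g 0%N)%:R - (u == g K)%:R) / m u).
  elim: K => [|K IH].
    rewrite subrr mul0r addr0 {2}/ray_partial big_ord0.
    apply: (eq_has_sum (f := fun=> 0)).
      by move=> v _; rewrite /ray_partial big_ord0 mulr0.
    by apply: has_sum_ge0 => //; rewrite esum1.
  have [eK _ _] := rayg K.
  have h := has_sumZ (a (g K) (g K.+1))^-1 (branch_indicator_mean eK u).
  have := has_sumD IH h.
  have -> : ray_partial K u + ((u == g 0%N)%:R - (u == g K)%:R) / m u +
    (a (g K) (g K.+1))^-1 * ((`[< B K u >])%:R + (u == g K)%:R * p (g K) (g K.+1)
      - (u == g K.+1)%:R * p (g K.+1) (g K)) =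
    ray_partial K.+1 u + ((u == g 0%N)%:R - (u == g K.+1)%:R) / m u.
    rewrite {2}/ray_partial big_ord_recr /= -/(ray_partial K u).
    have pK : p (g K) (g K.+1) != 0 by rewrite gt_eqF// p_gt0.
    have pK' : p (g K.+1) (g K) != 0 by rewrite gt_eqF// p_gt0// esym.
    have [uK|uK] := eqVneq u (g K).
      rewrite uK (negbTE (edge_neq treeT eK)) asboolF; last exact: branch_edge_src.
      rewrite /= mulr0n mulr1n /conductance; field.
      by rewrite pK gt_eqF.
    have [uK1|uK1] := eqVneq u (g K.+1).
      rewrite uK1 asboolT; last exact: branch_self.
      rewrite conductanceC /= mulr0n mulr1n /conductance; field.
      by rewrite pK' gt_eqF.
    by case: asbool; rewrite /= ?mulr0n ?mulr1n; ring.
  apply: eq_has_sum => v _.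
  rewrite /ray_partial big_ord_recr /= mulrDr; congr (_ + _).
  by case: asbool; rewrite ?mulr1 ?mulr0// mulrC.
have := term N.+1; rewrite (_ : (u == g N.+1) = false) ?subr0//.
by apply/negbTE; exact: ug.
Qed.

End Potential.

(** Two rays from x, one through y and one on the other side: in the difference of
their potentials the defects at x cancel.  The other side is infinite because
transience forces hit x y < 1, whereas a finite branch is left almost surely. *)
Lemma unbounded_harmonic_exists x y : transient p -> e x y ->
  infinite_set (branch e x y) -> hit y x = 1 ->
  exists2 h, harmonic_function p h & h y != h x.
Proof.
move=> trP exy iB h1.
have eyx : e y x by rewrite esym.
have iB' : infinite_set (branch e y x).
  move=> fB; have := transient_hit_lt1 trP (edge_neq treeT exy).
  by rewrite h1 (finite_branch_hit eyx fB) mulr1 ltxx.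
have [z [exz zy iz]] := infinite_child treeT ramT eyx iB'.
have [g1 [ray1 g10 g11]] := ray_exists treeT ramT exy iB.
have [g2 [ray2 g20 g21]] := ray_exists treeT ramT exz iz.
exists (fun w => ray_potential ray1 w - ray_potential ray2 w).
  move=> u; have := meanB (ray_potential_mean ray1 u) (ray_potential_mean ray2 u).
  by congr has_sum; rewrite g10 g20; ring.
have nx1 : ~ branch e (g1 0%N) (g1 1%N) x by rewrite g10 g11; exact: branch_edge_src.
have nx2 : ~ branch e (g2 0%N) (g2 1%N) x by rewrite g20 g21; exact: branch_edge_src.
have ny2 : ~ branch e (g2 0%N) (g2 1%N) y.
  rewrite g20 g21; apply: (branch_disjoint treeT exy exz); first by rewrite eq_sym.
  exact: branch_self.
have E1 : ray_potential ray1 y = (a x y)^-1 by rewrite -g10 -g11 ray_potential1.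
rewrite (ray_potential_out ray1 nx1) (ray_potential_out ray2 nx2) E1.
rewrite (ray_potential_out ray2 ny2).
by rewrite subr0 subrr invr_eq0 gt_eqF// conductance_gt0.
Qed.

(** If hit y x = 1, bounded harmonic functions cannot tell x from y, so
[three_point_charge] has the weak mean value property, but not the strong one. *)
Lemma transient_of_mean_value (o : T) : transient p ->
  (forall mu : {charge set (discrete_space o) -> \bar R},
    finite_support_charge mu -> weak_mean_value p mu <-> strong_mean_value p mu) ->
  forall x y, e x y -> infinite_set (branch e x y) -> hit y x < 1.
Proof.
move=> trP h5 x y exy iB; rewrite lt_neqAle hit_le1 andbT; apply/eqP => h1.
have [h hh hxy] := unbounded_harmonic_exists trP exy iB h1.
pose mu := three_point_charge R o y x.
have dev k : mean_deviation k mu o = (k y - k x)%:E.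
  rewrite /mean_deviation three_point_integral three_point_chargeE !in_setT.
  by rewrite subrr add0r mul1e -EFinB addrK.
have fmu : finite_support_charge mu.
  apply: (@sub_finite_set _ _ [set` undup [:: y; x; o]]); last exact: finite_seq.
  move=> w /= /eqP mw; apply/negPn/negP => /(@three_point_out R T o y x w).
  exact: mw.
have weak : weak_mean_value p mu.
  move=> k hk bk; rewrite dev (bounded_harmonic_recurrent hk bk h1).
  by rewrite subrr.
have /(h5 mu fmu) strong := weak.
have := strong h hh (charge_integrable_finite (undup_uniq _) (@three_point_out R T o y x) h).
rewrite dev => -[] /eqP; rewrite subr_eq0.
by rewrite (negbTE hxy).
Qed.

End Reversible.
End NearestNeighbourWalk.

(** * The equivalences *)
Theorem corollary12 (R : realType) (T : countType) (e : rel T)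
    (p : T -> T -> R) (m : T -> R) (o : T)
    (d : measure_display) (Omega : measurableType d)
    (Pr : T -> probability Omega R) (Z : nat -> Omega -> T)
    (That : topologicalType) (iota : T -> That) (Zoo : Omega -> That)
    (treeT : is_tree e)
    (ramT : ramified_at_infinite_degree e)
    (markovP : markov_operator p)
    (nnP : nearest_neighbour e p)
    (irrP : irreducible p)
    (transP : transient p)
    (revP : reversing p m)
    (chainZ : markov_chain Pr Z p)
    (martinT : martin_compactification (martin_kernel Pr Z o) iota)
    (limZ : boundary_limit Pr Z iota Zoo) :
  [<->
    (* (i) *)
    forall x y, infinite_set (branch e x y) ->
      transient_on (branch e x y)
        (restricted_walk (conductance p m) (branch e x y));
    (* (ii) *)
    forall x y, e x y -> infinite_set (branch e x y) -> hitting Pr Z y x < 1;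
    (* (iii) *)
    exists x, harmonic_support Pr iota Zoo x = boundary iota;
    forall x, harmonic_support Pr iota Zoo x = boundary iota;
    (* (iv) *)
    exists x, exists2 phi, flux_to_infinity e (conductance p m) x phi &
      supported_on_infinite_branches e x phi;
    forall x, exists2 phi, flux_to_infinity e (conductance p m) x phi &
      supported_on_infinite_branches e x phi]
  /\
  ((exists xi eta, [/\ boundary iota xi, boundary iota eta & xi <> eta]) ->
    ((forall x y, infinite_set (branch e x y) ->
       transient_on (branch e x y)
         (restricted_walk (conductance p m) (branch e x y)))
     <->
     (* (v) *)
     (forall mu : {charge set (discrete_space o) -> \bar R},
        finite_support_charge mu ->
        (weak_mean_value p mu <-> strong_mean_value p mu)))).
Proof.
have hitZ x y : hitting Pr Z x y = hit p x y by exact: hittingE.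
have iii : (forall x y, infinite_set (branch e x y) ->
      transient_on (branch e x y)
        (restricted_walk (conductance p m) (branch e x y))) <->
    (forall x y, e x y -> infinite_set (branch e x y) -> hit p y x < 1).
  exact: transient_branchesP.
have support x : (forall u v, e u v -> infinite_set (branch e u v) -> hit p v u < 1) ->
    harmonic_support Pr iota Zoo x = boundary iota.
  exact: (hit_lt1_support treeT markovP nnP chainZ martinT limZ ramT).
have unsupport x : harmonic_support Pr iota Zoo x = boundary iota ->
    forall u v, e u v -> infinite_set (branch e u v) -> hit p v u < 1.
  move=> supp u v.
  exact: (support_hit_lt1 treeT markovP nnP chainZ transP martinT limZ supp).
split; last first.
  move=> _; rewrite iii; split.
  - exact: mean_value_of_transient.
  - exact: (transient_of_mean_value treeT markovP nnP revP ramT transP).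
tfae.
- by move=> /iii h x y; rewrite hitZ; exact: h.
- move=> h; exists o; apply: support => x y exy ixy.
  by rewrite -hitZ; exact: h.
- by move=> [x0 /unsupport lt1] x; exact: support.
- by move=> supp; exists o; apply: flux_exists => //; exact: unsupport (supp o).
- move=> [x0 [phi fphi sphi]] x; apply: flux_exists => //.
  exact: (supported_flux_hit_lt1 treeT markovP nnP revP ramT fphi sphi).
- move=> /(_ o)[phi fphi sphi]; apply/iii.
  exact: (supported_flux_hit_lt1 treeT markovP nnP revP ramT fphi sphi).
Qed.
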